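(* Let $\boldsymbol\gamma$ be finite-intersection weights of finite order $\omega$, let $\eta\in\mathbb N$ satisfy $|\{u\in\mathcal U:\gamma_u>0,\ i\in u\}|\le\eta$ for all $i\in\mathbb N$, and put $d=\eta(\omega-1)+1$. Let $\boldsymbol a=(a,a,\dots)$ with $a\in D$ and $\sum_{u\in\mathcal U}\gamma_uk(a,a)^{|u|}<\infty$. Assume that for all $n\in\mathbb N$ there exists a randomized linear algorithm $Q_n(\omega',f)=\sum_{i=1}^nw_if(\boldsymbol x^{(i)}(\omega'))$, $\omega'\in\Omega^d$, with $w_i\in\mathbb R$, $\boldsymbol x^{(i)}(\omega')\in D^d$ and $\sum_{i=1}^nw_i=1$, which satisfies condition ( * ) for the set of all subsets of $[d]$, and that there are constants $\alpha,\beta,C_d$ independent of $n$ such that $$\mathrm{Var}(Q_n(f_u))\le C_d\,n^{-\alpha}\ln(n)^\beta\,\|f_u\|_{k_u}^2\quad\text{for all }u\subseteq[d],\ f_u\in H_u.$$ Let $\$(\nu)=O(\nu^s)$ for some $s>0$. Then for every $\delta>0$ there exist constants $C=C(d,\delta)$ and $N_0$ such that for every $N\ge N_0$ one can choose $m$, $L_1<\dots<L_m$, $n_1\ge\dots\ge n_m$ and building blocks $Q_{v_k,\boldsymbol a}$, $k=1,\dots,m$, which satisfy condition ( * ) for $\{u\subseteq v_k:\gamma_u>0\}$, $\sum_{j=1}^{n_k}w_{j,k}=1$, and $$\mathrm{Var}(Q_{v_k,\boldsymbol a}(f_{u}))\le C_d\,n_k^{-\alpha}\ln(n_k)^\beta\,\|f_{u}\|_{k_{u}}^2\quad\text{for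 all }u\subseteq v_k\text{ with }\gamma_u>0,\ f_u\in H_u,$$ such that the resulting multilevel algorithm $Q$ has cost at most $N$ in the variable subspace sampling model and $$e(Q,B(K))^2\le C\,N^{-\alpha+\delta}\quad\text{if }\mathrm{decay}_{\boldsymbol\gamma}\ge1+\alpha s,$$ $$e(Q,B(K))^2\le C\,N^{-\frac{\mathrm{decay}_{\boldsymbol\gamma}-1}{s}+\delta}\quad\text{if }1+\alpha s>\mathrm{decay}_{\boldsymbol\gamma}>1.$$
   Context: **Function spaces.** $[n]=\{1,\dots,n\}$; $\mathcal U$ is the set of all finite subsets of $\mathbb N$. $D\subseteq\mathbb R$, $\rho$ is a probability measure on $D$, $\mu=\bigotimes_{n\in\mathbb N}\rho$ on $D^{\mathbb N}$. For a reproducing kernel $L$, $H(L)$ is its reproducing kernel Hilbert space, $\|\cdot\|_L$ its norm, $B(L)$ its closed unit ball. $k\neq0$ is a measurable reproducing kernel on $D\times D$ with $H(k)\cap H(1)=\{0\}$ ($H(1)$: constant functions), $M:=\int_D k(x,x)\,\rho(dx)<\infty$, $\int_D k(x,y)\,\rho(dx)=0$ for all $y\in D$, and $k(a,a)>0$ for all $a\in D$. The weights $\boldsymbol\gamma=(\gamma_u)_{u\in\mathcal U}$ are non-negative with $\gamma_\emptyset=1$ and $\sum_{u\in\mathcal U}\gamma_uM^{|u|}<\infty$. Put $k_u(\boldsymbol x,\boldsymbol y)=\prod_{j\in u}k(x_j,y_j)$ ($k_\emptyset=1$), $H_u=H(k_u)$ (functions in $H_u$ depend only on the coordinates in $u$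 and are identified with functions on $D^u$, or on $D^w$ for $w\supseteq u$), $\mathfrak X=\{\boldsymbol x\in D^{\mathbb N}:\sum_{u\in\mathcal U}\gamma_uk_u(\boldsymbol x,\boldsymbol x)<\infty\}$ (one has $\mu(\mathfrak X)=1$), and $K=\sum_{u\in\mathcal U}\gamma_uk_u$ on $\mathfrak X\times\mathfrak X$. $I(f)=\int_{\mathfrak X}f\,d\mu$ for $f\in H(K)$. **Weights.** Finite-order weights of order $\omega$: $\gamma_u=0$ whenever $|u|>\omega$. Finite-intersection weights: finite-order weights for which there is $\varrho\in\mathbb N$ with $|\{v\in\mathcal U:\gamma_v>0,\ u\cap v\ne\emptyset\}|\le1+\varrho$ for all $u$ with $\gamma_u>0$ (equivalently, an $\eta$ as in the claim exists). $\widehat\gamma_u=\gamma_uk(a,a)^{|u|}$; $u_1,u_2,\dots$ is an ordering of the (infinitely many) non-empty $u\in\mathcal U$ with $\gamma_u>0$ such that $\widehat\gamma_{u_1}\ge\widehat\gamma_{u_2}\ge\cdots$; $\mathrm{decay}_{\boldsymbol\gamma}=\sup\{q\in\mathbb R:\lim_{j\to\infty}\widehat\gamma_{u_j}j^q=0\}$. **Condition ( * ).** $(\Omega,\Sigma,\mathbb P)$ denotes a probability space. For a finite index set $w$, random points $\boldsymbol t^{(i)}:\Omega^w\to D^w$ (with product measure $\mathbb P^w$ on $\Omega^w$) satisfy condition ( * ) for a collection $\mathcal V$ of subsets of $w$ if for all $u\in\mathcal V$, $j\in u$ and all $i$ the $j$th coordinate $t^{(i)}_j(\omega')$ depends only on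 $\omega'_j$ and is distributed according to $\rho$. **Multilevel algorithm.** For natural numbers $L_1<\dots<L_m$ put $v_0=\emptyset$, $v_k=\bigcup_{j\in[L_k]}u_j$. $(\boldsymbol x_v;\boldsymbol a)$ is the point with coordinates $x_j$ for $j\in v$ and $a_j$ for $j\notin v$; $(\Psi_kf)(\boldsymbol x)=f(\boldsymbol x_{v_k};\boldsymbol a)$ for $k\ge1$, $\Psi_0=0$. For $n_1\ge\dots\ge n_m$ the building blocks are randomized linear algorithms $Q_{v_k,\boldsymbol a}(f)=\sum_{j=1}^{n_k}w_{j,k}f(\boldsymbol t^{(j,k)}_{v_k};\boldsymbol a)$ with $w_{j,k}\in\mathbb R$ and random $\boldsymbol t^{(j,k)}_{v_k}\in D^{v_k}$. The multilevel algorithm is $Q(f)=\sum_{k=1}^mQ_{v_k,\boldsymbol a}(f-\Psi_{k-1}f)$, the $m$ summands being independent. **Cost and error.** $\$:\mathbb N\cup\{0\}\to[0,\infty)$ is monotone increasing. For strictly increasing sequences $\mathbf v=(v_i')_{i\in\mathbb N}$ of non-empty sets in $\mathcal U$ and an anchor $\boldsymbol a\in\mathfrak X$, let $c_{\mathbf v,\boldsymbol a}(\boldsymbol x)=\inf\{\$(|v_i'|): x_j=a_j\ \forall j\notin v_i'\}$ ($\inf\emptyset=\infty$). The cost of $Q$ in the variable subspace sampling model is $\inf_{\mathbf v,\boldsymbol a}\sup_{f\in B(K)}\mathbb E(\text{sum of }c_{\mathbf v,\boldsymbol a}(\boldsymbol x)\text{ over all evaluation points }\boldsymbol x\text{ used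 by }Q\text{ on }f)$. The error is $e(Q,B(K))=\big(\sup_{f\in B(K)}\mathbb E((I(f)-Q(f))^2)\big)^{1/2}$. *)

(* Defs.v *)
From HB Require Import structures.
From mathcomp Require Import all_boot all_order all_algebra finmap.
From mathcomp Require Import all_classical all_reals all_analysis.
Set Implicit Arguments.
Unset Strict Implicit.
Unset Printing Implicit Defensive.
Import Order.TTheory GRing.Theory Num.Theory.
Import numFieldTopology.Exports numFieldNormedType.Exports.
Local Open Scope classical_set_scope.
Local Open Scope card_scope.
Local Open Scope ring_scope.

(* A nonempty set D of reals as a type, with the trace of the Borel
   sigma-algebra. The library's measurable types are pointed, hence the point
   a of D, which plays no other role in the structure. *)
Definition dom (R : realType) (D : set R) (a : D) : Type := D.

Section dom_measurable.
Context (R : realType) (D : set R) (a : D).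

HB.instance Definition _ := Choice.copy (dom a) (set_type D).
HB.instance Definition _ := isPointed.Build (dom a) a.

Definition dom_val (x : dom a) : R := \val (x : D).

Let dom_sets := preimage_set_system setT dom_val measurable.

Let dom_sigma : sigma_algebra setT dom_sets.
Proof. exact/sigma_algebra_preimage/sigma_algebra_measurable. Qed.

Let dom0 : dom_sets set0. Proof. by case: dom_sigma. Qed.

Let domC A : dom_sets A -> dom_sets (~` A).
Proof. by case: dom_sigma => _ + _ => /[apply]; rewrite setTD. Qed.

Let domU (F : (set (dom a))^nat) :
  (forall i, dom_sets (F i)) -> dom_sets (\bigcup_i F i).
Proof. by case: dom_sigma => _ _; exact. Qed.

HB.instance Definition _ :=
  isMeasurable.Build default_measure_display (dom a) dom0 domC domU.

End dom_measurable.

Definition anchor (R : realType) (D : set R) (a : D) : nat -> dom a := fun=> a.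

Definition fpower (I T : Type) : Type := I -> T.

Section fpower_measurable.
Context d (I : Type) (T : measurableType d).

HB.instance Definition _ := gen_eqMixin (fpower I T).
HB.instance Definition _ := gen_choiceMixin (fpower I T).
HB.instance Definition _ := isPointed.Build (fpower I T) (fun=> point).

Let fpower_sets : set (set (fpower I T)) :=
  <<s \bigcup_i preimage_set_system setT (fun x : fpower I T => x i) measurable >>.

Let fpower0 : fpower_sets set0. Proof. exact: sigma_algebra0. Qed.

Let fpowerC A : fpower_sets A -> fpower_sets (~` A).
Proof. exact: sigma_algebraC. Qed.

Let fpowerU (F : (set (fpower I T))^nat) :
  (forall i, fpower_sets (F i)) -> fpower_sets (\bigcup_i F i).
Proof. exact: sigma_algebra_bigcup. Qed.

HB.instance Definition _ :=
  isMeasurable.Build default_measure_display (fpower I T) fpower0 fpowerC fpowerU.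

Lemma measurable_coord (i : I) :
  measurable_fun setT (fun x : fpower I T => x i).
Proof.
move=> _ B mB; rewrite setTI; apply: sub_sigma_algebra.
by exists i => //; exists B => //; rewrite setTI.
Qed.

Lemma measurable_fun_fpower d' (X : measurableType d') (f : X -> fpower I T) :
  (forall i, measurable_fun setT (fun x => f x i)) -> measurable_fun setT f.
Proof.
move=> mf; apply: (@measurability _ _ _ _ setT f
  (\bigcup_i preimage_set_system setT (fun x : fpower I T => x i) measurable)) => //.
move=> _ [_ [i _ [B mB <-]] <-].
by rewrite setTI; exact: mf.
Qed.

End fpower_measurable.

(* The product rule on measurable rectangles determines the product measure. *)
Definition is_power (R : realType) d (T : measurableType d) (I : choiceType)
    (P : probability T R) (Q : probability (fpower I T) R) : Prop :=
  forall (s : {fset I}) (A : I -> set T), (forall i, measurable (A i)) ->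
    Q [set x | forall i, i \in s -> A i (x i)] = (\prod_(i <- s) P (A i))%E.

Section finite_power.
Context (R : realType) d (T : measurableType d) (P : probability T R).

Let upd (I : choiceType) (i : I) (p : fpower I T * T) : fpower I T :=
  fun j => if j == i then p.2 else p.1 j.

Let measurable_upd (I : choiceType) (i : I) : measurable_fun setT (upd i).
Proof.
apply: measurable_fun_fpower => j; rewrite /upd.
case: (j == i); first exact: measurable_snd.
exact: (measurableT_comp (@measurable_coord _ _ _ j) measurable_fst).
Qed.

Lemma partial_power_exists (I : choiceType) (s : seq I) : uniq s ->
  exists Q : probability (fpower I T) R,
    forall A : I -> set T, (forall i, measurable (A i)) ->
      Q [set x | forall i, i \in s -> A i (x i)] = (\prod_(i <- s) P (A i))%E.
Proof.
elim: s => [_|i s IH /= /andP[nis us]].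
  exists (dirac (point : fpower I T)) => A mA; rewrite big_nil.
  suff -> : [set x : fpower I T | forall i, i \in [::] -> A i (x i)] = setT.
    exact: probability_setT.
  exact/seteqP.
have [Q QE] := IH us.
pose X : {mfun _ >-> _} := mfun_Sub (mem_set (measurable_upd i)).
exists (distribution (Q \x P)%E X) => A mA.
rewrite /distribution /pushforward /= big_cons.
rewrite [X in (Q \x P)%E X](_ : _ =
    [set x | forall j, j \in s -> A j (x j)] `*` A i); last first.
  apply/seteqP; split => [[x t] /= h|[x t] /= [hx ht] j].
    split => [j js|]; last by have := h i (mem_head _ _); rewrite /upd eqxx.
    have := h j; rewrite inE js orbT => /(_ isT); rewrite /upd.
    by case: eqP => // ji; rewrite -ji js in nis.
  by rewrite inE /upd; case: eqP => [->//|_ /= /hx].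
have mC : measurable [set x : fpower I T | forall j, j \in s -> A j (x j)].
  suff -> : [set x : fpower I T | forall j, j \in s -> A j (x j)] =
      \big[setI/setT]_(j <- s) ((fun x : fpower I T => x j) @^-1` A j).
    apply: bigsetI_measurable => j _; rewrite -[X in measurable X]setTI.
    exact: (@measurable_coord _ _ T j).
  by rewrite -bigcap_seq; apply/seteqP; split => x h j /h.
by rewrite product_measure1E// muleC; congr (_ * _)%E; exact: QE.
Qed.

Lemma power_exists (I : finType) :
  exists Q : probability (fpower I T) R, is_power P Q.
Proof.
have [Q QE] := partial_power_exists (enum_uniq I).
exists Q => s A mA.
pose B i := if i \in s then A i else setT.
have mB i : measurable (B i) by rewrite /B; case: ifP.
have -> : [set x : fpower I T | forall i, i \in s -> A i (x i)] =
    [set x | forall i, i \in enum I -> B i (x i)].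
  apply/seteqP; split => x h i.
    by move=> _; rewrite /B; case: ifP => [/h|].
  by move=> si; have := h i; rewrite /B mem_enum si; exact.
rewrite QE// big_enum/= (big_uniq _ (fset_uniq s))/= [LHS](bigID (mem s))/=.
rewrite [X in (_ * X)%E]big1 ?mule1; last first.
  by move=> i /negbTE; rewrite /B => ->; exact: probability_setT.
by apply: eq_bigr => i si; rewrite /B si.
Qed.

Definition power (I : finType) : probability (fpower I T) R :=
  projT1 (cid (power_exists I)).

Lemma is_power_power (I : finType) : is_power P (power I).
Proof. exact: projT2 (cid (power_exists I)). Qed.

End finite_power.

(* A Hilbert space of real functions on X, given by its underlying set and its
   inner product, in which L has the reproducing property. By Moore-Aronszajn
   it exists for every symmetric positive semidefinite L and is determined by
   L, so a variable of type [rkhs L] stands for H(L). The inner product is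
   meaningful on elements of the space only. *)
Record rkhs (R : realType) (X : Type) (L : X -> X -> R) := Rkhs {
  rk_set : set (X -> R) ;
  rk_dot : (X -> R) -> (X -> R) -> R ;
  rk_norm := fun f => Num.sqrt (rk_dot f f) ;
  rk_zero : rk_set 0 ;
  rk_lin : forall c f g, rk_set f -> rk_set g -> rk_set (c *: f + g) ;
  rk_dotC : forall f g, rk_set f -> rk_set g -> rk_dot f g = rk_dot g f ;
  rk_dot_lin : forall c f g h, rk_set f -> rk_set g -> rk_set h ->
    rk_dot (c *: f + g) h = c * rk_dot f h + rk_dot g h ;
  rk_dot_ge0 : forall f, rk_set f -> 0 <= rk_dot f f ;
  rk_dot_eq0 : forall f, rk_set f -> rk_dot f f = 0 -> f = 0 ;
  rk_complete : forall f_ : nat -> X -> R, (forall n, rk_set (f_ n)) ->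
    (forall e, 0 < e -> exists N, forall i j, (N <= i)%N -> (N <= j)%N ->
      rk_norm (f_ i - f_ j) < e) ->
    exists2 f, rk_set f & rk_norm (f_ n - f) @[n --> \oo] --> 0 ;
  rk_section : forall x, rk_set (L ^~ x) ;
  rk_reproducing : forall f x, rk_set f -> rk_dot f (L ^~ x) = f x }.

Definition unit_ball (R : realType) (X : Type) (L : X -> X -> R)
    (H : rkhs L) : set (X -> R) := [set f | rk_set H f /\ rk_norm H f <= 1].

(* the sum of an absolutely summable family of reals *)
Definition rsum (R : realType) (T : choiceType) (F : T -> R) : R :=
  fine (\esum_(t in setT) ((EFin \o F)^\+ t) -
        \esum_(t in setT) ((EFin \o F)^\- t))%E.

(* Functions in H(K) live on a subset of D^nat only; algorithms and integrals
   see them extended by 0. *)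
Definition zext (R : realType) (T : Type) (X : set T) (f : X -> R) : T -> R :=
  fun x => oapp f 0 (insub x : option X).

Section kernels.
Context (R : realType) (D : Type) (k : D -> D -> R) (gam : {fset nat} -> R).

Definition kprod (u : {fset nat}) (x y : nat -> D) : R :=
  \prod_(j <- u) k (x j) (y j).

Definition Xdom : set (nat -> D) :=
  [set x | (\esum_(u in setT) (gam u * kprod u x x)%:E < +oo)%E].

Definition Kker (x y : Xdom) : R :=
  rsum (fun u => gam u * kprod u (\val x) (\val y)).

Definition ghat (a : D) (u : {fset nat}) : R := gam u * k a a ^+ #|` u|.

End kernels.
Arguments Kker {R D} k gam x y.

Definition finite_order (R : realType) (gam : {fset nat} -> R) (om : nat) :=
  forall u, (om < #|` u|)%N -> gam u = 0.

Definition finite_intersection (R : realType) (gam : {fset nat} -> R) :=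
  exists r : nat, forall u, 0 < gam u ->
    [set v | 0 < gam v /\ (u `&` v != fset0)%fset] #<= `I_(1 + r).

(* The ordering is indexed from 0: [us j] is u_(j+1). *)
Definition weight_ordering (R : realType) (gam gh : {fset nat} -> R)
    (us : nat -> {fset nat}) :=
  [/\ injective us,
      range us = [set u | u != fset0 /\ 0 < gam u] &
      forall i j, (i <= j)%N -> gh (us j) <= gh (us i)].

Definition decay (R : realType) (g : nat -> R) : \bar R :=
  ereal_sup [set q%:E | q in [set q : R |
    g j * j.+1%:R `^ q @[j --> \oo] --> 0]].

(* (x; a): the coordinates in w are those of x, the others those of a. *)
Definition anchored (D : Type) (w : {fset nat}) (x : w -> D) (a : nat -> D) :
  nat -> D := fun j => oapp x (a j) (insub j : option w).

(* (x_v; a) for a point x of D^nat *)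
Definition splice (D : Type) (v : {fset nat}) (x a : nat -> D) : nat -> D :=
  fun j => if j \in v then x j else a j.

Section algorithms.
Context (R : realType) (dO : measure_display) (Om : measurableType dO)
  (P : probability Om R) (dD : measure_display) (D : measurableType dD)
  (rho : probability D R).

Record ralg (w : {fset nat}) (n : nat) := Ralg {
  ra_weight : 'I_n -> R ;
  ra_node : 'I_n -> fpower w Om -> fpower w D ;
  ra_measurable : forall i, measurable_fun setT (ra_node i) }.

(* Nodes in D^w are completed by the anchor. For f depending only on
   coordinates in w this is the evaluation of f as a function on D^w. *)
Definition ra_eval w n (Q : ralg w n) (a : nat -> D) (f : (nat -> D) -> R)
    (o : fpower w Om) : R :=
  \sum_(i < n) ra_weight Q i * f (anchored (ra_node Q i o) a).

Definition condition_star w n (Q : ralg w n) (V : set {fset nat}) :=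
  forall u, V u -> forall j : w, \val j \in u -> forall i : 'I_n,
    (forall o o' : fpower w Om, o j = o' j ->
       ra_node Q i o j = ra_node Q i o' j) /\
    (forall A : set D, measurable A ->
       power P w [set o | A (ra_node Q i o j)] = rho A).

Section multilevel.
Context (us : nat -> {fset nat}) (L n : nat -> nat) (m : nat) (a : nat -> D).

(* [level k] is v_k; [L], [n] and the building blocks are indexed from 0, so
   [L k], [n k] and [Q k] belong to v_(k+1) = [level k.+1]. *)
Definition level (k : nat) : {fset nat} :=
  if k is k'.+1 then \big[fsetU/fset0]_(j < L k') us j else fset0.

Definition Psi (k : nat) (f : (nat -> D) -> R) : (nat -> D) -> R :=
  if k is 0 then (fun=> 0) else (fun x => f (splice (level k) x a)).

(* Giving each building block its own coordinates makes the blocks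
   independent. *)
Definition ml_index : finType := {k : 'I_m & level k.+1}.

Definition ml_seed (o : fpower ml_index Om) (k : 'I_m) :
    fpower (level k.+1) Om :=
  fun j => o (Tagged (fun k : 'I_m => level k.+1) j).

Context (Q : forall k : 'I_m, ralg (level k.+1) (n k)).

Definition ml_eval (f : (nat -> D) -> R) (o : fpower ml_index Om) : R :=
  \sum_(k < m) ra_eval (Q k) a (fun x => f x - Psi k f x) (@ml_seed o k).

(* The evaluation points, with multiplicity; evaluating f - Psi_k f needs two
   of them except for k = 0. *)
Definition ml_points (o : fpower ml_index Om) : seq (nat -> D) :=
  flatten [seq flatten [seq
      let x := anchored (ra_node (Q k) i (@ml_seed o k)) a in
      x :: (if (k : nat) is 0 then [::] else [:: splice (level k) x a])
    | i : 'I_(n k)] | k : 'I_m].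

End multilevel.
End algorithms.

Section cost_error.
Context (R : realType) (D : Type) (price : nat -> R).

Definition nested (v : nat -> {fset nat}) :=
  (forall i, v i != fset0) /\ (forall i, (v i `<` v i.+1)%fset).

Definition point_cost (v : nat -> {fset nat}) (b x : nat -> D) : \bar R :=
  ereal_inf [set (price #|` v i|)%:E | i in
    [set i | forall j, j \notin v i -> x j = b j]].

Context (X : set (nat -> D)) (L : X -> X -> R) (H : rkhs L)
  (d : measure_display) (S : measurableType d) (PS : probability S R).

(* [pts f o]: the points, with multiplicity, at which the algorithm run with
   the seed o evaluates f *)
Definition vcost (pts : (X -> R) -> S -> seq (nat -> D)) : \bar R :=
  ereal_inf [set ereal_sup [set
      (\int[PS]_o \sum_(x <- pts f o) point_cost vb.1 vb.2 x)%E
    | f in unit_ball H] | vb in nested `*` X].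

Definition rerror (I : (X -> R) -> R) (Q : (X -> R) -> S -> R) : \bar R :=
  poweR (ereal_sup [set expectation PS (fun o => (I f - Q f o) ^+ 2)
    | f in unit_ball H]) 2^-1.

End cost_error.

(* Meant for 1 < n: since ln 1 = 0, at n = 1 this is 0 for every be != 0, even
   negative be. *)
Definition variance_bound (R : realType) (C al be : R) (n : nat) : R :=
  C * n%:R `^ (- al) * ln n%:R `^ be.

(* Main.v *)
Require Import Defs.
From HB Require Import structures.
From mathcomp Require Import all_boot all_order all_algebra finmap.
From mathcomp Require Import all_classical all_reals all_analysis.
From mathcomp Require Import measurable_realfun ring lra.
Set Implicit Arguments.
Unset Strict Implicit.
Unset Printing Implicit Defensive.
Import Order.TTheory GRing.Theory Num.Theory.
Import numFieldTopology.Exports numFieldNormedType.Exports.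
Local Open Scope classical_set_scope.
Local Open Scope card_scope.
Local Open Scope ring_scope.

(* Combinations g of sections K(., y) are dense in H(K), so by dominated
   convergence and Fatou's lemma it suffices to bound the error for
   f = sum_j gamma_(u_j) g_(u_j) with finitely many summands, where g_u is the
   same combination of sections of k_u.
   The bias comes from the u_j not meeting v_m, and is at most the tail
   sum_(j > L_m) ghat_(u_j) by Cauchy-Schwarz. The centered contribution of u
   to the k-th block vanishes if u is contained in v_(k-1), so its variance
   carries the factor ghat_(u_j) with j > L_(k-1); contributions of different
   blocks, or of disjoint sets, are uncorrelated, so that finite intersection
   costs only a constant factor.
   The blocks are obtained by coloring: joining two coordinates that lie in a
   common u with gamma_u > 0 gives a graph of degree at most eta (omega - 1),
   so d colors suffice to make the coloring injective on each such u. The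
   coordinate j of a node on v_k is the phi(j)-th coordinate of a node of Q_n,
   driven by the seed of j alone.
   Finally L_k = 2^k and n_k ~ 2^((m - k) s) balance the levels. *)

(** An abstract element of H(K) comes without components f_u, and no orthogonal decomposition of
    H(K) is built. Instead, one list of coefficients and points determines a combination of sections
    for K and for every k_u at once, with norms given by explicit quadratic forms. Bounds are proved
    for such lists and survive two limits: in the number of summands, then in the list. For a fixed
    seed the algorithm only needs pointwise convergence, because it evaluates f at finitely many
    points; these lie in the domain of K, since they differ from the anchor in finitely many
    coordinates and each coordinate lies in finitely many weighted sets. Freezing the coordinates
    outside a level replaces u by its intersection with the level, which may have weight 0. The
    blocks therefore need variance bounds for all subsets of weighted sets; the bound for Q_n on all
    subsets of [d] supplies them. The loss delta pays for three things: the power of the logarithm,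
    the supremum in the definition of the decay, and the number m of levels in the cost. *)

Definition depends_on (I T U : Type) (A : set I) (F : (I -> T) -> U) : Prop :=
  forall x y, (forall i, A i -> x i = y i) -> F x = F y.

(** * Product measures *)

Section power_measure.
Context (R : realType) d (T : measurableType d) (P : probability T R).

(** Rectangles over finite index sets form a pi-system that generates the product sigma-algebra. *)
Lemma power_unique (I : choiceType) (Q Q' : probability (fpower I T) R) :
  is_power P Q -> is_power P Q' -> forall A, measurable A -> Q A = Q' A.
Proof.
move=> hQ hQ' A mA.
pose rect (s : {fset I}) (B : I -> set T) := [set x : fpower I T | forall i, i \in s -> B i (x i)].
pose G := [set C | exists s B, (forall i, measurable (B i)) /\ C = rect s B].
have GT : G setT.
  exists fset0, (fun=> setT); split => //.
  by apply/seteqP; split => x //= _ i; rewrite inE.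
have Gm : G `<=` measurable.
  move=> _ [s [B [mB ->]]].
  rewrite (_ : rect s B = \big[setI/setT]_(j <- s) ((fun x : fpower I T => x j) @^-1` B j)).
    apply: bigsetI_measurable => j _; rewrite -[X in measurable X]setTI.
    exact: (@measurable_coord _ _ T j).
  by rewrite -bigcap_seq; apply/seteqP; split => x h j /h.
apply: (@g_sigma_algebra_measure_unique _ _ _ G Gm (fun=> setT)) => //.
- by rewrite bigcup_const.
- move=> _ _ [s [B [mB ->]]] [s' [B' [mB' ->]]].
  exists (s `|` s')%fset, (fun i => (if i \in s then B i else setT) `&`
    (if i \in s' then B' i else setT)).
  split; first by move=> i; apply: measurableI; case: ifP.
  apply/seteqP; split => x /=.
    by move=> [h h'] i _; split; case: ifP => // /[dup] ? ; [move/h|move/h'].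
  move=> h; split => i si; have := h i; rewrite inE si ?orbT => /(_ isT) [] //.
- by move=> _ [s [B [mB ->]]]; exact: etrans (hQ s B mB) (esym (hQ' s B mB)).
- by move=> _; apply: (le_lt_trans (probability_le1 _ _)); rewrite ?ltry.
- move: mA; apply: sub_smallest2r; first exact: smallest_sigma_algebra.
  move=> C [i _ [B mB <-]].
  exists [fset i]%fset, (fun=> B); split => //.
  apply/seteqP; split => x /=; first by move=> [_ Bx] j; rewrite inE => /eqP ->.
  by move=> h; split=> //; apply: h; rewrite inE.
Qed.

Definition coord_map (I J : Type) (psi : J -> I) (x : fpower I T) : fpower J T :=
  fun j => x (psi j).

Lemma measurable_coord_map (I J : Type) (psi : J -> I) : measurable_fun setT (coord_map psi).
Proof. by apply: measurable_fun_fpower => j; exact: measurable_coord. Qed.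

HB.instance Definition _ (I J : Type) (psi : J -> I) :=
  isMeasurableFun.Build _ _ _ _ (coord_map psi) (measurable_coord_map psi).

Lemma is_power_coord_map (I J : choiceType) (psi : J -> I) (Q : probability (fpower I T) R) :
  injective psi -> is_power P Q -> is_power P (distribution Q (coord_map psi)).
Proof.
move=> psiI hQ s A mA.
(* The constraint at i collects all j in s with psi j = i; by injectivity of [psi] there is at most
   one, so B i is a single A j or everything. *)
pose B i := [set t | forall j, j \in s -> psi j = i -> A j t].
have mB i : measurable (B i).
  have [[j js ji]|nj] := pselect (exists2 j, j \in s & psi j = i).
    rewrite (_ : B i = A j)//; apply/seteqP; split=> t /=; first exact.
    by move=> At j' _; rewrite -ji => /psiI ->.
  rewrite (_ : B i = setT)//; apply/seteqP; split => t //= _ j js ji.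
  by case: nj; exists j.
have := hQ (psi @` s)%fset B mB.
rewrite big_imfset//=; last by move=> ? ? _ _; exact: psiI.
rewrite /distribution /pushforward/=.
have -> : [set x : fpower I T | forall i, i \in (psi @` s)%fset -> B i (x i)] =
   coord_map psi @^-1` [set x | forall i, i \in s -> A i (x i)].
  apply/seteqP; split => x /= h.
    by move=> j js; apply: (h (psi j)) => //; apply/imfsetP; exists j.
  by move=> i _ j js <-; exact: h.
move=> ->; rewrite [LHS]big_seq_cond [RHS]big_seq_cond.
apply: eq_bigr => j; rewrite andbT => js; congr (P _).
apply/seteqP; split=> t /=; first exact.
by move=> At j' _ /psiI ->.
Qed.

Lemma ge0_integral_law d1 d2 (X : measurableType d1) (Y : measurableType d2)
    (QX : probability X R) (QY : probability Y R) (phi : X -> Y) :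
  measurable_fun setT phi ->
  (forall A, measurable A -> QX (phi @^-1` A) = QY A) ->
  forall f : Y -> \bar R, measurable_fun setT f -> (forall y, 0 <= f y)%E ->
  (\int[QX]_x f (phi x) = \int[QY]_y f y)%E.
Proof.
move=> mphi h f mf f0.
rewrite -(@ge0_integral_pushforward _ _ _ _ _ _ mphi QX setT f)//.
by apply: eq_measure_integral => A mA _; exact: h.
Qed.

Lemma integral_law d1 d2 (X : measurableType d1) (Y : measurableType d2)
    (QX : probability X R) (QY : probability Y R) (phi : X -> Y) :
  measurable_fun setT phi ->
  (forall A, measurable A -> QX (phi @^-1` A) = QY A) ->
  forall f : Y -> \bar R, measurable_fun setT f ->
  (\int[QX]_x f (phi x) = \int[QY]_y f y)%E.
Proof.
move=> mphi h f mf.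
have e1 : (\int[QX]_x f^\+ (phi x) = \int[QY]_y f^\+ y)%E.
  by apply: (ge0_integral_law mphi h) => //; exact: measurable_funepos.
have e2 : (\int[QX]_x f^\- (phi x) = \int[QY]_y f^\- y)%E.
  by apply: (ge0_integral_law mphi h) => //; exact: measurable_funeneg.
rewrite [RHS]integralE -e1 -e2 -[LHS]/(\int[QX]_x (f \o phi) x)%E integralE.
by rewrite funepos_comp funeneg_comp.
Qed.

Lemma integrable_law d1 d2 (X : measurableType d1) (Y : measurableType d2)
    (QX : probability X R) (QY : probability Y R) (phi : X -> Y) :
  measurable_fun setT phi ->
  (forall A, measurable A -> QX (phi @^-1` A) = QY A) ->
  forall f : Y -> \bar R, QY.-integrable setT f ->
  QX.-integrable setT (fun x => f (phi x)).
Proof.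
move=> mphi h f /integrableP[mf fi]; apply/integrableP; split.
  exact: (measurableT_comp mf mphi).
rewrite (ge0_integral_law mphi h (f := fun y => `|f y|%E))//.
exact: measurableT_comp.
Qed.

Lemma coord_map_law (I J : choiceType) (psi : J -> I) (Q : probability (fpower I T) R)
    (QJ : probability (fpower J T) R) :
  injective psi -> is_power P Q -> is_power P QJ ->
  forall A, measurable A -> Q (coord_map psi @^-1` A) = QJ A.
Proof.
move=> psiI hQ hQJ A mA.
by rewrite -(power_unique (is_power_coord_map psiI hQ) hQJ mA).
Qed.

Lemma coord_law (I : choiceType) (Q : probability (fpower I T) R) (i : I) :
  is_power P Q -> forall A, measurable A -> Q ((fun x => x i) @^-1` A) = P A.
Proof.
move=> hQ A mA; have := hQ [fset i]%fset (fun=> A) (fun=> mA).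
rewrite big_seq_fset1 => <-; congr (Q _); apply/seteqP; split => x /=.
  by move=> ? j; rewrite inE => /eqP ->.
by apply; rewrite inE.
Qed.

Lemma power_coord_law (I : finType) (i : I) A :
  measurable A -> power P I ((fun x => x i) @^-1` A) = P A.
Proof. by move=> mA; exact: (coord_law i (@is_power_power _ _ _ P I) mA). Qed.

Lemma power_coord_map_law (I J : finType) (psi : J -> I) : injective psi ->
  forall A, measurable A -> power P I (coord_map psi @^-1` A) = power P J A.
Proof.
by move=> psiI; apply: coord_map_law => //; exact: is_power_power.
Qed.

Lemma Rintegral_prob_cst d1 (X : measurableType d1) (QX : probability X R) (c : R) :
  \int[QX]_x c = c.
Proof. by rewrite /Rintegral integral_cst//= probability_setT mule1. Qed.

Section independence.
Context (I : choiceType) (Q : probability (fpower I T) R) (hQ : is_power P Q) (A : set I).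

(** Taking the coordinates in A from one copy and the others from an independent copy gives back the
    law Q. A function of the coordinates in A times a function of the others thus becomes a product
    of functions of separate variables under [Q \x Q], where Fubini applies; this is how
    [power_indep] is obtained. *)
Let merge (p : fpower I T * fpower I T) : fpower I T :=
  fun i => if i \in A then p.1 i else p.2 i.

Let measurable_merge : measurable_fun setT merge.
Proof.
apply: measurable_fun_fpower => i; rewrite /merge; case: (i \in A).
  exact: (measurableT_comp (@measurable_coord _ _ T i) measurable_fst).
exact: (measurableT_comp (@measurable_coord _ _ T i) measurable_snd).
Qed.

Let mmerge : {mfun _ >-> _} := mfun_Sub (mem_set measurable_merge).

Let QQ : probability _ R := (Q \x Q)%E.

Let is_power_merge : is_power P (distribution QQ mmerge).
Proof.
move=> s B mB.
pose B1 i := if i \in A then B i else setT.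
pose B2 i := if i \in A then setT else B i.
rewrite /distribution /pushforward/=.
have mrect (C : I -> set T) : (forall i, measurable (C i)) ->
    measurable [set x : fpower I T | forall i, i \in s -> C i (x i)].
  move=> mC; suff -> : [set x : fpower I T | forall i, i \in s -> C i (x i)] =
      \big[setI/setT]_(j <- s) ((fun x : fpower I T => x j) @^-1` C j).
    apply: bigsetI_measurable => j _; rewrite -[X in measurable X]setTI.
    exact: (@measurable_coord _ _ T j).
  by rewrite -bigcap_seq; apply/seteqP; split => x h j /h.
have mB1 i : measurable (B1 i) by rewrite /B1; case: ifP.
have mB2 i : measurable (B2 i) by rewrite /B2; case: ifP.
rewrite [X in QQ X](_ : _ =
    [set x | forall j, j \in s -> B1 j (x j)] `*` [set x | forall j, j \in s -> B2 j (x j)]);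
      last first.
  apply/seteqP; split => [[x y] /= h|[x y] /= [hx hy] i si].
    by split=> i si; rewrite /B1 /B2; case: ifPn => // iA;
      have := h i si; rewrite /merge ?iA// (negbTE iA).
  by move: (hx _ si) (hy _ si); rewrite /B1 /B2 /merge; case: ifP.
rewrite /QQ/= product_measure1E//; [|exact: mrect..].
rewrite [X in (X * _)%E](_ : _ = (\prod_(i <- s) P (B1 i))%E); last exact: hQ.
rewrite [X in (_ * X)%E](_ : _ = (\prod_(i <- s) P (B2 i))%E); last exact: hQ.
rewrite -big_split/=; apply: eq_bigr => i _.
rewrite /B1 /B2; case: ifP => _; rewrite probability_setT ?mule1 ?mul1e//.
Qed.

Let merge_law B : measurable B -> QQ (merge @^-1` B) = Q B.
Proof. by move=> mB; rewrite -(power_unique is_power_merge hQ mB). Qed.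

Lemma power_indep (F G : fpower I T -> R) :
  depends_on A F -> depends_on (~` A) G ->
  Q.-integrable setT (EFin \o F) -> Q.-integrable setT (EFin \o G) ->
  Q.-integrable setT (EFin \o (fun x => F x * G x)) /\
  \int[Q]_x (F x * G x) = (\int[Q]_x F x) * (\int[Q]_x G x).
Proof.
move=> dF dG iF iG.
have /measurable_EFinP mF := measurable_int _ iF.
have /measurable_EFinP mG := measurable_int _ iG.
have mFG : measurable_fun setT (fun x => F x * G x) by exact: measurable_funM.
have mFG2 : measurable_fun setT (fun p : fpower I T * fpower I T => (F p.1 * G p.2)%:E).
  apply/measurable_EFinP; apply: measurable_funM.
    exact: (measurableT_comp mF measurable_fst).
  exact: (measurableT_comp mG measurable_snd).
have E p : F (merge p) * G (merge p) = F p.1 * G p.2.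
  congr (_ * _).
    by apply: dF => i Ai; rewrite /merge mem_set.
  by apply: dG => i Ai; rewrite /merge memNset.
have iFG2 : QQ.-integrable setT (fun p : fpower I T * fpower I T => (F p.1 * G p.2)%:E).
  apply/(integrable12ltyP _ _ mFG2).
  under eq_integral => x _ do under eq_integral => y _ do rewrite /= normrM EFinM.
  under eq_integral => x _.
    rewrite ge0_integralZl//; last by apply/measurable_EFinP; exact: measurableT_comp.
    over.
  rewrite /= ge0_integralZr//; [|by apply/measurable_EFinP;
    exact: measurableT_comp|by apply: integral_ge0].
  have /integrableP[_ /=] := iF; have /integrableP[_ /=] := iG.
  move=> hG hF; rewrite lte_mul_pinfty//; first exact: integral_ge0.
  by rewrite ge0_fin_numE//; exact: integral_ge0.
have iFG : Q.-integrable setT (EFin \o (fun x => F x * G x)).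
  apply/integrableP; split; first exact/measurable_EFinP.
  rewrite -(ge0_integral_law measurable_merge merge_law)//=; last first.
    by apply/measurable_EFinP; exact: measurableT_comp.
  under eq_integral do rewrite E.
  by have /integrableP[] := iFG2.
split => //.
rewrite /Rintegral -(integral_law measurable_merge merge_law)/=; last exact/measurable_EFinP.
under eq_integral do rewrite E.
rewrite -integral12_prod_meas1//.
rewrite /fubini_F/=.
under eq_integral => x _.
  under eq_integral => y _ do rewrite EFinM.
  rewrite integralZl//.
  over.
have finG : (\int[Q]_x (G x)%:E)%E \is a fin_num by exact: integrable_fin_num.
rewrite /= -(fineK finG) integralZr// fineM//; exact: integrable_fin_num.
Qed.

End independence.

Lemma power_prod (I : choiceType) (Q : probability (fpower I T) R) (hQ : is_power P Q)
    (h : I -> T -> R) (s : seq I) : uniq s ->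
  (forall i, i \in s -> P.-integrable setT (EFin \o h i)) ->
  Q.-integrable setT (EFin \o (fun x => \prod_(i <- s) h i (x i))) /\
  \int[Q]_x (\prod_(i <- s) h i (x i)) = \prod_(i <- s) \int[P]_t h i t.
Proof.
elim: s => [_ _|i s IH /= /andP[nis us] hi].
  rewrite big_nil; under eq_Rintegral do rewrite big_nil.
  under [EFin \o _]eq_fun do rewrite big_nil.
  split; first exact: finite_measure_integrable_cst.
  exact: Rintegral_prob_cst.
have [//|j js|iS eS] := IH.
  by apply: hi; rewrite inE js orbT.
have hI : P.-integrable setT (EFin \o h i) by apply: hi; rewrite mem_head.
have iI := integrable_law (@measurable_coord _ _ T i) (coord_law i hQ) hI.
have := @power_indep I Q hQ [set i] (fun x => h i (x i)) _ _ _ iI iS.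
have -> : (fun x : fpower I T => \prod_(j <- i :: s) h j (x j)) =
    (fun x => h i (x i) * \prod_(j <- s) h j (x j)).
  by apply/funext => x; rewrite big_cons.
rewrite big_cons => hind.
have [||hprod eI] := hind.
- by move=> x y ->.
- move=> x y xy; rewrite [LHS]big_seq [RHS]big_seq; apply: eq_bigr => j js.
  by rewrite xy//= => ji; rewrite -ji js in nis.
split=> //; rewrite -eS.
have -> : \int[P]_t h i t = \int[Q]_x h i (x i).
  rewrite /Rintegral (integral_law (@measurable_coord _ _ T i) (coord_law i hQ) (f :=
    EFin \o h i))//.
  exact: measurable_int hI.
exact: eI.
Qed.

End power_measure.

(** * Reproducing kernel Hilbert spaces *)

Section span.
Context (R : realType) (X : Type) (L : X -> X -> R).
Implicit Types (l : seq (R * X)) (x y : X).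

(** A combination is kept as a list of coefficients and points rather than as a function, so that
    the same list can be read for K and for each k_u. *)
Definition kspan l : X -> R := fun x => \sum_(p <- l) p.1 * L x p.2.

(** The inner product of two combinations in the reproducing kernel space of L (see
    [rk_dot_kspan2]), written without the space so that limits in the kernel can be taken in it. *)
Definition kform l l' : R := \sum_(p <- l) \sum_(q <- l') p.1 * q.1 * L p.2 q.2.

Definition kscale (c : R) l := [seq (c * p.1, p.2) | p <- l].

Lemma kspan_cat l l' : kspan (l ++ l') = kspan l + kspan l'.
Proof. by apply/funext => x; rewrite /kspan big_cat. Qed.

Lemma kspan_scale c l : kspan (kscale c l) = c *: kspan l.
Proof.
apply/funext => x; rewrite /kspan big_map -[RHS]/(c * \sum_(p <- l) _) mulr_sumr.
by apply: eq_bigr => p _; rewrite mulrA.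
Qed.

Lemma kformE l l' : kform l l' = \sum_(p <- l) p.1 * kspan l' p.2.
Proof.
apply: eq_bigr => p _; rewrite mulr_sumr; apply: eq_bigr => q _.
by rewrite mulrA.
Qed.

End span.

Section rkhs_theory.
Context (R : realType) (X : Type) (L : X -> X -> R) (H : rkhs L).
Implicit Types (f g h : X -> R) (x y : X) (l : seq (R * X)).
Local Notation "''[' f , g ]" := (rk_dot H f g).
Local Notation nm := (rk_norm H).
Local Notation V := (rk_set H).

Lemma rk_setZ c f : V f -> V (c *: f).
Proof. by move=> Vf; rewrite -[c *: f]addr0; apply: rk_lin => //; exact: rk_zero. Qed.

Lemma rk_setD f g : V f -> V g -> V (f + g).
Proof. by move=> Vf Vg; rewrite -[f]scale1r; exact: rk_lin. Qed.

Lemma rk_setB f g : V f -> V g -> V (f - g).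
Proof. by move=> Vf Vg; rewrite addrC -scaleN1r; exact: rk_lin. Qed.

Lemma rk_dotDl f g h : V f -> V g -> V h -> '[f + g, h] = '[f, h] + '[g, h].
Proof. by move=> *; rewrite -[f]scale1r rk_dot_lin// mul1r scale1r. Qed.

Lemma rk_dot0l h : V h -> '[0, h] = 0.
Proof.
move=> Vh; have V0 := rk_zero H.
by have := rk_dotDl V0 V0 Vh; rewrite addr0 => /eqP;
  rewrite -subr_eq0 opprD addrA subrr sub0r oppr_eq0 => /eqP.
Qed.

Lemma rk_dotZl c f h : V f -> V h -> '[c *: f, h] = c * '[f, h].
Proof.
move=> Vf Vh; rewrite -[c *: f]addr0 rk_dot_lin//; last exact: rk_zero.
by rewrite rk_dot0l// addr0.
Qed.

Lemma rk_dotDr f g h : V f -> V g -> V h -> '[h, f + g] = '[h, f] + '[h, g].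
Proof.
move=> Vf Vg Vh; have Vfg := rk_setD Vf Vg.
by rewrite (rk_dotC Vh Vfg) rk_dotDl// (rk_dotC Vf Vh) (rk_dotC Vg Vh).
Qed.

Lemma rk_dotZr c f h : V f -> V h -> '[h, c *: f] = c * '[h, f].
Proof.
move=> Vf Vh; have Vcf := rk_setZ c Vf.
by rewrite (rk_dotC Vh Vcf) rk_dotZl// (rk_dotC Vf Vh).
Qed.

Lemma rk_dot_lin2 c f g : V f -> V g ->
  '[c *: f + g, c *: f + g] = c ^+ 2 * '[f, f] + 2 * c * '[f, g] + '[g, g].
Proof.
move=> Vf Vg; have Vcf := rk_setZ c Vf.
rewrite rk_dotDl ?rk_dotDr ?rk_dotZl ?rk_dotZr//; [|exact: rk_setD].
by rewrite (rk_dotC Vg Vf); ring.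
Qed.

Lemma rk_CS f g : V f -> V g -> '[f, g] ^+ 2 <= '[f, f] * '[g, g].
Proof.
move=> Vf Vg; have [f0|f0] := eqVneq '[f, f] 0.
  by rewrite (rk_dot_eq0 Vf f0) !rk_dot0l ?expr0n/= ?mul0r//; exact: rk_zero.
have := rk_dot_ge0 (rk_lin (- ('[f, g] / '[f, f])) Vf Vg).
have f1 : 0 < '[f, f] by rewrite lt_def f0 rk_dot_ge0.
rewrite rk_dot_lin2// => h.
have := mulr_ge0 (ltW f1) h.
set p := '[f, f] in f1 f0 h *; set q := '[f, g]; set r := '[g, g].
have -> : p * ((- (q / p)) ^+ 2 * p + 2 * - (q / p) * q + r) = p * r - q ^+ 2 by field.
by rewrite subr_ge0.
Qed.

Lemma rk_norm_ge0 f : 0 <= nm f. Proof. exact: sqrtr_ge0. Qed.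

Lemma rk_normE f : V f -> nm f ^+ 2 = '[f, f].
Proof. by move=> Vf; rewrite sqr_sqrtr// rk_dot_ge0. Qed.

Lemma rk_dot_le f g : V f -> V g -> `|'[f, g]| <= nm f * nm g.
Proof.
move=> Vf Vg; rewrite -(@ler_pXn2r _ 2)// ?nnegrE ?mulr_ge0 ?rk_norm_ge0//.
by rewrite exprMn !rk_normE// real_normK ?num_real// rk_CS.
Qed.

Lemma rk_normD f g : V f -> V g -> nm (f + g) <= nm f + nm g.
Proof.
move=> Vf Vg; rewrite -(@ler_pXn2r _ 2)// ?nnegrE ?addr_ge0 ?rk_norm_ge0//.
have := rk_dot_lin2 1 Vf Vg; rewrite scale1r expr1n mul1r mulr1 => e.
rewrite rk_normE; last exact: rk_setD.
have := le_trans (ler_norm _) (rk_dot_le Vf Vg).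
by rewrite e -!rk_normE// sqrrD; lra.
Qed.

Lemma rk_normN f : V f -> nm (- f) = nm f.
Proof.
by move=> Vf; rewrite /rk_norm -scaleN1r rk_dotZl ?rk_dotZr//;
  [rewrite mulrA mulrNN !mul1r|exact: rk_setZ].
Qed.

Lemma rk_normB f g : V f -> V g -> nm (f - g) = nm (g - f).
Proof. by move=> Vf Vg; rewrite -opprB rk_normN//; exact: rk_setB. Qed.

Lemma kernelC x y : L x y = L y x.
Proof.
rewrite -[L x y](rk_reproducing (r:=H) (f := L ^~ y)); last exact: rk_section.
rewrite rk_dotC; [|exact: rk_section..].
by rewrite rk_reproducing//; exact: rk_section.
Qed.

Lemma kernel_ge0 x : 0 <= L x x.
Proof.
rewrite -[L x x](rk_reproducing (r:=H) (f := L ^~ x)); last exact: rk_section.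
exact: rk_dot_ge0 (rk_section H x).
Qed.

Lemma rk_eval_le f x : V f -> f x ^+ 2 <= '[f, f] * L x x.
Proof.
move=> Vf; rewrite -{1}(rk_reproducing x Vf).
apply: (le_trans (rk_CS Vf (rk_section H x))).
by rewrite (rk_reproducing _ (rk_section H x)).
Qed.

Lemma kernel_CS x y : L x y ^+ 2 <= L x x * L y y.
Proof.
have := rk_eval_le x (rk_section H y).
by rewrite (rk_reproducing _ (rk_section H y)) mulrC.
Qed.

Lemma kernel_le x y : `|L x y| <= (L x x + L y y) / 2.
Proof.
have hx := kernel_ge0 x; have hy := kernel_ge0 y.
rewrite -(@ler_pXn2r _ 2)// ?nnegrE ?divr_ge0 ?addr_ge0//.
rewrite real_normK ?num_real//; apply: (le_trans (kernel_CS x y)).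
by have := sqr_ge0 (L x x - L y y); nra.
Qed.

Lemma rk_set_kspan l : V (kspan L l).
Proof.
elim: l => [|p l IH].
  by rewrite (_ : kspan L [::] = 0); [exact: rk_zero|apply/funext => x; rewrite /kspan big_nil].
rewrite (_ : kspan L (p :: l) = p.1 *: (L ^~ p.2) + kspan L l).
  exact: rk_lin (rk_section H _) IH.
by apply/funext => x; rewrite /kspan big_cons.
Qed.

Lemma rk_dot_kspan l f : V f -> '[kspan L l, f] = \sum_(p <- l) p.1 * f p.2.
Proof.
move=> Vf; elim: l => [|p l IH].
  rewrite big_nil (_ : kspan L [::] = 0) ?rk_dot0l//.
  by apply/funext => x; rewrite /kspan big_nil.
rewrite (_ : kspan L (p :: l) = p.1 *: (L ^~ p.2) + kspan L l); last first.
  by apply/funext => x; rewrite /kspan big_cons.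
rewrite rk_dot_lin//; [|exact: rk_section|exact: rk_set_kspan].
by rewrite IH big_cons rk_dotC ?rk_reproducing//; exact: rk_section.
Qed.

Lemma rk_dot_kspan2 l l' : '[kspan L l, kspan L l'] = kform L l l'.
Proof. by rewrite rk_dot_kspan ?kformE//; exact: rk_set_kspan. Qed.

Lemma rk_eval_norm f x : V f -> `|f x| <= nm f * Num.sqrt (L x x).
Proof.
move=> Vf; rewrite -(@ler_pXn2r _ 2)// ?nnegrE ?mulr_ge0 ?rk_norm_ge0 ?sqrtr_ge0//.
rewrite exprMn rk_normE// sqr_sqrtr ?kernel_ge0// real_normK ?num_real//.
exact: rk_eval_le.
Qed.

Lemma rk_cvg_eval (f_ : nat -> X -> R) f x : (forall n, V (f_ n)) -> V f ->
  nm (f_ n - f) @[n --> \oo] --> 0 -> f_ n x @[n --> \oo] --> f x.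
Proof.
move=> Vf_ Vf h.
have h2 : nm (f_ n - f) * Num.sqrt (L x x) @[n --> \oo] --> 0.
  by rewrite -[X in _ --> X](mul0r (Num.sqrt (L x x))); apply: cvgMl.
apply/cvgrPdist_le => e e0.
move/cvgrPdist_le : h2 => /(_ e e0); apply: filterS => n.
rewrite sub0r normrN => hn.
rewrite distrC; apply: le_trans hn.
rewrite [leRHS]ger0_norm ?mulr_ge0 ?rk_norm_ge0 ?sqrtr_ge0//.
by rewrite -[_ - _]/((f_ n - f) x) rk_eval_norm//; exact: rk_setB.
Qed.

End rkhs_theory.

Section density.
Context (R : realType) (X : Type) (L : X -> X -> R) (H : rkhs L).

(* The distances to f of a minimizing sequence of combinations are
   approximately critical in every direction L(., x), which forces pointwise
   convergence to f, while the parallelogram law makes the sequence Cauchy. *)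
Lemma kspan_dense (f : X -> R) : rk_set H f ->
  exists l : nat -> seq (R * X), rk_norm H (kspan L (l n) - f) @[n --> \oo] --> 0.
Proof.
move=> Vf.
pose S := [set rk_dot H (f - kspan L l) (f - kspan L l) | l in [set: seq (R * X)]].
have Vl l : rk_set H (kspan L l) by exact: rk_set_kspan.
have Vd l : rk_set H (f - kspan L l) by exact: rk_setB.
have S0 : has_inf S.
  split; first by exists (rk_dot H (f - kspan L [::]) (f - kspan L [::])), [::].
  by exists 0 => _ [l _ <-]; exact: rk_dot_ge0.
pose D := inf S.
have Dle l : D <= rk_dot H (f - kspan L l) (f - kspan L l).
  by apply: ge_inf; [exact: S0.2|exists l].
have /choice[l hl] : forall n : nat, exists l,
    rk_dot H (f - kspan L l) (f - kspan L l) < D + n.+1%:R^-1.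
  move=> n; have [|_ [l _ <-] hl] := @inf_adherent _ S n.+1%:R^-1 _ S0.
    by rewrite invr_gt0.
  by exists l.
(* Adding t L(., x) to the n-th combination cannot lower the squared distance to f by more than its
   slack 1/(n+1) over the infimum. *)
have key n x t : 2 * t * (f - kspan L (l n)) x <= n.+1%:R^-1 + t ^+ 2 * L x x.
  have := Dle ((t, x) :: l n).
  have -> : f - kspan L ((t, x) :: l n) = (- t) *: (L ^~ x) + (f - kspan L (l n)).
    apply/funext => y; rewrite /kspan.
    rewrite -[LHS]/(f y - \sum_(p <- _) _) big_cons.
    rewrite -[RHS]/(- t * L y x + (f y - \sum_(p <- _) _))/=; ring.
  have Vx := rk_section H x.
  rewrite rk_dot_lin2// (rk_dotC Vx)// !rk_reproducing//.
  rewrite sqrrN; move: (hl n); set y := (_ - _) x; move: (rk_dot _ _ _) (_^-1) => a b.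
  by move=> h1 h2; nra.
have pw x : kspan L (l n) x @[n --> \oo] --> f x.
  pose c := (1 + L x x) / 2.
  have c0 : 0 <= c by rewrite divr_ge0 ?addr_ge0 ?(kernel_ge0 H).
  have hc : Num.sqrt n.+1%:R^-1 * c @[n --> \oo] --> (0 : R).
    rewrite -[X in _ --> X](mul0r c); apply: cvgMl.
    rewrite -[X in _ --> X]sqrtr0.
    exact: (cvg_comp _ _ (@cvg_harmonic R) (@sqrt_continuous R 0)).
  apply/cvgrPdist_le => e e0; move/cvgrPdist_le : hc => /(_ e e0).
  apply: filterS => n; rewrite sub0r normrN; apply: le_trans.
  rewrite [leRHS]ger0_norm; last by rewrite mulr_ge0 ?sqrtr_ge0.
  (* The choice t = r and t = -r, with r^2 = 1/(n+1), makes both terms on the right of [key] of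
     order r^2, so that the value at x is of order r. *)
  set r := Num.sqrt _.
  have r0 : 0 < r by rewrite sqrtr_gt0 invr_gt0.
  have r2 : r ^+ 2 = n.+1%:R^-1 by rewrite sqr_sqrtr// invr_ge0.
  have h1 := key n x r; have h2 := key n x (- r).
  rewrite -r2 in h1 h2; rewrite -[f x - _]/((f - kspan L (l n)) x).
  move: h1 h2; set y := (_ - _) x => h1 h2.
  rewrite ler_norml /c; apply/andP; split; rewrite -(ler_pM2l r0); nra.
have [|g Vg hg] := rk_complete (r := H) (f_ := fun n => kspan L (l n)) (fun n => Vl (l n)).
  move=> e0 e00; have {e0 e00} [e [-> e0]] : exists e : R, e0 = e /\ 0 < e by exists e0.
  have e2 : 0 < e ^+ 2 / 4 by rewrite divr_gt0 ?exprn_gt0.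
  have [N hN] : exists N : nat, forall n, (N <= n)%N -> n.+1%:R^-1 < e ^+ 2 / 4.
    have := @cvg_harmonic R => /cvgrPdist_lt /(_ _ e2) [N _ hN].
    exists N => n Nn; have := hN n Nn; rewrite /= sub0r normrN ger0_norm//.
  exists N => i j Ni Nj.
  rewrite -(@ltr_pXn2r _ 2)// ?nnegrE ?rk_norm_ge0 ?ltW// rk_normE; last exact: rk_setB.
  (* The midpoint of two combinations is again a combination, so its squared distance to f is at
     least D. *)
  have := Dle (kscale 2^-1 (l i ++ l j)).
  rewrite kspan_scale kspan_cat.
  set u := f - kspan L (l i); set v := f - kspan L (l j).
  have -> : f - 2^-1 *: (kspan L (l i) + kspan L (l j)) = 2^-1 *: u + 2^-1 *: v.
    apply/funext => x; rewrite -[LHS]/(f x - 2^-1 * (kspan L (l i) x + kspan L (l j) x)).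
    rewrite -[RHS]/(2^-1 * (f x - kspan L (l i) x) + 2^-1 * (f x - kspan L (l j) x)).
    by field.
  have -> : kspan L (l i) - kspan L (l j) = (-1) *: u + v.
    apply/funext => x; rewrite -[LHS]/(kspan L (l i) x - kspan L (l j) x).
    rewrite -[RHS]/(-1 * (f x - kspan L (l i) x) + (f x - kspan L (l j) x)).
    by ring.
  have Vu : rk_set H u by exact: Vd.
  have Vv : rk_set H v by exact: Vd.
  have Vv2 : rk_set H (2^-1 *: v) by exact: rk_setZ.
  rewrite !rk_dot_lin2// rk_dotZl// !rk_dotZr//.
  have hu : rk_dot H u u < D + i.+1%:R^-1 by exact: hl.
  have hv : rk_dot H v v < D + j.+1%:R^-1 by exact: hl.
  have := hN i Ni; have := hN j Nj; move: hu hv.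
  move: (rk_dot H u u) (rk_dot H u v) (rk_dot H v v) => a b c.
  move: (i.+1%:R^-1) (j.+1%:R^-1) => a' c'; lra.
suff -> : f = g by exists l.
apply/funext => x; apply: (cvg_unique _ (pw x)) => //.
exact: (rk_cvg_eval (f_ := fun n => kspan L (l n)) (x := x) (fun n => Vl (l n)) Vg hg).
Qed.

Lemma kspan_dense_le (f : X -> R) e : rk_set H f -> 0 < e ->
  exists l : seq (R * X), rk_norm H (kspan L l - f) <= e.
Proof.
move=> Vf e0; have [l hl] := kspan_dense Vf.
move/cvgrPdist_le : hl => /(_ e e0)[N _ /(_ N (leqnn N))] /=.
by rewrite sub0r normrN ger0_norm ?rk_norm_ge0// => h; exists (l N).
Qed.

End density.

Section pullback.
Context (R : realType) (X X' : Type) (L : X -> X -> R) (L' : X' -> X' -> R)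
  (H : rkhs L) (H' : rkhs L') (sig : X' -> X) (tau : X -> X').
Hypothesis Lst : forall x' y, L (sig x') y = L' x' (tau y).
Hypothesis Ltt : forall x y, L x y = L' (tau x) (tau y).

(** The hypotheses say that composition with [sig] sends the section at y to the section at [tau y]
    and preserves Gram matrices. It is thus isometric on combinations; density in H and completeness
    of H' extend it to all of H. *)
Lemma rk_pullback f : rk_set H f ->
  rk_set H' (f \o sig) /\ rk_norm H' (f \o sig) <= rk_norm H f.
Proof.
move=> Vf; have [l hl] := kspan_dense Vf.
pose tl n := [seq (p.1, tau p.2) | p <- l n].
have ktl n x' : kspan L' (tl n) x' = kspan L (l n) (sig x').
  by rewrite /kspan big_map; apply: eq_bigr => p _; rewrite Lst.
have Vl n := rk_set_kspan H (l n).
have Vtl n := rk_set_kspan H' (tl n).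
have form (s t : seq (R * X)) :
    kform L' [seq (p.1, tau p.2) | p <- s] [seq (p.1, tau p.2) | p <- t] = kform L s t.
  rewrite /kform big_map; apply: eq_bigr => p _; rewrite big_map.
  by apply: eq_bigr => q _; rewrite -Ltt.
have normB i j : rk_norm H' (kspan L' (tl i) - kspan L' (tl j)) =
    rk_norm H (kspan L (l i) - kspan L (l j)).
  congr Num.sqrt.
  have E (Y : Type) (K : Y -> Y -> R) s t : kspan K s - kspan K t = kspan K (s ++ kscale (-1) t).
    by rewrite kspan_cat kspan_scale scaleN1r.
  rewrite !E !rk_dot_kspan2 -form; congr (kform _ _ _).
    by rewrite map_cat /kscale -!map_comp.
  by rewrite map_cat /kscale -!map_comp.
have norm i : rk_norm H' (kspan L' (tl i)) = rk_norm H (kspan L (l i)).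
  by congr Num.sqrt; rewrite !rk_dot_kspan2 -form.
have [//|e e0|g Vg hg] := rk_complete (r := H') (f_ := fun n => kspan L' (tl n)).
  have e2 : 0 < e / 3 by rewrite divr_gt0.
  move/cvgrPdist_le : (hl) => /(_ _ e2)[N _ hN].
  exists N => i j Ni Nj; rewrite normB.
  have hi := hN i Ni; have hj := hN j Nj.
  rewrite /= !sub0r !normrN !ger0_norm ?rk_norm_ge0// in hi hj.
  have -> : kspan L (l i) - kspan L (l j) = (kspan L (l i) - f) + (f - kspan L (l j)).
    by rewrite addrA subrK.
  rewrite (le_lt_trans (rk_normD _ _))//; [exact: rk_setB..|].
  by rewrite (rk_normB Vf (Vl j)); lra.
have -> : f \o sig = g.
  apply/funext => x'.
  have h1 := rk_cvg_eval (f_ := fun n => kspan L' (tl n)) (x := x') Vtl Vg hg.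
  have h2 := rk_cvg_eval (f_ := fun n => kspan L (l n)) (x := sig x') Vl Vf hl.
  have e : (fun n => kspan L' (tl n) x') = (fun n => kspan L (l n) (sig x')) by apply/funext =>
    n; rewrite ktl.
  rewrite e in h1.
  exact: cvg_unique h2 h1.
split=> //; apply/ler_addgt0Pr => e e0.
have e2 : 0 < e / 2 by rewrite divr_gt0.
move/cvgrPdist_le : hl => /(_ _ e2)[N _ hN].
move/cvgrPdist_le : hg => /(_ _ e2)[N' _ hN'].
have {hN} hN := hN (maxn N N') (leq_maxl _ _).
have {hN'} hN' := hN' (maxn N N') (leq_maxr _ _).
set n := maxn N N' in hN hN'.
rewrite /= !sub0r !normrN !ger0_norm ?rk_norm_ge0// in hN hN'.
have -> : g = kspan L' (tl n) + (g - kspan L' (tl n)) by rewrite addrC subrK.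
rewrite (le_trans (rk_normD _ _))//; first exact: rk_setB.
rewrite norm (rk_normB Vg (Vtl n)).
have : rk_norm H (kspan L (l n)) <= rk_norm H f + e / 2.
  have -> : kspan L (l n) = f + (kspan L (l n) - f) by rewrite addrC subrK.
  by rewrite (le_trans (rk_normD _ _))// ?lerD2l//; exact: rk_setB.
by lra.
Qed.

End pullback.

(** * Coloring and chains of finite sets *)

Lemma card_le_cover (T : choiceType) (A : set T) n : A #<= `I_n ->
  exists2 s : {fset T}, (#|` s| <= n)%N & forall x, A x -> x \in s.
Proof.
move=> h; exists (fset_set A); first exact: geq_card_fset_set.
have fA : finite_set A by apply/finite_set_leP; exists n.
by move=> x Ax; rewrite in_fset_set// inE.
Qed.

(** The list is colored from its end: the neighbours of the head among the already colored vertices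
    are fewer than the colors, so a free color remains. *)
Lemma greedy_coloring (T : finType) (V : eqType) (e : rel V) (c0 : T) (s : seq V) :
  symmetric e -> uniq s ->
  (forall x, x \in s -> (size [seq y <- s | (y != x) && e x y] < #|T|)%N) ->
  exists phi : V -> T, forall x y, x \in s -> y \in s -> x != y -> e x y ->
    phi x != phi y.
Proof.
move=> esym; elim: s => [|x s IH] /= us deg; first by exists (fun=> c0).
case/andP: us => xs us.
have [y ys|phi hphi] := IH us.
  apply: leq_ltn_trans (deg y _); last by rewrite inE ys orbT.
  by case: ifP => _ //=.
have [c hc] : exists c, c \notin [seq phi y | y <- s & e x y].
  apply/existsP; rewrite -negb_forall; apply/negP => /forallP h.
  have := deg x (mem_head _ _); rewrite eqxx/=.
  apply/negP; rewrite -leqNgt.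
  have -> : [seq y <- s | (y != x) && e x y] = [seq y <- s | e x y].
    by apply: eq_in_filter => y ys; case: eqP => // yx; rewrite -yx ys in xs.
  rewrite -(size_map phi); apply: leq_trans (card_size _).
  by apply: subset_leq_card; apply/fintype.subsetP => c _; exact: h.
exists (fun y => if y == x then c else phi y) => y z.
rewrite !inE.
have nc w : w \in s -> e x w -> c != phi w.
  move=> ws exw; apply: contraNneq hc => ->; apply: map_f.
  by rewrite mem_filter exw.
have [->|yx] := eqVneq y x; have [->|zx] := eqVneq z x => //=.
- by move=> _ zs _; exact: nc.
- by move=> ys _ _; rewrite eq_sym esym; exact: nc.
- exact: hphi.
Qed.

Definition fadd_fresh (B : {fset nat}) : {fset nat} := ((\max_(x <- B) x).+1 |` B)%fset.

Lemma fadd_fresh_proper B : (B `<` fadd_fresh B)%fset.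
Proof.
rewrite fproperE fsubsetUr/=; apply/fsubsetPn; exists (\max_(x <- B) x).+1.
  by rewrite !inE eqxx.
apply/negP => h.
by have := @leq_bigmax_seq _ (enum_fset B) predT id _ h isT; rewrite ltnn.
Qed.

(** The cost model asks for an infinite strictly increasing sequence, while successive levels may
    coincide and there are finitely many of them. Repetitions are skipped, and after the last level
    fresh elements are added one at a time. *)
Lemma nested_through (c : nat -> {fset nat}) (m : nat) :
  c 0%N != fset0 -> (forall i, (c i `<=` c i.+1)%fset) ->
  exists2 v, nested v & forall k, (k <= m)%N -> exists i, v i = c k.
Proof.
move=> c0 cS.
(* The position [i0] of [c m] is carried along: there the sequence is cut and continued in the next
   step. *)
suff [v [i0 [nv vi0 hv]]] : exists v i0, [/\ nested v, v i0 = c m &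
    forall k, (k <= m)%N -> exists2 i, (i <= i0)%N & v i = c k].
  by exists v => // k /hv [i _ <-]; exists i.
elim: m => [|m [v [i0 [[v0 vS] vi0 hv]]]].
  exists (fun i => iter i fadd_fresh (c 0%N)), 0%N; split => //; last first.
    by move=> k; rewrite leqn0 => /eqP ->; exists 0%N.
  split=> [[|i]|i] //=; last exact: fadd_fresh_proper.
  by apply/fset0Pn; exists (\max_(x <- iter i fadd_fresh (c 0%N)) x).+1; rewrite !inE eqxx.
have [e|ne] := eqVneq (c m.+1) (c m).
  exists v, i0; split => //; first by rewrite e.
  move=> k; rewrite leq_eqVlt => /predU1P[->|]; last exact: hv.
  by rewrite e; exact: hv.
pose w i := if (i <= i0)%N then v i else iter (i - i0.+1) fadd_fresh (c m.+1).
have cm0 : c m.+1 != fset0.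
  rewrite -fproper0; apply: fproper_sub_trans (cS m).
  by rewrite fproper0 -vi0.
have w0 i : w i != fset0.
  rewrite /w; case: ifP => // _; case: (i - _)%N => //= j.
  by apply/fset0Pn; exists (\max_(x <- iter j fadd_fresh (c m.+1)) x).+1; rewrite !inE eqxx.
have wS i : (w i `<` w i.+1)%fset.
  rewrite /w; have [ii|ii] := ltnP i i0.
    by rewrite (ltnW ii).
  have [->|] := eqVneq i i0.
    rewrite leqnn subnn/= vi0 fproperEneq cS andbT eq_sym//.
  move=> ni; have lti : (i0 < i)%N by rewrite ltn_neqAle eq_sym ni.
  by rewrite leqNgt lti/= subSS -(subnSK lti); exact: fadd_fresh_proper.
have wle i : (i <= i0)%N -> w i = v i by rewrite /w => ->.
exists w, i0.+1; split => //.
  by rewrite /w ltnn subnn.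
move=> k; rewrite leq_eqVlt => /predU1P[->|km].
  by exists i0.+1 => //; rewrite /w ltnn subnn.
by have [i ii0 <-] := hv k km; exists i; [exact: leqW|exact: wle].
Qed.

(** * Choice of the parameters *)

(* [lvl L k] is the number of sets u_j whose union is v_k, so [lvl L 0 = 0]. *)
Definition lvl (L : nat -> nat) (k : nat) : nat := if k is k'.+1 then L k' else 0%N.

(** The requirement n_k > 1 is there because the variance hypothesis on Q_n speaks only of n > 1. *)
Definition admissible (m : nat) (L n : nat -> nat) : Prop :=
  [/\ (0 < m)%N, (0 < L 0)%N,
      (forall i j, (i < j < m)%N -> (L i < L j)%N),
      (forall i, (i < m)%N -> (1 < n i)%N) &
      (forall i j, (i <= j < m)%N -> (n j <= n i)%N)].

Section parameters.
Context (R : realType).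

Lemma bernoulli_le (y : R) n : 1 <= y -> 1 + n%:R * (y - 1) <= y ^+ n.
Proof.
move=> y1; elim: n => [|n IH]; first by rewrite mul0r addr0 expr0.
rewrite exprS; apply: le_trans (ler_wpM2l _ IH); last lra.
rewrite -natr1; have : 0 <= n%:R * (y - 1) ^+ 2 by rewrite mulr_ge0 ?sqr_ge0.
nra.
Qed.

Lemma powRXn (a c : R) n : 0 <= a -> (a ^+ n) `^ c = (a `^ c) ^+ n.
Proof.
by move=> a0; rewrite -powR_mulrn// -powRrM mulrC powRrM powR_mulrn ?powR_ge0.
Qed.

Lemma le_max_exponent (C Y N : R) : 0 < C -> 1 < Y -> C * Y <= N ->
  exists m : nat, [/\ (0 < m)%N, C * Y ^+ m <= N & N < C * Y ^+ m.+1].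
Proof.
move=> C0 Y1 CN.
have [M hM] : exists M : nat, N < C * Y ^+ M.
  exists (Num.truncn (N / (C * (Y - 1)))).+1.
  set M := _.+1.
  have C1 : 0 < C * (Y - 1) by rewrite mulr_gt0// subr_gt0.
  have h : N < M%:R * (C * (Y - 1)) by rewrite -ltr_pdivrMr// truncnS_gt.
  apply: lt_le_trans h _; rewrite mulrCA ler_pM2l//.
  by apply: le_trans (bernoulli_le M (ltW Y1)); rewrite lerDr.
have [[|[|m]] hm minm] := ex_minnP (ex_intro (fun M => N < C * Y ^+ M) M hM).
- move: hm CN; rewrite expr0 mulr1 => h1 h2.
  exfalso; have h3 : C < C * Y by rewrite ltr_pMr.
  by lra.
- by have := lt_le_trans hm CN; rewrite ltxx.
- exists m.+1; split => //; rewrite leNgt; apply/negP => /minm.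
  by rewrite ltnn.
Qed.

(** The gap [al - th] pays for the power of the logarithm. For [be <= 0] that power is largest at n
    = 2; otherwise ln x < x is applied to x = n^e' with e' = (al - th) / be. *)
Lemma variance_bound_le (C al be th : R) : 0 <= C -> th < al ->
  exists2 K : R, 0 <= K & forall n, (1 < n)%N -> variance_bound C al be n <= K * n%:R `^ (- th).
Proof.
move=> C0 tha; pose e := al - th; have e0 : 0 < e by rewrite subr_gt0.
have [K K0 hK] : exists2 K : R, 0 <= K & forall n, (1 < n)%N ->
  (ln n%:R) `^ be <= K * (n%:R : R) `^ e.
  have [be0|be0] := leP be 0.
    exists ((ln 2) `^ be); first exact: powR_ge0.
    move=> n n1; have n2 : (2 : R) <= n%:R by rewrite (ler_nat _ 2).
    have l2 : (0 : R) < ln 2 by rewrite ln_gt0// ltr1n.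
    have ll : ln 2 <= ln n%:R :> R by rewrite ler_ln// ?posrE ?ltr0n// (ltn_trans _ n1).
    apply: (@le_trans _ _ (ln 2 `^ be)).
      rewrite -[be]opprK !(powRN _ (- be)) lef_pV2 ?posrE ?powR_gt0//; last exact: lt_le_trans ll.
      by apply: ge0_ler_powR; rewrite ?oppr_ge0// ?nnegrE ?ltW//; exact: lt_le_trans ll.
    rewrite ler_peMr ?powR_ge0//.
    by rewrite -[leLHS](powRr0 n%:R) ler_powR ?ltW ?ltr1n.
  pose e' := e / be; have e'0 : 0 < e' by rewrite divr_gt0.
  exists (e'^-1 `^ be); first exact: powR_ge0.
  move=> n n1; have n0 : (0 : R) < n%:R by rewrite ltr0n (ltn_trans _ n1).
  have : ln n%:R <= e'^-1 * (n%:R : R) `^ e'.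
    rewrite mulrC ler_pdivlMr// mulrC -ln_powR ltW// ln_sublinear//.
    exact: powR_gt0.
  have ln0 : 0 <= ln n%:R :> R by rewrite ln_ge0// (ler_nat _ 1) ltnW.
  move=> /(ge0_ler_powR (ltW be0)); rewrite !nnegrE => /(_ ln0 _).
  rewrite powRM ?powR_ge0 ?invr_ge0 ?(ltW e'0)// -powRrM /e' divfK ?gt_eqF//.
  by apply; rewrite mulr_ge0 ?powR_ge0// invr_ge0 ltW.
exists (C * K); first exact: mulr_ge0.
move=> n n1; rewrite /variance_bound -!mulrA ler_wpM2l//.
apply: (le_trans (ler_wpM2l (powR_ge0 _ _) (hK n n1))).
rewrite mulrCA ler_wpM2l// -powRD ?pnatr_eq0 -?lt0n ?(ltn_trans _ n1) ?implybT//.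
by rewrite /e addKr.
Qed.

(** Cauchy condensation: the block of indices from 2^j to 2^(j+1) contributes at most 2^j g(2^j),
    and these bounds form a geometric series. *)
Lemma dyadic_tail (g : nat -> R) (K r : R) (i J : nat) :
  (forall j, 0 <= g j) -> (forall j j', (j <= j')%N -> g j' <= g j) ->
  0 < r < 1 -> (forall i, 2 ^+ i * g (2 ^ i)%N <= K * r ^+ i) ->
  \sum_(2 ^ i <= j < J) g j <= K * r ^+ i / (1 - r).
Proof.
move=> g0 gm /andP[r0 r1] hg.
have dy M : \sum_(2 ^ i <= j < 2 ^ (i + M)) g j <= K * r ^+ i * (1 - r ^+ M) / (1 - r).
  elim: M => [|M IH]; first by rewrite addn0 big_geq// expr0 subrr mulr0 mul0r.
  rewrite (@big_cat_nat _ _ _ (2 ^ (i + M))) ?leq_pexp2l ?leq_addr ?leq_add2l//=.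
  have : \sum_(2 ^ (i + M) <= j < 2 ^ (i + M.+1)) g j <= K * r ^+ (i + M).
    apply: le_trans (hg (i + M)%N).
    rewrite (@le_trans _ _ (\sum_(2 ^ (i + M) <= j < 2 ^ (i + M.+1)) g (2 ^ (i + M))%N))//.
      by rewrite !big_nat ler_sum// => j /andP[hj _]; exact: gm.
    rewrite sumr_const_nat addnS expnS mul2n -addnn addnK.
    by rewrite -[leLHS]mulr_natl natrX.
  move=> h; apply: (le_trans (lerD IH h)).
  rewrite le_eqVlt; apply/orP; left; apply/eqP.
  rewrite exprD exprS; field; lra.
have [M hM] : exists M, (J <= 2 ^ (i + M))%N.
  by exists J; rewrite ltnW// (leq_trans (ltn_expl J (ltnSn 1)))// leq_pexp2l// leq_addl.
apply: (@le_trans _ _ (\sum_(2 ^ i <= j < 2 ^ (i + M)) g j)).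
  have [iJ|iJ] := leqP (2 ^ i) J.
    by rewrite (@big_cat_nat _ _ _ J _ (2 ^ (i + M)))//= lerDl sumr_ge0.
  by rewrite big_geq ?sumr_ge0// ltnW.
have K0 : 0 <= K * r ^+ i by apply: le_trans (hg i); rewrite mulr_ge0.
apply: (le_trans (dy M)); apply: ler_wpM2r; first by rewrite invr_ge0 subr_ge0 ltW.
by rewrite ler_piMr// gerBl exprn_ge0// ltW.
Qed.

(* With X = 2^s and r = 2^(-p), p = th' s, the choice L_k = 2^k, n_k ~ X^(m-k)
   gives cost ~ m X^m and squared error ~ r^m; the factor m is absorbed by
   Y = X^(th'/th) > X, for which Y^(-th) = r. *)
Lemma exists_parameters (g : nat -> R) (G s al be Cd Cc Ce th : R) :
  (forall j, 0 <= g j) -> (forall j j', (j <= j')%N -> g j' <= g j) ->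
  (forall J, \sum_(j < J) g j <= G) ->
  0 < s -> 0 <= Cd -> 0 <= Cc -> 0 <= Ce ->
  (0 < th -> exists th' K, [/\ th < th', th' < al &
    forall j, g j <= K * j.+1%:R `^ (- (1 + th' * s))]) ->
  exists (C : R) (N0 : nat), forall N, (N0 <= N)%N -> exists m L n, [/\ admissible m L n,
    Cc * \sum_(k < m) (n k)%:R * (L k)%:R `^ s <= N%:R &
    exists2 B : R, (forall J, \sum_(L m.-1 <= j < J) g j <= B) &
      Ce * (B + \sum_(k < m) variance_bound Cd al be (n k) * g (lvl L k)) <= C * N%:R `^ (- th)].
Proof.
move=> g0 gm gG s0 Cd0 Cc0 Ce0 hth.
(* For [th <= 0] the target N^(-th) does not decay: a single level with one set and two points is
   enough. *)
have [th0|th0] := leP th 0.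
  exists (Ce * (G + variance_bound Cd al be 2 * g 0%N)), (Num.truncn (Cc * 2)).+1.
  move=> N hN; exists 1%N, (fun=> 1%N), (fun=> 2%N); split => //.
  - by split => // i j /andP[ij j1]; move: (leq_trans ij j1); rewrite ltnS ltn0.
  - rewrite big_ord1 powR1 mulr1 ltW// (lt_le_trans (truncnS_gt _))//.
    by rewrite ler_nat.
  - exists G.
      move=> J; apply: le_trans (gG J).
      case: J => [|J]; first by rewrite big_geq ?sumr_ge0.
      by rewrite -(big_mkord xpredT) [leRHS]big_nat_recl// big_add1/= lerDr.
    rewrite big_ord1/= ler_peMr//.
      rewrite mulr_ge0// addr_ge0//; first exact: le_trans (sumr_ge0 _ _) (gG 0%N).
      by rewrite !mulr_ge0// powR_ge0.
    rewrite -[leLHS](powRr0 N%:R) ler_powR ?oppr_ge0//.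
    by rewrite (ler_nat _ 1) (leq_trans _ hN).
have [th' [K [tht' th'al hg]]] := hth th0.
have th'0 : 0 < th' by exact: lt_trans tht'.
have K0 : 0 <= K by have := hg 0%N; rewrite powR1 mulr1; exact: le_trans.
have [Kv Kv0 hKv] := variance_bound_le be Cd0 th'al.
have [X XE] : exists X, X = (2 : R) `^ s by exists ((2 : R) `^ s).
have [Y YE] : exists Y, Y = X `^ (th' / th) by exists (X `^ (th' / th)).
have [r rE] : exists r, r = X `^ (- th') by exists (X `^ (- th')).
have pow_gt1 (b c : R) : 1 < b -> 0 < c -> 1 < b `^ c.
  by move=> b1 c0; rewrite /powR gt_eqF ?(lt_trans _ b1)// expR_gt1 mulr_gt0// ln_gt0.
have X1 : 1 < X by rewrite XE pow_gt1// ltr1n.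
have X0 : 0 < X by exact: lt_trans X1.
have Xpow (c : R) : 0 < c -> 1 < X `^ c by exact: pow_gt1.
have YX : X < Y.
  have -> : Y = X `^ ((th' - th) / th) * X.
    rewrite -[X in _ * X]powRr1 ?ltW// -powRD ?(gt_eqF X0) ?implybT//.
    by rewrite YE; congr powR; field; rewrite gt_eqF.
  by rewrite ltr_pMl// Xpow// divr_gt0// subr_gt0.
have Y0 : 0 < Y by exact: lt_trans YX.
have Y1 : 1 < Y by exact: lt_trans YX.
have r01 : 0 < r < 1.
  by rewrite rE powRN invr_gt0 powR_gt0//= invf_lt1 ?powR_gt0// Xpow.
have [r0 r1] := andP r01.
have rn0 : r != 0 by rewrite gt_eqF.
have r1n0 : 1 - r != 0 by rewrite subr_eq0 gt_eqF.
have Yth : Y `^ (- th) = r.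
  by rewrite YE rE -powRrM mulrN divfK// gt_eqF.
have Yr j : (Y ^+ j) `^ (- th) = r ^+ j.
  rewrite powRXn; last exact: ltW Y0.
  by rewrite Yth.
have Xr j : (X ^+ j) `^ (- th') = r ^+ j.
  by rewrite powRXn ?rE//; exact: ltW X0.
have powX j : (2 ^ j)%:R `^ s = X ^+ j.
  by rewrite natrX powRXn ?XE.
have hg2 j : g (2 ^ j)%N <= K * (2 ^- j * r ^+ j).
  apply: (le_trans (hg _)); rewrite ler_wpM2l//.
  have le2 : (2 ^+ j : R) <= (2 ^ j).+1%:R by rewrite -natrX ler_nat.
  have p2 : 0 < (2 ^+ j : R) by rewrite exprn_gt0.
  apply: (@le_trans _ _ ((2 ^+ j) `^ (- (1 + th' * s)))).
    rewrite !(powRN _ (1 + _)) lef_pV2 ?posrE ?powR_gt0 ?ltr0n//.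
    by apply: (ge0_ler_powR _ _ _ le2);
      rewrite ?nnegrE ?ler0n ?addr_ge0 ?mulr_ge0 ?(ltW p2) ?(ltW th'0) ?(ltW s0).
  rewrite opprD powRD; last by rewrite (gt_eqF p2) implybT.
  rewrite powR_inv1 ?(ltW p2)//.
  have -> : r = 2 `^ (- (th' * s)).
    by rewrite rE XE -powRrM mulrN mulrC.
  by rewrite powRXn.
(* The 3 comes from n_k <= X^(m-k) + 2 <= 3 X^(m-k). Bernoulli's inequality for Y/X bounds m X^m by
   Y^m / (Y/X - 1), and the summand 1 keeps the constant positive. *)
pose Kc := Cc * 3 / (Y / X - 1) + 1.
have YX0 : 0 < Y / X - 1 by rewrite subr_gt0 ltr_pdivlMr// mul1r.
have Kc0 : 0 < Kc by rewrite ltr_wpDl// divr_ge0 ?mulr_ge0// ltW.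
have mX m : m%:R * X ^+ m <= Y ^+ m / (Y / X - 1).
  rewrite ler_pdivlMr// mulrAC -ler_pdivlMr ?exprn_gt0// -expr_div_n.
  by apply: le_trans (bernoulli_le m _); [rewrite lerDr|rewrite ler_pdivlMr// mul1r ltW].
(* The first summand is the geometric tail beyond L_(m-1) = 2^(m-1). In the second, 2/r is the price
   of having 2^(k-1) instead of 2^k at level k, and the last 2 bounds the sum of the 2^(-k). *)
pose Ke := Ce * (K / r / (1 - r) + Kv * K * (2 / r) * 2).
exists (Ke * (Kc * Y) `^ th), (Num.truncn (Kc * Y)).+1 => N hN.
have N1 : Kc * Y <= N%:R.
  by rewrite ltW// (lt_le_trans (truncnS_gt _))// ler_nat.
have [m [m0 hm1 hm2]] := le_max_exponent Kc0 Y1 N1.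
(* The offset 2 makes n_k > 1 immediate and keeps n_k above X^(m-k). *)
exists m, (fun k => 2 ^ k)%N, (fun k => (Num.truncn (X ^+ (m - k))).+2); split.
- split => //.
  + by move=> i j /andP[ij _]; rewrite ltn_exp2l.
  + by move=> i j /andP[ij jm]; rewrite !ltnS le_truncn// ler_weXn2l ?(ltW X1)// leq_sub2l.
- apply: le_trans hm1.
  apply: (@le_trans _ _ (Cc * (3 * (m%:R * X ^+ m)))).
    rewrite ler_wpM2l// (_ : 3 * _ = \sum_(k < m) 3 * X ^+ m); last first.
      by rewrite sumr_const card_ord -[RHS]mulr_natl mulrCA.
    apply: ler_sum => k _; rewrite powX -[in leRHS](subnK (ltnW
      (ltn_ord k))) exprD mulrA ler_wpM2r ?exprn_ge0 ?(ltW X0)//.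
    have := truncn_le (X ^+ (m - k)); have := exprn_ege1 (m - k) (ltW X1).
    rewrite exprn_ge0 ?(ltW X0)// -addn2 natrD; set y := X ^+ _.
    by move=> h1 h2; lra.
  rewrite /Kc [leRHS]mulrDl mul1r ler_wpDr ?exprn_ge0 ?(ltW Y0)//.
  have := mX m; have := mulr_ge0 Cc0 (ler0n R 3).
  move=> c0 h; rewrite mulrA -[leRHS]mulrA [_^-1 * _]mulrC.
  exact: ler_wpM2l.
- exists (K * r ^+ m.-1 / (1 - r)).
    move=> J; apply: dyadic_tail => // j.
    rewrite -ler_pdivlMl ?exprn_gt0//; apply: le_trans (hg2 j) _.
    by rewrite mulrCA.
  apply: (@le_trans _ _ (Ke * r ^+ m)).
    rewrite /Ke -[leRHS]mulrA; apply: ler_wpM2l => //; rewrite [leRHS]mulrDl; apply: lerD.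
      rewrite -{2}(prednK m0) exprS le_eqVlt; apply/orP; left; apply/eqP.
      by field; rewrite ?rn0 ?r1n0.
    (* On each level the factor r^(m-k) from n_k and the factor r^k from the weights multiply to
       r^m; the remaining 2^(-k) makes the sum over the levels bounded in m. *)
    apply: (@le_trans _ _ (\sum_(k < m) Kv * K * (2 / r) * r ^+ m * 2 ^- k)).
      apply: ler_sum => k _.
      have h1 : variance_bound Cd al be (Num.truncn (X ^+ (m - k))).+2 <= Kv * r ^+ (m - k).
        apply: (le_trans (hKv _ _)) => //; rewrite ler_wpM2l//.
        have Xk : 0 < X ^+ (m - k) by rewrite exprn_gt0.
        rewrite -Xr !(powRN _ th') lef_pV2 ?posrE ?powR_gt0 ?ltr0n//.
        have hle : X ^+ (m - k) <= (Num.truncn (X ^+ (m - k))).+2%:R.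
          by rewrite ltW// (lt_trans (truncnS_gt _))// ltr_nat.
        by apply: (ge0_ler_powR _ _ _ hle); rewrite ?nnegrE ?ler0n ?(ltW Xk) ?(ltW th'0).
      have h2 : g (lvl (fun k => 2 ^ k)%N k) <= K * (2 / r) * (2 ^- k * r ^+ k).
        rewrite -mulrA; case: (k : nat) => [|k'] /=.
          rewrite expr0 invr1 mul1r expr0 mulr1.
          have := hg 0%N; rewrite powR1 mulr1 => /le_trans; apply.
          by rewrite ler_peMr// ler_pdivlMr// mul1r; lra.
        apply: (le_trans (hg2 k')); rewrite ler_wpM2l//.
        rewrite le_eqVlt; apply/orP; left; apply/eqP.
        have pk : (2 ^+ k' : R) != 0 by rewrite expf_neq0// pnatr_eq0.
        by rewrite !exprS; field; rewrite ?rn0 ?pk.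
      have v0 : 0 <= variance_bound Cd al be (Num.truncn (X ^+ (m - k))).+2.
        by rewrite /variance_bound !mulr_ge0// powR_ge0.
      apply: (le_trans (ler_pM v0 (g0 _) h1 h2)).
      rewrite (_ : r ^+ m = r ^+ (m - k) * r ^+ k); last first.
        by rewrite -exprD subnK// ltnW.
      by rewrite le_eqVlt; apply/orP; left; apply/eqP; ring.
    rewrite -mulr_sumr [leRHS]mulrAC ler_wpM2l//.
      by rewrite !mulr_ge0 ?exprn_ge0 ?invr_ge0 ?(ltW r0).
    have h M : \sum_(k < M) (2 ^- k : R) = 2 - 2 * 2 ^- M.
      elim: M => [|M IH]; first by rewrite big_ord0 expr0 invr1; ring.
      rewrite big_ord_recr/= IH exprS; field; exact: expf_neq0.
    by rewrite h gerBl mulr_ge0// invr_ge0 exprn_ge0.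
  have Ke0 : 0 <= Ke.
    by rewrite mulr_ge0// addr_ge0 ?mulr_ge0 ?invr_ge0 ?subr_ge0 ?(ltW r0) ?(ltW r1).
  (* Here r^m = (Y^m)^(-th), and the maximality of m gives N < Kc Y^(m+1). *)
  rewrite -mulrA ler_wpM2l// -Yr !(powRN _ th).
  have KY : 0 < Kc * Y by rewrite mulr_gt0.
  have N0' : 0 < (N%:R : R) by exact: lt_le_trans N1.
  rewrite ler_pdivlMr ?powR_gt0// mulrC ler_pdivrMr ?powR_gt0 ?exprn_gt0//.
  rewrite -powRM ?exprn_ge0 ?(ltW Y0) ?(ltW KY)//.
  have hle : N%:R <= Kc * Y * Y ^+ m by rewrite -mulrA -exprS ltW.
  by apply: (ge0_ler_powR _ _ _ hle); rewrite ?nnegrE ?(ltW th0) ?(ltW N0') ?mulr_ge0 ?exprn_ge0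
    ?(ltW Y0) ?(ltW Kc0).
Qed.

End parameters.

(** * Variances and product kernels *)

Section square_integrable.
Context (R : realType) d (T : measurableType d) (P : probability T R).

Lemma integrable_EFinZ (c : R) (F : T -> R) :
  P.-integrable setT (EFin \o F) -> P.-integrable setT (EFin \o (fun x => c * F x)).
Proof. by move=> iF; exact: (integrableZl _ c iF). Qed.

Lemma integrable_EFinD (F G : T -> R) :
  P.-integrable setT (EFin \o F) -> P.-integrable setT (EFin \o G) ->
  P.-integrable setT (EFin \o (fun x => F x + G x)).
Proof. by move=> iF iG; exact: (integrableD _ iF iG). Qed.

Lemma integrable_prod (F G : T -> R) :
  measurable_fun setT F -> measurable_fun setT G ->
  (\int[P]_x (F x ^+ 2)%:E < +oo)%E -> (\int[P]_x (G x ^+ 2)%:E < +oo)%E ->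
  P.-integrable setT (fun x => (F x * G x)%:E).
Proof.
move=> mF mG F2 G2.
have iS (H : T -> R) : measurable_fun setT H -> (\int[P]_x (H x ^+ 2)%:E < +oo)%E ->
    P.-integrable setT (fun x => (H x ^+ 2)%:E).
  move=> mH H2; apply/integrableP; split.
    by apply/measurable_EFinP; exact: measurable_funX.
  by under eq_integral => x _ do rewrite gee0_abs ?lee_fin ?sqr_ge0//.
apply: (le_integrable _ _ _ (integrableD _ (iS F mF F2) (iS G mG G2))) => //.
  by apply/measurable_EFinP; exact: measurable_funM.
move=> x _ /=; rewrite lee_fin normrM [leRHS]ger0_norm ?addr_ge0 ?sqr_ge0//.
rewrite -(real_normK (num_real (F x))) -(real_normK (num_real (G x))).
have := sqr_ge0 (`|F x| - `|G x|); have := mulr_ge0 (normr_ge0 (F x)) (normr_ge0 (G x)); nra.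
Qed.

Lemma Rintegral_sum (I : Type) (s : seq I) (F : I -> T -> R) :
  (forall i, P.-integrable setT (EFin \o F i)) ->
  P.-integrable setT (EFin \o (fun x => \sum_(i <- s) F i x)) /\
  \int[P]_x (\sum_(i <- s) F i x) = \sum_(i <- s) \int[P]_x F i x.
Proof.
move=> iF; elim: s => [|i s [IH1 IH2]].
  have -> : (fun x => \sum_(i <- [::]) F i x) = cst 0 by apply/funext => x; rewrite big_nil.
  by rewrite big_nil Rintegral_prob_cst; split=> //; exact: finite_measure_integrable_cst.
have -> : (fun x => \sum_(j <- i :: s) F j x) = (fun x => F i x + \sum_(j <- s) F j x).
  by apply/funext => x; rewrite big_cons.
rewrite big_cons RintegralD// IH2; split => //.
exact: (integrableD _ (iF i) IH1).
Qed.

(** Expanding the square, only pairs related by [e] survive. Each is at most (V s + V t) / 2, and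
    each s has at most B partners. *)
Lemma sum_uncorrelated_le (S : finType) (Z : S -> T -> R) (V : S -> R)
    (e : rel S) (B : nat) :
  (forall s, measurable_fun setT (Z s)) ->
  (forall s, (\int[P]_x (Z s x ^+ 2)%:E <= (V s)%:E)%E) ->
  symmetric e ->
  (forall s t, ~~ e s t -> \int[P]_x (Z s x * Z t x) = 0) ->
  (forall s, (#|[pred t | e s t]| <= B)%N) ->
  (\int[P]_x ((\sum_s Z s x) ^+ 2)%:E <= (B%:R * \sum_s V s)%:E)%E.
Proof.
move=> mZ ZV esym ZZ0 eB.
have Z2 s : (\int[P]_x (Z s x ^+ 2)%:E < +oo)%E by apply: le_lt_trans (ZV s) _; rewrite ltry.
have V0 s : 0 <= V s.
  by rewrite -lee_fin (le_trans _ (ZV s))// integral_ge0// => x _; rewrite lee_fin sqr_ge0.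
have iZZ s t := integrable_prod (mZ s) (mZ t) (Z2 s) (Z2 t).
have [iS eS] := Rintegral_sum (index_enum S) (fun s : S =>
  (Rintegral_sum (index_enum S) (iZZ s)).1).
have E : (fun x => \sum_s \sum_t Z s x * Z t x) = (fun x => (\sum_s Z s x) ^+ 2).
  apply/funext => x; rewrite expr2 mulr_suml; apply: eq_bigr => s _.
  by rewrite mulr_sumr.
rewrite E in iS eS.
rewrite -(fineK (integrable_fin_num _ iS))// lee_fin.
rewrite [leLHS](_ : _ = \sum_s \sum_t \int[P]_x (Z s x * Z t x)); last first.
  rewrite -[LHS]/(\int[P]_x ((\sum_s Z s x) ^+ 2)) eS; apply: eq_bigr => s _.
  by rewrite (Rintegral_sum (index_enum S) (iZZ s)).2.
have le1 s t : \int[P]_x (Z s x * Z t x) <= if e s t then (V s + V t) / 2 else 0.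
  case: ifPn => [_|/ZZ0 ->//].
  have iss := iZZ s s; have itt := iZZ t t.
  have vs r : \int[P]_x (Z r x * Z r x) <= V r.
    rewrite -lee_fin fineK; last by apply: integrable_fin_num => //; exact: iZZ.
    by apply: le_trans (ZV r); under eq_integral do rewrite -expr2.
  apply: (@le_trans _ _ (\int[P]_x (2^-1 * (Z s x * Z s x + Z t x * Z t x)))).
    apply: le_Rintegral => //; first exact: iZZ.
      by apply: integrable_EFinZ; exact: integrable_EFinD.
    by move=> x _; have := sqr_ge0 (Z s x - Z t x); nra.
  rewrite RintegralZl//; last exact: (integrableD _ iss itt).
  by rewrite RintegralD//; have := vs s; have := vs t; lra.
have hB s : \sum_t (if e s t then V s / 2 else 0) <= B%:R * (V s / 2).
  rewrite -big_mkcond/= sumr_const -[leLHS]mulr_natl ler_wpM2r ?divr_ge0// ler_nat.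
  exact: eB.
have split2 : \sum_s \sum_t (if e s t then (V s + V t) / 2 else 0) =
    \sum_s \sum_t (if e s t then V s / 2 else 0) +
    \sum_s \sum_t (if e s t then V s / 2 else 0).
  rewrite [X in _ = _ + X]exchange_big/= -big_split/=; apply: eq_bigr => s _.
  rewrite -big_split/=; apply: eq_bigr => t _.
  by rewrite [e t s]esym; case: ifP => _; lra.
apply: (@le_trans _ _ (\sum_s \sum_t (if e s t then (V s + V t) / 2 else 0))).
  by apply: ler_sum => s _; apply: ler_sum => t _; exact: le1.
rewrite split2; apply: (@le_trans _ _ (\sum_s B%:R * (V s / 2) + \sum_s B%:R * (V s / 2))).
  by apply: lerD; apply: ler_sum => s _; exact: hB.
by rewrite -big_split/= mulr_sumr ler_sum// => s _; lra.
Qed.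

Lemma variance_law d2 (T2 : measurableType d2) (P2 : probability T2 R) (phi : T -> T2)
    (G : T2 -> R) :
  measurable_fun setT phi ->
  (forall A, measurable A -> P (phi @^-1` A) = P2 A) ->
  measurable_fun setT G ->
  variance P (fun x => G (phi x)) = variance P2 G.
Proof.
move=> mphi law mG; rewrite /variance unlock.
have E (H : T2 -> R) : measurable_fun setT H -> 'E_P[fun x => H (phi x)]%E = 'E_P2[H]%E.
  move=> mH; rewrite unlock.
  by apply: (integral_law mphi law (f := EFin \o H)); exact/measurable_EFinP.
rewrite (E G mG); set c := fine _.
rewrite -(E ((G \- cst c) * (G \- cst c))%R)//.
by apply: measurable_funM; apply: measurable_funB.
Qed.

Lemma variance_second_moment (X : T -> R) :
  variance P X = (\int[P]_x ((X x - \int[P]_y X y) ^+ 2)%:E)%E.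
Proof.
by rewrite /variance unlock unlock /=; under [RHS]eq_integral do rewrite expr2.
Qed.

End square_integrable.

(** By density every element is a pointwise limit of combinations of sections. *)
Lemma rk_measurable (R : realType) d (X : measurableType d) (L : X -> X -> R) (H : rkhs L) f :
  (forall y, measurable_fun setT (L ^~ y)) -> rk_set H f -> measurable_fun setT f.
Proof.
move=> mL Vf; have [l hl] := kspan_dense Vf.
apply: (@measurable_fun_cvg _ _ _ _ (fun n => kspan L (l n))) => [n|x _].
  rewrite /kspan; apply: measurable_sum => p.
  by apply: measurable_funM => //; exact: mL.
exact: (rk_cvg_eval (fun n => rk_set_kspan H (l n)) Vf hl).
Qed.

Section product_kernels.
Context (R : realType) (D : Type) (k : D -> D -> R).
Local Notation ku := (kprod k).
Implicit Types (u W : {fset nat}) (x y a : nat -> D).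

Lemma kprod_eq u x x' y y' : (forall j, j \in u -> x j = x' j) ->
  (forall j, j \in u -> y j = y' j) -> ku u x y = ku u x' y'.
Proof.
move=> hx hy; rewrite /kprod [LHS]big_seq [RHS]big_seq.
by apply: eq_bigr => j ju; rewrite hx ?hy.
Qed.

Lemma kprod0 x y : ku fset0 x y = 1.
Proof. by rewrite /kprod big_seq_fset0. Qed.

Lemma kprodID u W x y : ku u x y = ku (u `\` W)%fset x y * ku (u `&` W)%fset x y.
Proof.
rewrite /kprod (big_fsetID _ (mem W))/= mulrC; congr (_ * _).
  by apply: eq_fbigl => j; rewrite !inE andbC.
by apply: eq_fbigl => j; rewrite !inE.
Qed.

Lemma kprod_splice u W x y a :
  ku u (splice W x a) y = ku (u `\` W)%fset a y * ku (u `&` W)%fset x y.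
Proof.
rewrite (kprodID u W); congr (_ * _); apply: kprod_eq => // j; rewrite !inE /splice.
  by move=> /andP[/negbTE ->].
by move=> /andP[_ ->].
Qed.

Lemma kprod_imfset (w : {fset nat}) (phi : nat -> nat) x y : {in w &, injective phi} ->
  ku (phi @` w)%fset x y = ku w (x \o phi) (y \o phi).
Proof. by move=> phiI; rewrite /kprod big_imfset. Qed.

Lemma kprod_cst u (c : D) : ku u (fun=> c) (fun=> c) = k c c ^+ #|` u|.
Proof. by rewrite /kprod big_const_seq count_predT iter_mulr_1. Qed.

Context (Hu : forall u, rkhs (ku u)).

(** The value f x is the inner product of f with the section at x, which sees only the coordinates
    of x in u. *)
Lemma rk_kprod_dep u f : rk_set (Hu u) f -> depends_on [set j | j \in u] f.
Proof.
move=> Vf x y xy; rewrite -(rk_reproducing x Vf) -(rk_reproducing y Vf).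
by congr rk_dot; apply/funext => z; apply: kprod_eq.
Qed.

(** Freezing the coordinates outside W at a moves the factors k(a_j, y_j), j in u \ W, of each
    section into its coefficient; what is left is a combination for the kernel of the intersection
    of u and W. *)
Definition partial_eval u W a (l : seq (R * (nat -> D))) :=
  [seq (p.1 * ku (u `\` W)%fset a p.2, p.2) | p <- l].

Lemma kspan_partial_eval u W a l x :
  kspan (ku (u `&` W)%fset) (partial_eval u W a l) x = kspan (ku u) l (splice W x a).
Proof.
rewrite /kspan big_map; apply: eq_bigr => p _ /=.
by rewrite kprod_splice mulrA.
Qed.

(* With g the partially evaluated function and h the function g (x) k_{u \ W} (., a)
   of H(k_u), one has <f, h> = |g|^2 and |h|^2 = k_{u \ W} (a, a) |g|^2. *)
Lemma kform_partial_eval u W a l :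
  kform (ku (u `&` W)%fset) (partial_eval u W a l) (partial_eval u W a l) <=
  ku (u `\` W)%fset a a * kform (ku u) l l.
Proof.
set l' := partial_eval u W a l.
pose l2 := [seq (p.1, splice W p.2 a) | p <- l'].
set A := kform _ l' l'; set c := ku _ a a; set B := kform _ l l.
have sC y z : ku u y z = ku u z y by exact: kernelC (Hu u) _ _.
have sCI y z : ku (u `&` W)%fset y z = ku (u `&` W)%fset z y by exact: kernelC (Hu _) _ _.
have sCD y z : ku (u `\` W)%fset y z = ku (u `\` W)%fset z y by exact: kernelC (Hu _) _ _.
have A0 : 0 <= A by rewrite /A -(rk_dot_kspan2 (Hu _)) rk_dot_ge0//; exact: rk_set_kspan.
have c0 : 0 <= c by exact: kernel_ge0 (Hu _) _.
have B0 : 0 <= B by rewrite /B -(rk_dot_kspan2 (Hu u)) rk_dot_ge0//; exact: rk_set_kspan.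
have e1 : kform (ku u) l l2 = A.
  rewrite /A /kform big_map; apply: eq_bigr => p _; rewrite big_map; apply: eq_bigr => q _ /=.
  by rewrite sC kprod_splice (sCI q.2); ring.
have e2 : kform (ku u) l2 l2 = c * A.
  rewrite /A /kform big_map mulr_sumr; apply: eq_bigr => p _.
  rewrite big_map mulr_sumr; apply: eq_bigr => q _ /=.
  rewrite (kprodID u W).
  have -> : ku (u `&` W)%fset (splice W p.2 a) (splice W q.2 a) = ku (u `&` W)%fset p.2 q.2.
    by apply: kprod_eq => j; rewrite !inE /splice => /andP[_ ->].
  have -> : ku (u `\` W)%fset (splice W p.2 a) (splice W q.2 a) = c.
    by apply: kprod_eq => j; rewrite !inE /splice => /andP[/negbTE ->].
  ring.
have := rk_CS (rk_set_kspan (Hu u) l) (rk_set_kspan (Hu u) l2).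
rewrite !rk_dot_kspan2 e1 e2 -/B => h.
have [->|An0] := eqVneq A 0; first exact: mulr_ge0.
have A1 : 0 < A by rewrite lt_def An0.
by rewrite -(ler_pM2r A1) -expr2; apply: le_trans h _; rewrite mulrCA mulrA.
Qed.

End product_kernels.

Section product_kernels_measurable.
Context (R : realType) d (T : measurableType d) (k : T -> T -> R).
Hypothesis k_meas : measurable_fun setT (fun p : T * T => k p.1 p.2).

Lemma measurable_section (y : T) : measurable_fun setT (k ^~ y).
Proof.
have mg : measurable_fun setT (fun x : T => (x, y)) by exact: measurable_fun_pair.
exact: (measurableT_comp k_meas mg).
Qed.

Lemma measurable_kprod (u : {fset nat}) (y : nat -> T) :
  measurable_fun setT (fun x : fpower nat T => kprod k u x y).
Proof.
rewrite /kprod; apply: measurable_prod => j _.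
exact: (measurableT_comp (measurable_section (y j)) (@measurable_coord _ _ T j)).
Qed.

Lemma measurable_kprod_diag (u : {fset nat}) :
  measurable_fun setT (fun x : fpower nat T => kprod k u x x).
Proof.
rewrite /kprod; apply: measurable_prod => j _.
have mg : measurable_fun setT (fun x : fpower nat T => (x j, x j)).
  by apply: measurable_fun_pair; exact: measurable_coord.
exact: (measurableT_comp k_meas mg).
Qed.

End product_kernels_measurable.

(** * Building blocks *)

Section blocks.
Context (R : realType) (dO : measure_display) (Om : measurableType dO)
  (P : probability Om R) (dD : measure_display) (T : measurableType dD)
  (rho : probability T R).

(** [condition_star] with every coordinate of v covered. Recolored rules have this stronger
    property, so the family of weighted sets need not be tracked. *)
Definition own_coordinates (v : {fset nat}) n (Q : ralg R Om T v n) : Prop :=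
  forall (j : v) (i : 'I_n),
    (forall o o' : fpower v Om, o j = o' j -> ra_node Q i o j = ra_node Q i o' j) /\
    (forall A : set T, measurable A -> power P v [set o | A (ra_node Q i o j)] = rho A).

Lemma measurable_anchored (v : {fset nat}) d' (X : measurableType d')
    (F : X -> fpower v T) (a : nat -> T) :
  measurable_fun setT F ->
  measurable_fun setT (fun x => anchored (F x) a : fpower nat T).
Proof.
move=> mF; apply: measurable_fun_fpower => j; rewrite /anchored.
case: insub => [jj|] /=; last exact: measurable_cst.
exact: (measurableT_comp (@measurable_coord _ _ T jj) mF).
Qed.

Lemma measurable_ra_eval (v : {fset nat}) n (Q : ralg R Om T v n) (a : nat -> T) f :
  measurable_fun setT (f : fpower nat T -> R) -> measurable_fun setT (ra_eval Q a f).
Proof.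
move=> mf; rewrite /ra_eval; apply: measurable_sum => i.
apply: measurable_funM => //.
exact: (measurableT_comp mf (measurable_anchored a (ra_measurable Q i))).
Qed.

Section recoloring.
Context (w0 : {fset nat}) (n : nat) (Q0 : ralg R Om T w0 n) (phi : nat -> w0).

(** When each coordinate of a node of Q0 depends only on its own seed, coordinate [phi j] can be
    computed from the constant seed [o j]; the other coordinates obtained from that seed are
    discarded. *)
Definition recolor_node (v : {fset nat}) (i : 'I_n) (o : fpower v Om) : fpower v T :=
  fun j => ra_node Q0 i (fun=> o j) (phi (val j)).

Lemma measurable_own_node (i : 'I_n) (c : w0) :
  measurable_fun setT (fun t : Om => ra_node Q0 i (fun=> t) c).
Proof.
have mc : measurable_fun setT (fun t : Om => (fun=> t) : fpower w0 Om).
  by apply: measurable_fun_fpower => ?; exact: measurable_id.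
exact: (measurableT_comp (@measurable_coord _ _ T c) (measurableT_comp (ra_measurable Q0 i) mc)).
Qed.

Lemma measurable_recolor_node v (i : 'I_n) : measurable_fun setT (@recolor_node v i).
Proof.
apply: measurable_fun_fpower => j.
exact: (measurableT_comp (measurable_own_node i (phi (val j))) (@measurable_coord _ _ Om j)).
Qed.

(* The points of Q0, a rule on the colors w0, transported along the coloring
   phi; coordinates of equal color receive independent copies. *)
Definition recolor v : ralg R Om T v n :=
  Ralg (ra_weight Q0) (@measurable_recolor_node v).

Hypothesis own0 : own_coordinates Q0.

Lemma recolor_own v : own_coordinates (recolor v).
Proof.
move=> j i; split => [z z' zj|A mA]; first by rewrite /= /recolor_node zj.
have [own law] := own0 (phi (val j)) i.
rewrite -(law A mA).
pose B := [set t : Om | A (ra_node Q0 i (fun=> t) (phi (val j)))].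
have mB : measurable B.
  by rewrite -[B]setTI; exact: measurable_own_node.
rewrite (_ : [set o : fpower v Om | _] = (fun o => o j) @^-1` B)//.
rewrite (_ : [set o : fpower w0 Om | _] = (fun o => o (phi (val j))) @^-1` B).
  by rewrite !power_coord_law.
apply/seteqP; split => o /=; rewrite /B /=.
  by rewrite (own o (fun=> o (phi (val j)))).
by rewrite (own o (fun=> o (phi (val j)))).
Qed.

(** Both sides are the variance of one function G of seeds indexed by w: on the left v-indexed seeds
    are restricted to w, on the right color-indexed seeds are read along [phi]. Both maps of indices
    are injective, so the seeds seen by G have the same law. *)
Lemma recolor_variance v w (a : nat -> T) (f : (nat -> T) -> R) :
  (w `<=` v)%fset -> {in w &, injective phi} -> depends_on [set j | j \in w] f ->
  measurable_fun setT (f : fpower nat T -> R) ->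
  variance (power P v) (ra_eval (recolor v) a f) =
  variance (power P w0) (ra_eval Q0 a (fun x => f (fun j => x (val (phi j))))).
Proof.
move=> wv phiI df mf.
pose pt i (z : fpower w Om) : fpower nat T :=
  fun j => oapp (fun jj : w => ra_node Q0 i (fun=> z jj) (phi j)) (a j) (insub j).
pose G (z : fpower w Om) := \sum_(i < n) ra_weight Q0 i * f (pt i z).
have mG : measurable_fun setT G.
  apply: measurable_sum => i; apply: measurable_funM => //.
  suff mpt : measurable_fun setT (pt i) by exact: (measurableT_comp mf mpt).
  apply: measurable_fun_fpower => j; rewrite /pt.
  case: insub => [jj|] /=; last exact: measurable_cst.
  exact: (measurableT_comp (measurable_own_node i (phi j)) (@measurable_coord _ _ Om jj)).
have e1 : ra_eval (recolor v) a f = (fun o => G (coord_map (fincl wv) o)).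
  apply/funext => o; apply: eq_bigr => i _; congr (_ * _); apply: df => j /= jw.
  have jv : j \in v by exact: (fsubsetP wv).
  rewrite /anchored /pt (insubT (mem w) jw) (insubT (mem v) jv)/= /recolor_node /coord_map/=.
  by congr (ra_node _ _ _ _); apply/funext => _; congr o; exact: val_inj.
pose psi (jj : w) := phi (val jj).
have psiI : injective psi by move=> x y /phiI xy; apply: val_inj; apply: xy; exact: valP.
have fI : injective (fincl wv) by move=> x y /(congr1 val) xy; exact: val_inj.
have e2 : ra_eval Q0 a (fun x => f (fun j => x (val (phi j)))) = (fun o => G (coord_map psi o)).
  apply/funext => o; apply: eq_bigr => i _; congr (_ * _); apply: df => j /= jw.
  rewrite /anchored /pt valK/= (insubT (mem w) jw)/= /coord_map/psi/=.
  by apply: (own0 (phi j) i).1.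
rewrite e1 e2.
rewrite (variance_law (measurable_coord_map _) (power_coord_map_law P fI))//.
by rewrite (variance_law (measurable_coord_map _) (power_coord_map_law P psiI)).
Qed.

(** Renaming coordinates along [phi] turns k_w into the product kernel of the image of w, and by
    [rk_pullback] does not increase the norm. The bound for functions of colors then applies. *)
Lemma recolor_variance_le (k : T -> T -> R) (Hu : forall u, rkhs (kprod k u)) (B : R) v w a f :
  measurable_fun setT (fun p : T * T => k p.1 p.2) -> 0 <= B ->
  (forall u, (u `<=` w0)%fset -> forall g, rk_set (Hu u) g ->
    (variance (power P w0) (ra_eval Q0 a g) <= (B * rk_norm (Hu u) g ^+ 2)%:E)%E) ->
  (w `<=` v)%fset -> {in w &, injective phi} -> rk_set (Hu w) f ->
  (variance (power P v) (ra_eval (recolor v) a f) <= (B * rk_norm (Hu w) f ^+ 2)%:E)%E.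
Proof.
move=> mk B0 hB wv phiI Vf.
pose chi j := val (phi j).
have chiI : {in w &, injective chi} by move=> x y xw yw /val_inj; exact: phiI.
pose sig (x : nat -> T) : nat -> T := fun j => x (chi j).
(* A right inverse of [sig] on the coordinates in w: color c receives the coordinate of y at the j
   in w of that color. The default index is met only for colors not occurring in w, which the
   kernels do not see. *)
pose tau (y : nat -> T) : nat -> T := fun c => y (nth 0%N w (find (fun j => chi j == c) w)).
have tauE y j : j \in w -> tau y (chi j) = y j.
  move=> jw; rewrite /tau.
  have hj : has (fun j' => chi j' == chi j) w by apply/hasP; exists j.
  have /eqP := nth_find 0%N hj => /chiI -> //.
  by rewrite mem_nth// -has_find.
have [||Vs ns] := rk_pullback (H := Hu w) (Hu (chi @` w)%fset) (sig := sig) (tau := tau) _ _ Vf.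
- move=> x y; rewrite kprod_imfset//; apply: kprod_eq => // j jw.
  by rewrite /= tauE.
- move=> x y; rewrite kprod_imfset//; apply: kprod_eq => // j jw; by rewrite /= tauE.
rewrite (recolor_variance _ wv phiI)//.
- apply: (le_trans (hB _ _ _ Vs)).
    by apply/fsubsetP => _ /imfsetP[j _ ->]; exact: valP.
  rewrite lee_fin ler_wpM2l// ler_pXn2r// ?nnegrE ?rk_norm_ge0//.
- exact: rk_kprod_dep Vf.
- apply: (@rk_measurable R _ (fpower nat T) (kprod k w) (Hu w) f _ Vf) => y.
  exact: measurable_kprod.
Qed.

End recoloring.

Section moments.
Context (k : T -> T -> R).
Hypothesis k_int : forall y, rho.-integrable setT (EFin \o (k ^~ y)).
Hypothesis k_mean : forall y, \int[rho]_x k x y = 0.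
Context (a : nat -> T).

(** Coordinates of a node use independent seeds and have law [rho], so the expectation is a product
    of integrals of sections of k, each equal to 0; only the empty product survives. *)
Lemma own_mean_kprod (v w : {fset nat}) n (Q : ralg R Om T v n) (i : 'I_n) (y : nat -> T) :
  own_coordinates Q -> (w `<=` v)%fset ->
  (power P v).-integrable setT (EFin \o (fun o => kprod k w (anchored (ra_node Q i o) a) y)) /\
  \int[power P v]_o kprod k w (anchored (ra_node Q i o) a) y = (w == fset0)%:R.
Proof.
move=> own wv.
pose xi (jj : v) (t : Om) := ra_node Q i (fun=> t) jj.
have mxi jj : measurable_fun setT (xi jj) by exact: measurable_own_node.
have lawxi jj A : measurable A -> P (xi jj @^-1` A) = rho A.
  move=> mA; rewrite -((own jj i).2 A mA).
  rewrite (_ : [set o | _] = (fun o : fpower v Om => o jj) @^-1` (xi jj @^-1` A)).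
    rewrite power_coord_law//.
    by rewrite -[X in measurable X]setTI; exact: mxi.
  by apply/seteqP; split => o /=; rewrite /xi ((own jj i).1 o (fun=> o jj)).
pose h (jj : w) (t : Om) := k (xi (fincl wv jj) t) (y (val jj)).
have hint jj : P.-integrable setT (EFin \o h jj).
  exact: (integrable_law (mxi _) (lawxi _) (k_int (y (val jj)))).
have h0 jj : \int[P]_t h jj t = 0.
  rewrite -(k_mean (y (val jj))) /Rintegral.
  rewrite -(integral_law (mxi (fincl wv jj)) (lawxi (fincl wv jj)) (f :=
    EFin \o (k ^~ (y (val jj)))))//.
  exact: measurable_int (k_int _).
pose F (z : fpower w Om) := \prod_(jj <- index_enum w) h jj (z jj).
have [iF eF] := power_prod (@is_power_power _ _ _ P w) (index_enum_uniq w) (fun jj _ => hint jj).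
have fI : injective (fincl wv) by move=> x z /(congr1 val) xz; exact: val_inj.
have law := power_coord_map_law P fI.
have E : (fun o => kprod k w (anchored (ra_node Q i o) a) y) = (fun o =>
  F (coord_map (fincl wv) o)).
  apply/funext => o; rewrite /kprod big_seq_fsetE/=; apply: eq_bigr => jj _.
  rewrite /h /anchored (insubT (mem v) (fsubsetP wv _ (valP jj)))/= /xi /coord_map.
  have -> : Sub (val jj) (fsubsetP wv (val jj) (valP jj)) = fincl wv jj by exact: val_inj.
  by congr (k _ _); apply: (own (fincl wv jj) i).1.
rewrite E; split; first exact: (integrable_law (measurable_coord_map _) law iF).
have -> : \int[power P v]_o F (coord_map (fincl wv) o) = \int[power P w]_z F z.
  rewrite /Rintegral (integral_law (measurable_coord_map _) law (f := EFin \o F))//.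
  exact: measurable_int iF.
rewrite eF (eq_bigr (fun=> 0)) => [|jj _]; last exact: h0.
by rewrite prodr_const expr0n -cardfE cardfs_eq0.
Qed.

Lemma own_mean_kspan (v w : {fset nat}) n (Q : ralg R Om T v n) l :
  own_coordinates Q -> \sum_(i < n) ra_weight Q i = 1 -> (w `<=` v)%fset ->
  (power P v).-integrable setT (EFin \o ra_eval Q a (kspan (kprod k w) l)) /\
  \int[power P v]_o ra_eval Q a (kspan (kprod k w) l) o =
    if w == fset0 then \sum_(p <- l) p.1 else 0.
Proof.
move=> own w1 wv.
have h1 i p := own_mean_kprod i p own wv.
pose F i (p : R * (nat -> T)) o := p.1 * kprod k w (anchored (ra_node Q i o) a) p.2.
have iF i p : (power P v).-integrable setT (EFin \o F i p).
  by apply: integrable_EFinZ; exact: (h1 i p.2).1.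
have iG i : (power P v).-integrable setT
    (EFin \o (fun o => ra_weight Q i * kspan (kprod k w) l (anchored (ra_node Q i o) a))).
  by apply: integrable_EFinZ; exact: (Rintegral_sum l (iF i)).1.
have [iS eS] := Rintegral_sum (index_enum 'I_n) iG.
split => //; rewrite eS.
transitivity (\sum_(i < n) ra_weight Q i * (if w == fset0 then \sum_(p <- l) p.1 else 0)).
  apply: eq_bigr => i _; rewrite RintegralZl//; last exact: (Rintegral_sum l (iF i)).1.
  congr (_ * _); rewrite (Rintegral_sum l (iF i)).2.
  under eq_bigr => p _.
    rewrite /F RintegralZl//; last exact: (h1 i p.2).1.
    rewrite (h1 i p.2).2; over.
  case: eqP => _ /=; first by apply: eq_bigr => p _; rewrite mulr1.
  by rewrite big1// => p _; rewrite mulr0.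
by rewrite -mulr_suml w1 mul1r.
Qed.

End moments.

End blocks.

Lemma integral_prob_cst (R : realType) d (X : measurableType d) (QX : probability X R) (c : R) :
  (\int[QX]_x c%:E = c%:E)%E.
Proof. by rewrite integral_cst//= probability_setT mule1. Qed.

(** Cauchy-Schwarz for |x_i| <= sqrt(t_i q_i), obtained without roots from x_i x_j <= (t_i q_j + t_j
    q_i) / 2. *)
Lemma sqr_sum_le (R : realFieldType) (I : finType) (x q t : I -> R) :
  (forall i, 0 <= q i) -> (forall i, 0 <= t i) -> (forall i, x i ^+ 2 <= t i * q i) ->
  (\sum_i x i) ^+ 2 <= (\sum_i t i) * (\sum_i q i).
Proof.
move=> q0 t0 h.
have le2 i j : x i * x j <= (t i * q j + t j * q i) / 2.
  have a0 : 0 <= t i * q j by rewrite mulr_ge0.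
  have b0 : 0 <= t j * q i by rewrite mulr_ge0.
  apply: le_trans (ler_norm _) _.
  rewrite -(@ler_pXn2r _ 2)// ?nnegrE ?divr_ge0 ?addr_ge0//.
  rewrite real_normK ?num_real// exprMn.
  have := ler_pM (sqr_ge0 _) (sqr_ge0 _) (h i) (h j).
  rewrite (_ : t i * q i * (t j * q j) = (t i * q j) * (t j * q i)); last ring.
  by move=> /le_trans; apply; have := sqr_ge0 (t i * q j - t j * q i); nra.
rewrite expr2 mulr_suml.
apply: (@le_trans _ _ (\sum_i \sum_j (t i * q j + t j * q i) / 2)).
  by apply: ler_sum => i _; rewrite mulr_sumr; apply: ler_sum => j _.
have e1 : \sum_i \sum_j t i * q j = (\sum_i t i) * (\sum_i q i).
  by rewrite mulr_suml; apply: eq_bigr => i _; rewrite mulr_sumr.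
have e2 : \sum_i \sum_j t j * q i = (\sum_i t i) * (\sum_i q i) by rewrite exchange_big.
under eq_bigr => i _ do rewrite -mulr_suml big_split.
by rewrite -mulr_suml big_split/= e1 e2; lra.
Qed.

(** * The multilevel error for finite sums *)

Section multilevel.
Context (R : realType) (dO : measure_display) (Om : measurableType dO)
  (P : probability Om R) (dD : measure_display) (T : measurableType dD)
  (rho : probability T R) (k : T -> T -> R).
Hypothesis k_meas : measurable_fun setT (fun p : T * T => k p.1 p.2).
Hypothesis k_int : forall y, rho.-integrable setT (EFin \o (k ^~ y)).
Hypothesis k_mean : forall y, \int[rho]_x k x y = 0.
Context (Hu : forall u, rkhs (kprod k u)) (gam : {fset nat} -> R) (us : nat -> {fset nat})
  (a : nat -> T) (L n : nat -> nat) (m : nat)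
  (Q : forall j : 'I_m, ralg R Om T (level us L j.+1) (n j)) (vb : 'I_m -> R).
Hypothesis Lmono : forall i j, (i < j < m)%N -> (L i < L j)%N.
Hypothesis gam_us : forall j, 0 < gam (us j).
Hypothesis gam0 : gam fset0 = 1.
Hypothesis us_neq0 : forall j, us j != fset0.
Hypothesis vb_ge0 : forall j, 0 <= vb j.
Hypothesis Qown : forall j, own_coordinates P rho (Q j).
Hypothesis Qw : forall j : 'I_m, \sum_(i < n j) ra_weight (Q j) i = 1.
(** Stated for all subsets w of a weighted u, since freezing coordinates leads from H(k_u) to H(k_w)
    for a w that need not carry weight itself. *)
Hypothesis Qvar : forall (j : 'I_m) u w, 0 < gam u -> (w `<=` u)%fset ->
  (w `<=` level us L j.+1)%fset -> forall f, rk_set (Hu w) f ->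
  (variance (power P _) (ra_eval (Q j) a f) <= (vb j * rk_norm (Hu w) f ^+ 2)%:E)%E.

Local Notation ku := (kprod k).
Local Notation lv := (level us L).
Local Notation PM := (power P (ml_index us L m)).

(** The empty set is put in front of [us], so that all sets of positive weight are enumerated. *)
Definition supp (j : nat) : {fset nat} := if j is j'.+1 then us j' else fset0.

Lemma gam_supp j : 0 < gam (supp j).
Proof. by case: j => [|j] /=; rewrite ?gam0. Qed.

Lemma level_lvl i : lv i = \big[fsetU/fset0]_(j < lvl L i) us j.
Proof. by case: i => [|i] //=; rewrite big_ord0. Qed.

Lemma sub_level i j : (j < lvl L i)%N -> (us j `<=` lv i)%fset.
Proof. by move=> ji; rewrite level_lvl; exact: (@bigfcup_sup _ _ (index_enum _)
  (Ordinal ji) xpredT us (mem_index_enum _)). Qed.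

Lemma level_mono i : (i < m)%N -> (lv i `<=` lv i.+1)%fset.
Proof.
move=> im; rewrite level_lvl; apply/bigfcupsP => j _ _; apply: sub_level.
apply: leq_trans (ltn_ord j) _; case: i im j => //= i im _.
by apply: ltnW; apply: Lmono; rewrite ltnSn.
Qed.

Definition block_eval (i : 'I_m) u l (W : {fset nat}) (o : fpower (lv i.+1) Om) : R :=
  ra_eval (Q i) a (fun x => kspan (ku u) l (splice W x a)) o.

Arguments block_eval : clear implicits.

(** The expectation of [block_eval]: if u meets W, a factor of mean zero is present; otherwise the
    integrand is constant and the weights sum to 1. It does not depend on the block, which lets the
    means telescope over the levels. *)
Definition block_mean u l (W : {fset nat}) : R :=
  if (u `&` W == fset0)%fset then kspan (ku u) l a else 0.

Lemma block_evalE i u l W : block_eval i u l W =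
  ra_eval (Q i) a (kspan (ku (u `&` W)%fset) (partial_eval k u W a l)).
Proof.
apply/funext => o; apply: eq_bigr => j _; congr (_ * _).
by rewrite kspan_partial_eval.
Qed.

Lemma measurable_block_eval i u l W : measurable_fun setT (block_eval i u l W).
Proof.
rewrite block_evalE; apply: measurable_ra_eval; apply: measurable_sum => p.
by apply: measurable_funM => //; exact: measurable_kprod.
Qed.

Lemma block_eval_mean (i : 'I_m) u l W : (W `<=` lv i.+1)%fset ->
  (power P _).-integrable setT (EFin \o block_eval i u l W) /\
  \int[power P _]_o block_eval i u l W o = block_mean u l W.
Proof.
move=> Wv; rewrite block_evalE.
have uWv : (u `&` W `<=` lv i.+1)%fset by apply: fsubset_trans Wv; exact: fsubsetIr.
have [-> ->] := own_mean_kspan k_int k_mean a (partial_eval k u W a l) (@Qown i) (Qw i) uWv.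
split => //; rewrite /block_mean; case: eqP => // uW.
rewrite big_map; apply: eq_bigr => p _ /=; congr (_ * _).
by rewrite (kprodID k u W a) uW kprod0 mulr1.
Qed.

Lemma block_eval_var (i : 'I_m) u l W : 0 < gam u -> (W `<=` lv i.+1)%fset ->
  (\int[power P _]_o ((block_eval i u l W o - block_mean u l W) ^+ 2)%:E <=
   (vb i * (ku (u `\` W)%fset a a * kform (ku u) l l))%:E)%E.
Proof.
move=> gu Wv; have [iX eX] := block_eval_mean u l Wv.
rewrite -eX -variance_second_moment block_evalE.
have Vf := rk_set_kspan (Hu (u `&` W)%fset) (partial_eval k u W a l).
apply: (le_trans (Qvar gu (fsubsetIl u W) (fsubset_trans (fsubsetIr u W) Wv) Vf)).
rewrite lee_fin ler_wpM2l// rk_normE// rk_dot_kspan2.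
exact: kform_partial_eval.
Qed.

Definition seed_map (i : 'I_m) (j : lv i.+1) : ml_index us L m :=
  Tagged (fun k : 'I_m => lv k.+1) j.

Lemma seed_map_inj i : injective (@seed_map i).
Proof. by move=> x y /eqP; rewrite /seed_map eq_Tagged => /eqP. Qed.

Lemma seed_law i A : measurable A -> PM (coord_map (@seed_map i) @^-1` A) = power P _ A.
Proof. exact: power_coord_map_law (@seed_map_inj i) A. Qed.

Definition centered (i : 'I_m) u l W (o : fpower (ml_index us L m) Om) : R :=
  block_eval i u l W (coord_map (@seed_map i) o) - block_mean u l W.

Arguments centered : clear implicits.

Lemma measurable_centered i u l W : measurable_fun setT (centered i u l W).
Proof.
apply: measurable_funB => //.
exact: (measurableT_comp (@measurable_block_eval i u l W) (measurable_coord_map (@seed_map i))).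
Qed.

Lemma centered_mean (i : 'I_m) u l W : (W `<=` lv i.+1)%fset ->
  PM.-integrable setT (EFin \o centered i u l W) /\ \int[PM]_o centered i u l W o = 0.
Proof.
move=> Wv; have [iX eX] := block_eval_mean u l Wv.
have iS := integrable_law (measurable_coord_map _) (seed_law (i := i)) iX.
have ic : PM.-integrable setT (EFin \o (cst (block_mean u l W) : _ -> R)).
  exact: finite_measure_integrable_cst.
split; first exact: (integrableB _ iS ic).
rewrite RintegralB// Rintegral_prob_cst.
have -> : \int[PM]_o block_eval i u l W (coord_map (@seed_map i) o) = block_mean u l W.
  rewrite -eX /Rintegral.
  rewrite (integral_law (measurable_coord_map _) (seed_law (i := i)) (f :=
    EFin \o block_eval i u l W))//.
  exact: measurable_int iX.
by rewrite subrr.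
Qed.

Lemma centered_var (i : 'I_m) u l W : 0 < gam u -> (W `<=` lv i.+1)%fset ->
  (\int[PM]_o (centered i u l W o ^+ 2)%:E <=
   (vb i * (ku (u `\` W)%fset a a * kform (ku u) l l))%:E)%E.
Proof.
move=> gu Wv; apply: le_trans (block_eval_var l gu Wv).
pose f o := ((block_eval i u l W o - block_mean u l W) ^+ 2)%:E.
have mf : measurable_fun setT f.
  apply/measurable_EFinP; apply: measurable_funX; apply: measurable_funB => //.
  exact: measurable_block_eval.
have f0 o : (0 <= f o)%E by rewrite lee_fin sqr_ge0.
by rewrite -(ge0_integral_law (measurable_coord_map _) (seed_law (i := i)) mf f0).
Qed.

Lemma centered_dep i u l W :
  depends_on [set s : ml_index us L m | tag s = i /\ val (tagged s) \in u] (centered i u l W).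
Proof.
move=> z z' zz'; rewrite /centered block_evalE; congr (_ - _).
apply: eq_bigr => j _; congr (_ * _); apply: eq_bigr => p _; congr (_ * _).
apply: kprod_eq => // c; rewrite inE => /andP[cu _].
rewrite /anchored; case: insubP => //= s _ cs.
by apply: (Qown s j).1; rewrite /coord_map; apply: zz' => /=; rewrite cs.
Qed.

(** The contribution of u to block i applied to f - Psi_i f, minus its mean. For i = 0 the second
    centered term is zero, in accordance with Psi_0 = 0: with all coordinates frozen a block is
    exact. *)
Definition level_term (i : 'I_m) u l o : R :=
  gam u * (centered i u l (lv i.+1) o - centered i u l (lv i) o).

Arguments level_term : clear implicits.

Lemma measurable_level_term (i : 'I_m) u l : measurable_fun setT (level_term i u l).
Proof.
by apply: measurable_funM => //; apply: measurable_funB; exact: measurable_centered.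
Qed.

Lemma sub_level_succ (i : 'I_m) : (lv i `<=` lv i.+1)%fset.
Proof. exact: level_mono. Qed.

Lemma level_term_mean (i : 'I_m) u l :
  PM.-integrable setT (EFin \o level_term i u l) /\ \int[PM]_o level_term i u l o = 0.
Proof.
have [i1 e1] := centered_mean u l (fsubset_refl (lv i.+1)).
have [i2 e2] := centered_mean u l (sub_level_succ i).
have iB : PM.-integrable setT
    (EFin \o (fun o => centered i u l (lv i.+1) o - centered i u l (lv i) o)).
  exact: (integrableB _ i1 i2).
split; first exact: integrable_EFinZ.
by rewrite RintegralZl// RintegralB// e1 e2 subrr mulr0.
Qed.

Lemma level_term_eq0 (i : 'I_m) u l o : (u `<=` lv i)%fset -> level_term i u l o = 0.
Proof.
move=> uv; rewrite /level_term /centered /block_mean !block_evalE.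
have -> : (u `&` lv i.+1)%fset = u by apply/fsetIidPl; exact: fsubset_trans (sub_level_succ i).
have -> : (u `&` lv i)%fset = u by exact/fsetIidPl.
rewrite (_ : partial_eval k u (lv i.+1) a l = partial_eval k u (lv i) a l) ?subrr ?mulr0//.
apply: eq_map => p; congr (_ * _, _).
have -> : (u `\` lv i.+1)%fset = fset0.
  by apply/eqP; rewrite fsetD_eq0; exact: fsubset_trans (sub_level_succ i).
by have -> : (u `\` lv i)%fset = fset0 by apply/eqP; rewrite fsetD_eq0.
Qed.

Lemma level_term_var (K : R) (i : 'I_m) u l : 0 < gam u ->
  (forall w, (w `<=` u)%fset -> ku w a a <= K) ->
  (\int[PM]_o (level_term i u l o ^+ 2)%:E <=
   (4 * K * vb i * gam u * (gam u * kform (ku u) l l))%:E)%E.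
Proof.
move=> gu hK.
have B0 : 0 <= kform (ku u) l l.
  by rewrite -(rk_dot_kspan2 (Hu u)) rk_dot_ge0//; exact: rk_set_kspan.
pose F W o := (centered i u l W o ^+ 2)%:E.
have mF W : measurable_fun setT (F W).
  by apply/measurable_EFinP; apply: measurable_funX; exact: measurable_centered.
have F0 W o : (0 <= F W o)%E by rewrite lee_fin sqr_ge0.
have hF W : (W `<=` lv i.+1)%fset -> (\int[PM]_o F W o <= (vb i * (K * kform (ku u) l l))%:E)%E.
  move=> Wv; apply: (le_trans (centered_var l gu Wv)).
  by rewrite lee_fin ler_wpM2l// ler_wpM2r// hK// fsubsetDl.
apply: (@le_trans _ _ (\int[PM]_o ((2 * gam u ^+ 2)%:E * (F (lv i.+1) o + F (lv i) o)))%E).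
  apply: ge0_le_integral => //.
  - by move=> o _; rewrite lee_fin sqr_ge0.
  - apply/measurable_EFinP; apply: measurable_funX; exact: measurable_level_term.
  - by apply: measurable_funeM; apply: emeasurable_funD.
  - move=> o _; rewrite /F -EFinD -EFinM lee_fin /level_term exprMn.
    set x := centered _ _ _ _ _; set y := centered _ _ _ _ _.
    by have := mulr_ge0 (sqr_ge0 (gam u)) (sqr_ge0 (x + y)); nra.
rewrite ge0_integralZl//; last 3 first.
- by apply: emeasurable_funD.
- by move=> o _; rewrite adde_ge0.
- by rewrite lee_fin mulr_ge0// sqr_ge0.
rewrite ge0_integralD//.
apply: (@le_trans _ _ ((2 * gam u ^+ 2)%:E * ((vb i * (K * kform (ku u) l l))%:E +
    (vb i * (K * kform (ku u) l l))%:E))%E).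
  apply: lee_wpmul2l; first by rewrite lee_fin mulr_ge0// sqr_ge0.
  by apply: leeD; apply: hF; [exact: fsubset_refl|exact: sub_level_succ].
rewrite -EFinD -EFinM lee_fin le_eqVlt; apply/orP; left; apply/eqP; ring.
Qed.

Lemma level_term_dep (i : 'I_m) u l :
  depends_on [set s : ml_index us L m | tag s = i /\ val (tagged s) \in u] (level_term i u l).
Proof.
by move=> z z' zz'; rewrite /level_term !(@centered_dep i u l _ z z').
Qed.

(** The two terms read disjoint sets of seeds and are therefore independent, each with mean zero. *)
Lemma level_term_uncorrelated (i i' : 'I_m) u u' l :
  (i != i') || (u `&` u' == fset0)%fset ->
  \int[PM]_o (level_term i u l o * level_term i' u' l o) = 0.
Proof.
move=> h; have [i1 e1] := level_term_mean i u l; have [i2 e2] := level_term_mean i' u' l.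
have [|_ ->] := power_indep (@is_power_power _ _ _ P (ml_index us L m))
  (@level_term_dep i u l) _ i1 i2; last by rewrite e1 mul0r.
move=> z z' zz'; apply: level_term_dep => s /= [si su]; apply: zz' => /= -[si' su'].
case/orP: h => [/eqP|/eqP uu]; first by rewrite -si' -si.
by have : val (tagged s) \in (u `&` u')%fset; [rewrite inE su su'|rewrite uu inE].
Qed.

(** The means telescope over the blocks and leave the mean at the last level. The factor
    [(0 < i)%N%:R] encodes Psi_0 = 0. *)
Lemma ml_eval_terms J l o : (0 < m)%N ->
  ml_eval a Q (fun x => \sum_(j < J) gam (supp j) * kspan (ku (supp j)) l x) o =
  \sum_(j < J) gam (supp j) * block_mean (supp j) l (lv m) +
  \sum_(s : 'I_m * 'I_J) level_term s.1 (supp s.2) l o.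
Proof.
move=> m0; rewrite /ml_eval.
pose c (i : nat) (j : 'I_J) := gam (supp j) * block_mean (supp j) l (lv i).
pose c' (i : nat) j := (0 < i)%N%:R * c i j.
have PsiE (i : nat) f x : Psi us L a i f x = (0 < i)%N%:R * f (splice (lv i) x a).
  by case: i => [|i]; rewrite ?mul0r ?mul1r.
transitivity (\sum_(i < m) \sum_(j < J) (level_term i (supp j) l o + (c i.+1 j - c' i j))).
  apply: eq_bigr => i _; rewrite /ra_eval.
  pose pt h := anchored (ra_node (Q i) h (coord_map (@seed_map i) o)) a.
  (* Nodes of block i already agree with the anchor off [lv i.+1], so f and Psi_i f both take the
     form of f with coordinates frozen outside a level. *)
  have hpt h : splice (lv i.+1) (pt h) a = pt h.
    apply/funext => j; rewrite /splice /pt /anchored.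
    by case: ifPn => // jv; rewrite insubN.
  transitivity (\sum_(h < n i) \sum_(j < J) ra_weight (Q i) h * (gam (supp j) *
      (kspan (ku (supp j)) l (splice (lv i.+1) (pt h) a) -
       (0 < i)%N%:R * kspan (ku (supp j)) l (splice (lv i) (pt h) a)))).
    apply: eq_bigr => h _; rewrite -mulr_sumr; congr (_ * _).
    rewrite hpt PsiE -/(pt h) mulr_sumr -sumrB.
    by apply: eq_bigr => j _; rewrite mulrBr; congr (_ - _); exact: mulrCA.
  rewrite exchange_big/=; apply: eq_bigr => j _.
  transitivity (gam (supp j) * (block_eval i (supp j) l (lv i.+1) (coord_map (@seed_map i) o) -
     (0 < i)%N%:R * block_eval i (supp j) l (lv i) (coord_map (@seed_map i) o))).
    rewrite [block_eval _ _ _ (lv i.+1) _]/block_eval [block_eval _ _ _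
      (lv i) _]/block_eval /ra_eval.
    rewrite [(0 < i)%N%:R * _]mulr_sumr -sumrB mulr_sumr; apply: eq_bigr => h _; rewrite -/(pt h).
    ring.
  rewrite /level_term /centered /c' /c.
  have [i0|i0] := posnP i; last by rewrite /=; ring.
  have lv0 : lv i = fset0 by rewrite i0.
  rewrite lv0 (_ : block_eval i _ _ fset0 _ = block_mean (supp j) l fset0); last first.
    rewrite /block_mean /= fsetI0 eqxx /block_eval /ra_eval.
    have e0 x : splice (fset0 : {fset nat}) x a = a by apply/funext => t; rewrite /splice inE.
    transitivity (\sum_(h < n i) ra_weight (Q i) h * kspan (ku (supp j)) l a).
      by apply: eq_bigr => h _; congr (_ * kspan _ _ _); exact: e0.
    by rewrite -mulr_suml Qw mul1r.
  rewrite /=; ring.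
under eq_bigr do rewrite big_split/=.
rewrite big_split/= addrC; congr (_ + _); last by rewrite pair_big.
rewrite exchange_big/=; apply: eq_bigr => j _.
have tel M : \sum_(i < M.+1) (c i.+1 j - c' i j) = c M.+1 j.
  elim: M => [|M IH]; first by rewrite big_ord1 /c' mul0r subr0.
  by rewrite big_ord_recr/= IH /c' mul1r addrC subrK.
by rewrite -(prednK m0) tel.
Qed.

(** K1 bounds factors frozen at the anchor and K2 converts gamma into its hatted version; both will
    come from finite order, which confines the occurring powers of k(a, a) between two positive
    constants. B counts weighted sets meeting a given one, and tb bounds the tail beyond the last
    level. *)
Context (K1 K2 tb : R) (B : nat).
Local Notation g j := (gam (us j) * ku (us j) a a).
Hypothesis K1_ge0 : 0 <= K1.
Hypothesis K2_ge0 : 0 <= K2.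
Hypothesis hK1 : forall u w, 0 < gam u -> (w `<=` u)%fset -> ku w a a <= K1.
Hypothesis hK2 : forall j, gam (us j) <= K2 * g j.
Hypothesis g_mono : forall i j, (i <= j)%N -> g j <= g i.
Hypothesis hB : forall J u, 0 < gam u ->
  (#|[pred j : 'I_J | (u `&` supp j)%fset != fset0]| <= B)%N.
Hypothesis hJ : forall J, \sum_(lvl L m <= j < J) g j <= tb.

Lemma kform_ge0 u l : 0 <= kform (ku u) l l.
Proof. by rewrite -(rk_dot_kspan2 (Hu u)) rk_dot_ge0//; exact: rk_set_kspan. Qed.

Lemma ghat_ge0 j : 0 <= g j.
Proof. by rewrite mulr_ge0 ?(ltW (gam_us j))//; exact: kernel_ge0 (Hu _) _. Qed.

Lemma bias_le J l :
  (\sum_(j < J) gam (us j) * block_mean (us j) l (lv m)) ^+ 2 <=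
  tb * \sum_(j < J) gam (us j) * kform (ku (us j)) l l.
Proof.
(* Below [lvl L m] the set u_j is a nonempty subset of v_m, so its mean vanishes; every later u_j is
   charged in full, whether or not it meets v_m. *)
pose t j := if (j < lvl L m)%N then 0 else g j.
have t0 j : 0 <= t j by rewrite /t; case: ifP => // _; exact: ghat_ge0.
have q0 j : 0 <= gam (us j) * kform (ku (us j)) l l.
  by rewrite mulr_ge0 ?kform_ge0 ?(ltW (gam_us j)).
have h : (\sum_(j < J) gam (us j) * block_mean (us j) l (lv m)) ^+ 2 <=
    (\sum_(j < J) t j) * \sum_(j < J) gam (us j) * kform (ku (us j)) l l.
  apply: sqr_sum_le => // j; rewrite /t; case: ltnP => [jm|_].
    have uv : (us j `&` lv m)%fset = us j by apply/fsetIidPl; exact: sub_level.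
    rewrite /block_mean uv (negbTE (us_neq0 j)).
    by rewrite mulr0 expr0n mul0r.
  have h1 : block_mean (us j) l (lv m) ^+ 2 <= kform (ku (us j)) l l * ku (us j) a a.
    rewrite /block_mean; case: ifP => _.
      by rewrite -(rk_dot_kspan2 (Hu (us j))); apply: rk_eval_le; exact: rk_set_kspan.
    by rewrite expr0n mulr_ge0 ?kform_ge0//; exact: kernel_ge0 (Hu _) _.
  rewrite exprMn (_ : g j * _ = gam (us j) ^+ 2 * (kform (ku (us j)) l l * ku (us j) a a));
    last ring.
  by rewrite ler_wpM2l ?sqr_ge0.
apply: (le_trans h); rewrite ler_wpM2r ?sumr_ge0//.
rewrite -(big_mkord xpredT t); have [Jm|mJ] := leqP J (lvl L m).
  rewrite big_nat big1; first by apply: le_trans (hJ 0%N); rewrite big_geq.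
  by move=> j /andP[_ jJ]; rewrite /t (leq_trans jJ Jm).
rewrite (@big_cat_nat _ _ _ (lvl L m)) ?(ltnW mJ)//= [X in X + _]big_nat big1 ?add0r; last first.
  by move=> j /andP[_ jm]; rewrite /t jm.
apply: le_trans (hJ J); rewrite !big_nat ler_sum// => j /andP[mj _].
by rewrite /t ltnNge mj.
Qed.

(** The empty set contributes exactly the integral, so the error is minus the sum of the bias b and
    the level terms. From (b + z)^2 <= 2 b^2 + 2 z^2 come the 2 in front of [tb] and the 8, which is
    2 times the 4 of [level_term_var]. *)
Lemma multilevel_error J l : (0 < m)%N ->
  (\int[PM]_o (((\sum_(p <- l) p.1) - ml_eval a Q
      (fun x => \sum_(j < J.+1) gam (supp j) * kspan (ku (supp j)) l x) o) ^+ 2)%:E <=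
   ((2 * tb + 8 * B%:R * K1 * K2 * \sum_(i < m) vb i * g (lvl L i)) *
    \sum_(j < J.+1) gam (supp j) * kform (ku (supp j)) l l)%:E)%E.
Proof.
move=> m0.
pose S1 := \sum_(j < J.+1) gam (supp j) * kform (ku (supp j)) l l.
pose b := \sum_(j < J) gam (us j) * block_mean (us j) l (lv m).
pose Z (s : 'I_m * 'I_J.+1) := level_term s.1 (supp s.2) l.
pose V (s : 'I_m * 'I_J.+1) := if (supp s.2 `<=` lv s.1)%fset then 0 else
  4 * K1 * vb s.1 * gam (supp s.2) * (gam (supp s.2) * kform (ku (supp s.2)) l l).
have q0 j : 0 <= gam (supp j) * kform (ku (supp j)) l l.
  by rewrite mulr_ge0 ?kform_ge0 ?(ltW (gam_supp j)).
have hZ : (\int[PM]_o ((\sum_s Z s o) ^+ 2)%:E <= (B%:R * \sum_s V s)%:E)%E.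
  (* Only terms of the same block with intersecting sets may be correlated; a given term has at most
     B such partners, itself included. *)
  apply: (@sum_uncorrelated_le _ _ _ PM _ Z V
    (fun s t => (s.1 == t.1) && ((supp s.2 `&` supp t.2)%fset != fset0)) B).
  - by move=> s; exact: measurable_level_term.
  - move=> s; rewrite /V; case: ifPn => [sv|_].
      under eq_integral => o _ do rewrite /Z level_term_eq0// expr0n.
      by rewrite integral0.
    by apply: level_term_var => [|w wu]; [exact: gam_supp|exact: hK1 (gam_supp _) wu].
  - by move=> s t; rewrite eq_sym fsetIC.
  - move=> s t; rewrite negb_and negbK => h; exact: level_term_uncorrelated.
  - move=> s; apply: leq_trans (hB J.+1 (gam_supp s.2)).
    rewrite -(card_in_image (f := snd)).
      apply: subset_leq_card; apply/fintype.subsetP => j /fintype.imageP[t]; rewrite !inE.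
      by move=> /andP[_ h] ->.
    move=> [i1 j1] [i2 j2] /=; rewrite !inE /= => /andP[/eqP <- _] /andP[/eqP <- _] ->.
    by [].
have hV : \sum_s V s <= 4 * K1 * K2 * (\sum_(i < m) vb i * g (lvl L i)) * S1.
  rewrite -(pair_bigA _ (fun i j => V (i, j)))/= [X in _ <= X * S1]mulr_sumr [leRHS]mulr_suml;
    apply: ler_sum => i _.
  rewrite /S1 mulr_sumr; apply: ler_sum => j _; rewrite /V /=.
  have gl0 := ghat_ge0 (lvl L i).
  case: ifPn => [_|].
    by rewrite !mulr_ge0 ?(ltW (gam_supp j)) ?kform_ge0 ?(ltW (gam_us _))//;
      exact: kernel_ge0 (Hu _) _.
  case: (j : nat) => [|j'] /=; first by rewrite fsub0set.
  move=> nsub; rewrite ler_wpM2r ?(q0 j'.+1)//.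
  have ij : (lvl L i <= j')%N by rewrite leqNgt; apply: contra nsub; exact: sub_level.
  have : gam (us j') <= K2 * g (lvl L i).
    by apply: le_trans (hK2 j') _; rewrite ler_wpM2l// g_mono.
  move=> h; rewrite (_ : 4 * K1 * K2 * _ = 4 * K1 * vb i * (K2 * g (lvl L i))); last ring.
  by rewrite ler_wpM2l// !mulr_ge0.
have hb : b ^+ 2 <= tb * S1.
  apply: (le_trans (bias_le J l)); apply: ler_wpM2l.
    by apply: le_trans (hJ 0%N); rewrite big_geq.
  by rewrite /S1 big_ord_recl/= lerDr; have := q0 0%N.
have E o : (\sum_(p <- l) p.1) - ml_eval a Q
      (fun x => \sum_(j < J.+1) gam (supp j) * kspan (ku (supp j)) l x) o =
      - (b + \sum_s Z s o).
  rewrite ml_eval_terms// big_ord_recl/= gam0 /block_mean fset0I eqxx mul1r.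
  have -> : kspan (ku fset0) l a = \sum_(p <- l) p.1.
    by apply: eq_bigr => p _; rewrite kprod0 mulr1.
  rewrite -/b /Z; ring.
under eq_integral do rewrite E sqrrN.
have mZ : measurable_fun setT (fun o => \sum_s Z s o).
  by apply: measurable_sum => s; exact: measurable_level_term.
apply: (@le_trans _ _ (\int[PM]_o ((2 * b ^+ 2)%:E + 2%:E * ((\sum_s Z s o) ^+ 2)%:E))%E).
  apply: ge0_le_integral => //.
  - by move=> o _; rewrite lee_fin sqr_ge0.
  - by apply/measurable_EFinP; apply: measurable_funX; apply: measurable_funD.
  - apply/measurable_EFinP; apply: measurable_funD => //; apply: measurable_funM => //.
    exact: measurable_funX.
  - move=> o _; rewrite -EFinM -EFinD lee_fin.
    by have := sqr_ge0 (b - \sum_s Z s o); nra.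
have m2 : measurable_fun setT (fun o => ((\sum_s Z s o) ^+ 2)%:E).
  by apply/measurable_EFinP; exact: measurable_funX.
rewrite ge0_integralD//; last 3 first.
- by move=> o _; rewrite lee_fin mulr_ge0// sqr_ge0.
- by move=> o _; rewrite mule_ge0// lee_fin sqr_ge0.
- exact: measurable_funeM.
rewrite integral_prob_cst ge0_integralZl//; last first.
  by move=> o _; rewrite lee_fin sqr_ge0.
apply: (@le_trans _ _ ((2 * b ^+ 2)%:E + 2%:E * (B%:R * \sum_s V s)%:E)%E).
  by apply: leeD => //; exact: lee_wpmul2l.
rewrite -EFinM -EFinD lee_fin -/S1.
have hB0 : 0 <= B%:R :> R by rewrite ler0n.
have := ler_wpM2l hB0 hV; nra.
Qed.

End multilevel.

(** * The weighted kernel *)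

Section summation.
Context (R : realType) (T : choiceType) (e : nat -> T).
Hypothesis eI : injective e.

Lemma esum_range (F : T -> \bar R) : (forall t, 0 <= F t)%E ->
  (forall t, ~ range e t -> F t = 0%E) ->
  (\esum_(t in setT) F t = \sum_(j <oo) F (e j))%E.
Proof.
move=> F0 Fe; rewrite nneseries_esumT//.
rewrite -(esum_image setT e)//; last by move=> i j _ _; exact: eI.
rewrite [RHS]esum_mkcond; apply: eq_esum => t _; case: ifPn => //.
by move=> /negP te; apply: Fe => h; apply: te; rewrite inE.
Qed.

(** The positive and negative parts are treated separately, as in [rsum]; each is a convergent
    series of nonnegative terms. *)
Lemma rsum_cvg (F : T -> R) : (forall t, ~ range e t -> F t = 0) ->
  (\sum_(j <oo) `|F (e j)|%:E < +oo)%E ->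
  \sum_(j < J) F (e j) @[J --> \oo] --> rsum F.
Proof.
move=> Fe Fs.
pose p j : R := Num.max (F (e j)) 0; pose q j : R := Num.max (- F (e j)) 0.
have E1 : (\esum_(t in setT) (EFin \o F)^\+ t = \sum_(j <oo) (p j)%:E)%E.
  rewrite esum_range => [|t|t te].
  - by apply: eq_eseriesr => j _; rewrite funeposE EFin_max.
  - exact: funepos_ge0.
  - by rewrite funeposE /= Fe// maxxx.
have E2 : (\esum_(t in setT) (EFin \o F)^\- t = \sum_(j <oo) (q j)%:E)%E.
  rewrite esum_range => [|t|t te].
  - by apply: eq_eseriesr => j _; rewrite funenegE EFin_max.
  - exact: funeneg_ge0.
  - by rewrite funenegE /= Fe// oppr0 maxxx.
have cv (r : nat -> R) : (forall j, 0 <= r j) -> (forall j, r j <= `|F (e j)|) ->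
    (\sum_(j <oo) (r j)%:E)%E \is a fin_num /\
    \sum_(j < J) r j @[J --> \oo] --> fine (\sum_(j <oo) (r j)%:E)%E.
  move=> r0 rF.
  have fin : (\sum_(j <oo) (r j)%:E)%E \is a fin_num.
    rewrite ge0_fin_numE; last by apply: nneseries_ge0 => j _ _; rewrite lee_fin.
    apply: le_lt_trans Fs; apply: lee_nneseries => j _ *; rewrite lee_fin//.
  split => //.
  have h : (fun J => (\sum_(j < J) r j)%:E) @ \oo --> (fine (\sum_(j <oo) (r j)%:E))%:E.
    rewrite fineK//.
    have := @is_cvg_nneseries R (fun j => (r j)%:E) xpredT 0%N (fun j _ _ => r0 j).
    by under eq_fun do rewrite big_mkord sumEFin.
  exact: (fine_cvg h).
have p0 j : 0 <= p j by rewrite le_max lexx orbT.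
have q0 j : 0 <= q j by rewrite le_max lexx orbT.
have pF j : p j <= `|F (e j)| by rewrite ge_max ler_norm normr_ge0.
have qF j : q j <= `|F (e j)| by rewrite ge_max normr_ge0 andbT -normrN ler_norm.
have [fp cp] := cv p p0 pF.
have [fq cq] := cv q q0 qF.
rewrite /rsum E1 E2 fineB//.
have -> : (fun J => \sum_(j < J) F (e j)) = (fun J => \sum_(j < J) p j - \sum_(j < J) q j).
  apply/funext => J; rewrite -sumrB; apply: eq_bigr => j _; rewrite /p /q.
  by case: (leP (F (e j)) 0); case: (leP (- F (e j)) 0); lra.
exact: cvgB.
Qed.

End summation.

Lemma zextE (R : realType) (T : Type) (X : set T) (f : X -> R) (x : X) :
  zext f (val x) = f x.
Proof. by rewrite /zext valK. Qed.

Lemma zext_mem (R : realType) (T : Type) (X : set T) (f : X -> R) x (Xx : X x) :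
  zext f x = f (SigSub (mem_set Xx)).
Proof. by rewrite -[x in LHS]/(val (SigSub (mem_set Xx) : X)) zextE. Qed.

Section weighted_kernel.
Context (R : realType) (dD : measure_display) (T : measurableType dD)
  (rho : probability T R) (mu : probability (fpower nat T) R) (hmu : is_power rho mu)
  (k : T -> T -> R).
Hypothesis k_meas : measurable_fun setT (fun p : T * T => k p.1 p.2).
Context (M : R) (hM : (\int[rho]_x (k x x)%:E = M%:E)%E).
Hypothesis k_mean0 : forall y, \int[rho]_x k x y = 0.
Hypothesis k_ge0 : forall x, 0 <= k x x.
Hypothesis k_int : forall y, rho.-integrable setT (EFin \o (k ^~ y)).
Context (Hu : forall u, rkhs (kprod k u)) (gam : {fset nat} -> R) (us : nat -> {fset nat}).
Hypothesis gam_ge0 : forall u, 0 <= gam u.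
Hypothesis gam0 : gam fset0 = 1.
Hypothesis gam_sum : (\esum_(u in setT) (gam u * M ^+ #|` u|)%:E < +oo)%E.
Hypothesis us_inj : injective us.
Hypothesis us_range : range us = [set u | u != fset0 /\ 0 < gam u].
Local Notation ku := (kprod k).
Local Notation su := (supp us).
Local Notation X := (Xdom k gam).

Lemma supp_inj : injective su.
Proof.
have us0 j : us j != fset0.
  by have [] : [set u | u != fset0 /\ 0 < gam u] (us j) by rewrite -us_range; exists j.
move=> [|i] [|j] //=.
- by move=> /esym/eqP; rewrite (negbTE (us0 j)).
- by move=> /eqP; rewrite (negbTE (us0 i)).
- by move=> /us_inj ->.
Qed.

Lemma supp_range u : ~ range su u -> gam u = 0.
Proof.
move=> h; apply/eqP/negPn/negP => g0; apply: h.
have [->|u0] := eqVneq u fset0; first by exists 0%N.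
have : range us u by rewrite us_range /=; split=> //; rewrite lt_def g0 gam_ge0.
by case=> j _ <-; exists j.+1.
Qed.

Definition ksum (J : nat) x y : R := \sum_(j < J) gam (su j) * ku (su j) x y.

(** The diagonal K(x, x), extended to all of D^nat with the value +oo exactly off X. It makes X
    measurable and is the integrable majorant for all limits of integrals. *)
Definition kdiag (x : nat -> T) : \bar R := (\sum_(j <oo) (gam (su j) * ku (su j) x x)%:E)%E.

Lemma kprod_ge0 u x : 0 <= ku u x x. Proof. exact: kernel_ge0 (Hu u) x. Qed.

Lemma gku_ge0 u x : 0 <= gam u * ku u x x.
Proof. by rewrite mulr_ge0 ?kprod_ge0. Qed.

Lemma XdomE x : X x = (kdiag x < +oo)%E.
Proof.
rewrite /Xdom /kdiag /= (esum_range supp_inj)// => [u|u /supp_range ->].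
  by rewrite lee_fin gku_ge0.
by rewrite mul0r.
Qed.

Lemma kdiag_ge0 x : (0 <= kdiag x)%E.
Proof. by apply: nneseries_ge0 => j _ _; rewrite lee_fin gku_ge0. Qed.

Lemma kdiag_fin x : X x -> kdiag x \is a fin_num.
Proof. by rewrite XdomE => h; rewrite ge0_fin_numE ?kdiag_ge0. Qed.

Lemma ksum_diag_le J x : X x -> ksum J x x <= fine (kdiag x).
Proof.
move=> Xx; rewrite -lee_fin fineK ?kdiag_fin// /ksum -sumEFin -(big_mkord xpredT (fun j =>
  (gam (su j) * ku (su j) x x)%:E)).
by apply: nneseries_lim_ge => j _ _; rewrite lee_fin gku_ge0.
Qed.

Lemma sum_abs_gku_le J x y : X x -> X y ->
  \sum_(j < J) `|gam (su j) * ku (su j) x y| <= (fine (kdiag x) + fine (kdiag y)) / 2.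
Proof.
move=> Xx Xy.
apply: (@le_trans _ _ ((ksum J x x + ksum J y y) / 2)).
  rewrite /ksum -big_split/= mulr_suml; apply: ler_sum => j _.
  rewrite normrM (ger0_norm (gam_ge0 _)) -mulrDr -mulrA ler_wpM2l//.
  exact: kernel_le (Hu _) _ _.
by rewrite ler_wpM2r// lerD// ksum_diag_le.
Qed.

Lemma ksum_le J x y : X x -> X y -> `|ksum J x y| <= (fine (kdiag x) + fine (kdiag y)) / 2.
Proof. by move=> Xx Xy; apply: le_trans (sum_abs_gku_le J Xx Xy); exact: ler_norm_sum. Qed.

Lemma ksum_cvg (x y : X) : ksum J (val x) (val y) @[J --> \oo] --> Kker k gam x y.
Proof.
have Xx : X (val x) by exact: set_valP.
have Xy : X (val y) by exact: set_valP.
apply: (rsum_cvg supp_inj (F := fun u => gam u * ku u (val x) (val y))) => [u /supp_range ->|].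
  by rewrite mul0r.
apply: (@le_lt_trans _ _ ((fine (kdiag (val x)) + fine (kdiag (val y))) / 2)%:E); last exact: ltry.
apply: lime_le; first exact: is_cvg_nneseries.
by apply: nearW => J; rewrite big_mkord sumEFin lee_fin; exact: sum_abs_gku_le.
Qed.

Lemma measurable_kdiag : measurable_fun setT (kdiag : fpower nat T -> \bar R).
Proof.
apply: ge0_emeasurable_sum => [j x _ _|j _]; first by rewrite lee_fin gku_ge0.
apply/measurable_EFinP; apply: measurable_funM => //; exact: measurable_kprod_diag.
Qed.

Lemma measurable_Xdom : measurable (X : set (fpower nat T)).
Proof.
have -> : X = setT `&` kdiag @^-1` [set y | (y < +oo)%E].
  by apply/seteqP; split => x /=; rewrite XdomE => // -[].
apply: measurable_kdiag => //.
have -> : [set y : \bar R | (y < +oo)%E] = `]-oo, +oo%E[%classic.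
  by apply/seteqP; split => y; rewrite /= in_itv.
exact: emeasurable_itv.
Qed.

(** Termwise integration gives the sum of the gamma_u M^|u|, as each factor k(x_j, x_j) has integral
    M. *)
Lemma integral_kdiag : mu.-integrable setT (kdiag : fpower nat T -> \bar R).
Proof.
apply/integrableP; split; first exact: measurable_kdiag.
under eq_integral do rewrite gee0_abs ?kdiag_ge0//.
rewrite /kdiag integral_nneseries//; last 2 first.
- move=> j; apply/measurable_EFinP; apply: measurable_funM => //; exact: measurable_kprod_diag.
- by move=> j x _; rewrite lee_fin gku_ge0.
apply: le_lt_trans gam_sum.
have M0 : 0 <= M by rewrite -lee_fin -hM integral_ge0// => x _; rewrite lee_fin.
rewrite (esum_range supp_inj) => [|u|u /supp_range ->]; last 2 first.
- by rewrite lee_fin mulr_ge0// exprn_ge0.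
- by rewrite mul0r.
apply: lee_nneseries => [j _ _|j _].
  by apply: integral_ge0 => x _; rewrite lee_fin gku_ge0.
have ikk : rho.-integrable setT (EFin \o (fun x => k x x)).
  apply/integrableP; split.
    apply/measurable_EFinP; apply: (measurableT_comp k_meas (g := fun x => (x, x))).
    exact: measurable_fun_pair.
  by under eq_integral do rewrite gee0_abs ?lee_fin//; rewrite hM ltry.
have [iP eP] := power_prod hmu (h := fun _ x => k x x) (fset_uniq (su j)) (fun _ _ => ikk).
have -> : (\int[mu]_x (gam (su j) * ku (su j) x x)%:E = (gam (su j) * \int[mu]_x ku
  (su j) x x)%:E)%E.
  have -> : gam (su j) * \int[mu]_x ku (su j) x x = \int[mu]_x (gam (su j) * ku (su j) x x).
    by rewrite RintegralZl.
  by rewrite fineK//; apply: integrable_fin_num => //; exact: (integrable_EFinZ _ iP).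
rewrite lee_fin ler_wpM2l// /kprod eP big_const_seq count_predT iter_mulr_1.
by rewrite /Rintegral hM.
Qed.

Lemma mu_XdomC : mu (~` (X : set (fpower nat T))) = 0%E.
Proof.
have [N [mN N0 hN]] := integrable_ae measurableT integral_kdiag.
apply/eqP; rewrite eq_le measure_ge0 andbT -N0.
apply: le_measure; [by rewrite inE; apply: measurableC; exact: measurable_Xdom|by rewrite inE|].
move=> x /= nX; apply: hN => /= /(_ I); rewrite ge0_fin_numE ?kdiag_ge0// => h.
by apply: nX; rewrite XdomE.
Qed.

Lemma Rintegral_Xdom (F : fpower nat T -> R) : mu.-integrable setT (EFin \o F) ->
  \int[mu]_(x in X) F x = \int[mu]_x F x.
Proof.
move=> iF; rewrite /Rintegral.
have mXC : measurable (~` (X : set (fpower nat T))) by apply: measurableC; exact: measurable_Xdom.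
rewrite (negligible_integral mXC measurableT iF mu_XdomC).
by rewrite setTD setCK.
Qed.

Lemma integral_kprod u y :
  mu.-integrable setT (EFin \o (fun x => ku u x y)) /\ \int[mu]_x ku u x y = (u == fset0)%:R.
Proof.
have [iP eP] := power_prod hmu (h := fun j t => k t (y j)) (fset_uniq u) (fun j _ => k_int (y j)).
split => //; rewrite /kprod eP; have [->|/fset0Pn[j ju]] := eqVneq u fset0.
  by rewrite big_seq_fset0.
by rewrite (big_fsetD1 j)//= k_mean0 mul0r.
Qed.

(** Nonempty sets integrate to zero, so the value is the same for every J. *)
Lemma integral_finite_part J l :
  \int[mu]_(x in X) (\sum_(j < J.+1) gam (su j) * kspan (ku (su j)) l x) = \sum_(p <- l) p.1.
Proof.
have i1 u p : mu.-integrable setT (EFin \o (fun x => p.1 * ku u x p.2)).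
  by apply: integrable_EFinZ; exact: (integral_kprod u p.2).1.
have i2 u : mu.-integrable setT (EFin \o (fun x => gam u * kspan (ku u) l x)).
  by apply: integrable_EFinZ; exact: (Rintegral_sum l (i1 u)).1.
have [i3 e3] := Rintegral_sum (index_enum 'I_J.+1) (fun j : 'I_J.+1 => i2 (su j)).
rewrite Rintegral_Xdom// e3.
have e (u : {fset nat}) : \int[mu]_x (gam u * kspan (ku u) l x) =
    gam u * ((u == fset0)%:R * \sum_(p <- l) p.1).
  rewrite RintegralZl//; last exact: (Rintegral_sum l (i1 u)).1.
  rewrite (Rintegral_sum l (i1 u)).2; congr (_ * _); rewrite [RHS]mulr_sumr; apply: eq_bigr => p _.
  by rewrite RintegralZl//; [rewrite (integral_kprod u p.2).2 mulrC|exact: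
    (integral_kprod u p.2).1].
under eq_bigr do rewrite e.
rewrite big_ord_recl (_ : su ord0 = fset0)// eqxx gam0 !mul1r [X in _ + X]big1 ?addr0// => j _ /=.
have -> : (us j == fset0) = false.
  apply/negbTE.
  by have [] : [set u | u != fset0 /\ 0 < gam u] (us j) by rewrite -us_range; exists j.
by rewrite mul0r mulr0.
Qed.

End weighted_kernel.

(** * Passage to the unit ball *)

Section limits.
Context (R : realType).

Lemma cvg_bigsum (I : Type) (s : seq I) (u : nat -> I -> R) (l : I -> R) :
  (forall i, u J i @[J --> \oo] --> l i) ->
  \sum_(i <- s) u J i @[J --> \oo] --> \sum_(i <- s) l i.
Proof.
move=> h; elim: s => [|i s IH].
  by rewrite big_nil; under eq_fun do rewrite big_nil; exact: cvg_cst.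
by rewrite big_cons; under eq_fun do rewrite big_cons; exact: cvgD.
Qed.

Lemma Rintegral_cvg d (S : measurableType d) (mu : {measure set S -> \bar R}) (X : set S)
    (G_ : nat -> S -> R) (G h : S -> R) : measurable X ->
  (forall n, measurable_fun X (G_ n)) ->
  (forall x, X x -> G_ n x @[n --> \oo] --> G x) ->
  mu.-integrable X (EFin \o h) -> (forall n x, X x -> `|G_ n x| <= h x) ->
  \int[mu]_(x in X) G_ n x @[n --> \oo] --> \int[mu]_(x in X) G x.
Proof.
move=> mX mG GG ih Gh.
have mGl : measurable_fun X G by exact: measurable_fun_cvg GG.
have [] := @dominated_convergence _ _ _ mu X mX (fun n => EFin \o G_ n) (EFin \o G) (EFin \o h).
- by move=> n; exact/measurable_EFinP.
- exact/measurable_EFinP.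
- by apply: aeW => x Xx; apply: cvg_EFin; [apply: nearW|exact: GG].
- exact: ih.
- by apply: aeW => x n Xx; rewrite /= lee_fin Gh.
move=> iG _ cG; apply: fine_cvg.
rewrite fineK; last exact: integrable_fin_num.
exact: cG.
Qed.

Lemma second_moment_limit d (S : measurableType d) (PS : {measure set S -> \bar R})
    (F_ : nat -> S -> R) (F : S -> R) (B : R) :
  (forall n, measurable_fun setT (F_ n)) ->
  (forall o, F_ n o @[n --> \oo] --> F o) ->
  (forall n, \int[PS]_o ((F_ n o) ^+ 2)%:E <= B%:E)%E ->
  (\int[PS]_o ((F o) ^+ 2)%:E <= B%:E)%E.
Proof.
move=> mF FF hB.
have E o : (((F o) ^+ 2)%:E = limn_einf (fun n => ((F_ n o) ^+ 2)%:E))%E.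
  rewrite (cvg_limn_einf_sup (l := ((F o) ^+ 2)%:E) _).1//.
  apply: cvg_EFin; first exact: nearW.
  by rewrite expr2; under eq_fun do rewrite /= expr2; apply: cvgM; exact: FF.
under eq_integral do rewrite E.
apply: (le_trans (fatou PS measurableT (f := fun n o => ((F_ n o) ^+ 2)%:E) _ _)).
- by move=> n; apply/measurable_EFinP; exact: measurable_funX.
- by move=> n o _; rewrite lee_fin sqr_ge0.
rewrite limn_einf_lim; apply: lime_le; first exact: is_cvg_einfs.
apply: nearW => n; apply: le_trans (hB n).
by apply: ereal_inf_lbound; exists n => /=.
Qed.

End limits.

Section ml_eval_limits.
Context (R : realType) (dO : measure_display) (Om : measurableType dO)
  (P : probability Om R) (dD : measure_display) (T : measurableType dD)
  (us : nat -> {fset nat}) (a : nat -> T) (L n : nat -> nat) (m : nat)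
  (Q : forall j : 'I_m, ralg R Om T (level us L j.+1) (n j))
  (X : set (fpower nat T)) (mX : measurable X)
  (hX : forall (v : {fset nat}) x, X (splice v x a)).

Lemma anchored_mem (v : {fset nat}) (x : v -> T) : X (anchored x a).
Proof.
rewrite (_ : anchored x a = splice v (anchored x a) a); first exact: hX.
by apply/funext => j; rewrite /splice /anchored; case: ifPn => // jv; rewrite insubN.
Qed.

Lemma Psi_cvg (G_ : nat -> (nat -> T) -> R) (G : (nat -> T) -> R) i x :
  (forall x, X x -> G_ J x @[J --> \oo] --> G x) ->
  Psi us L a i (G_ J) x @[J --> \oo] --> Psi us L a i G x.
Proof.
by move=> h; case: i => [|i] /=; [exact: cvg_cst|apply: h; exact: hX].
Qed.

Lemma ml_eval_cvg (G_ : nat -> (nat -> T) -> R) (G : (nat -> T) -> R) z :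
  (forall x, X x -> G_ J x @[J --> \oo] --> G x) ->
  ml_eval a Q (G_ J) z @[J --> \oo] --> ml_eval a Q G z.
Proof.
move=> h; apply: cvg_bigsum => i; apply: cvg_bigsum => s.
apply: cvgMr; apply: cvgB; first by apply: h; exact: anchored_mem.
exact: Psi_cvg.
Qed.

Lemma measurable_Psi d (S : measurableType d) (pt : S -> fpower nat T) (G : (nat -> T) -> R) i :
  measurable_fun X (G : fpower nat T -> R) -> measurable_fun setT pt ->
  measurable_fun setT (fun z => Psi us L a i G (pt z)).
Proof.
move=> mG mpt; case: i => [|i]; first exact: measurable_cst.
have ms : measurable_fun setT (fun z => splice (level us L i.+1) (pt z) a : fpower nat T).
  apply: measurable_fun_fpower => j; rewrite /splice.
  case: (j \in _); last exact: measurable_cst.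
  exact: (measurableT_comp (@measurable_coord _ _ T j) mpt).
by apply: (measurable_comp mX _ mG ms) => _ [z _ <-]; exact: hX.
Qed.

Lemma measurable_ml_eval (G : (nat -> T) -> R) :
  measurable_fun X (G : fpower nat T -> R) -> measurable_fun setT (ml_eval a Q G).
Proof.
move=> mG; apply: measurable_sum => i; apply: measurable_sum => s.
apply: measurable_funM => //.
have mpt : measurable_fun setT (fun z : fpower (ml_index us L m) Om =>
    anchored (ra_node (Q i) s (@ml_seed _ _ us L m z i)) a : fpower nat T).
  apply: measurable_anchored; apply: (measurableT_comp (ra_measurable (Q i) s)).
  exact: (measurable_coord_map (T := Om) (@seed_map us L m i)).
apply: measurable_funB; last exact: measurable_Psi.
by apply: (measurable_comp mX _ mG mpt) => _ [z _ <-]; exact: anchored_mem.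
Qed.

End ml_eval_limits.

Section unit_ball.
Context (R : realType) (dO : measure_display) (Om : measurableType dO)
  (P : probability Om R) (dD : measure_display) (T : measurableType dD)
  (rho : probability T R) (mu : probability (fpower nat T) R) (hmu : is_power rho mu)
  (k : T -> T -> R).
Hypothesis k_meas : measurable_fun setT (fun p : T * T => k p.1 p.2).
Context (M : R) (hM : (\int[rho]_x (k x x)%:E = M%:E)%E).
Hypothesis k_mean0 : forall y, \int[rho]_x k x y = 0.
Hypothesis k_ge0 : forall x, 0 <= k x x.
Hypothesis k_int : forall y, rho.-integrable setT (EFin \o (k ^~ y)).
Context (Hu : forall u, rkhs (kprod k u)) (gam : {fset nat} -> R) (us : nat -> {fset nat}).
Hypothesis gam_ge0 : forall u, 0 <= gam u.
Hypothesis gam0 : gam fset0 = 1.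
Hypothesis gam_sum : (\esum_(u in setT) (gam u * M ^+ #|` u|)%:E < +oo)%E.
Hypothesis us_inj : injective us.
Hypothesis us_range : range us = [set u | u != fset0 /\ 0 < gam u].
Context (HK : rkhs (Kker k gam)) (a : nat -> T) (L n : nat -> nat) (m : nat)
  (Q : forall j : 'I_m, ralg R Om T (level us L j.+1) (n j)).
Local Notation ku := (kprod k).
Local Notation su := (supp us).
Local Notation X := (Xdom k gam).
Hypothesis hX : forall (v : {fset nat}) x, X (splice v x a).
Local Notation PM := (power P (ml_index us L m)).
Local Notation I f := (\int[mu]_(x in X) zext f x).
Context (C : R).
Hypothesis C_ge0 : 0 <= C.
(** By [integral_finite_part] the sum of the coefficients is the integral of the finite sum, so this
    is the mean square error for that sum. *)
Hypothesis core : forall J l,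
  (\int[PM]_o (((\sum_(p <- l) p.1) - ml_eval a Q
      (fun x => \sum_(j < J.+1) gam (su j) * kspan (ku (su j)) l x) o) ^+ 2)%:E <=
   (C * \sum_(j < J.+1) gam (su j) * kform (ku (su j)) l l)%:E)%E.

Let mX : measurable (X : set (fpower nat T)).
Proof. exact: (measurable_Xdom k_meas Hu gam_ge0 us_inj us_range). Qed.

Let kd (x : nat -> T) : R := fine (kdiag k gam us x).

Let kd_ge0 x : 0 <= kd x.
Proof. by apply: fine_ge0; exact: (kdiag_ge0 Hu us gam_ge0 x). Qed.

Lemma integrable_dominating A B :
  mu.-integrable X (EFin \o (fun x : fpower nat T => A * kd x + B)).
Proof.
have ik := integral_kdiag hmu k_meas hM k_ge0 Hu gam_ge0 gam_sum us_inj us_range.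
have ikX : mu.-integrable X (EFin \o kd).
  apply: (eq_integrable mX (kdiag k gam us)).
    move=> x; rewrite inE => Xx; rewrite /= /kd fineK//.
    exact: (kdiag_fin Hu gam_ge0 us_inj us_range Xx).
  exact: (integrableS measurableT mX _ ik).
apply: (integrableD mX (f := EFin \o (fun x => A * kd x)) (g := cst B%:E)).
- exact: (integrableZl mX A ikX).
- exact: (finite_measure_integrable_cst mu B mX).
Qed.

Lemma Kker_diag (x : X) : Kker k gam x x <= kd (val x).
Proof.
have h : ksum k gam us J (val x) (val x) @[J --> \oo] --> Kker k gam x x.
  exact: (ksum_cvg Hu gam_ge0 us_inj us_range).
rewrite -(cvg_lim _ h)//; apply: limr_le; first by apply/cvg_ex; exists (Kker k gam x x).
apply: nearW => J; apply: (ksum_diag_le Hu gam_ge0 us_inj us_range J).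
exact: set_valP.
Qed.

Section span.
Context (l : seq (R * X)).

(** The points forget their membership in X, so that the list can be read for the kernels k_u. *)
Let vl : seq (R * (nat -> T)) := [seq (p.1, val p.2) | p <- l].

Let G (J : nat) (x : nat -> T) : R := \sum_(j < J.+1) gam (su j) * kspan (ku (su j)) vl x.

Let GE J x : G J x = \sum_(p <- l) p.1 * ksum k gam us J.+1 x (val p.2).
Proof.
rewrite /G /kspan; under eq_bigr do rewrite mulr_sumr big_map.
rewrite exchange_big/=; apply: eq_bigr => p _; rewrite mulr_sumr.
by apply: eq_bigr => j _; rewrite mulrCA.
Qed.

Let ksumS_cvg (x y : X) :
  ksum k gam us J.+1 (val x) (val y) @[J --> \oo] --> Kker k gam x y.
Proof.
have h : ksum k gam us J (val x) (val y) @[J --> \oo] --> Kker k gam x y.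
  exact: (ksum_cvg Hu gam_ge0 us_inj us_range).
by rewrite -cvg_shiftS in h.
Qed.

Let G_cvg x : X x -> G J x @[J --> \oo] --> zext (kspan (Kker k gam) l) x.
Proof.
move=> Xx; rewrite (zext_mem _ Xx); set y := SigSub _.
under eq_fun do rewrite GE.
by apply: cvg_bigsum => p; apply: cvgMr; exact: (@ksumS_cvg y p.2).
Qed.

Let measurable_G J : measurable_fun setT (G J : fpower nat T -> R).
Proof.
apply: measurable_sum => j; apply: measurable_funM => //; apply: measurable_sum => p.
by apply: measurable_funM => //; exact: measurable_kprod.
Qed.

Lemma measurable_zext_span :
  measurable_fun (X : set (fpower nat T)) (zext (kspan (Kker k gam) l) : fpower nat T -> R).
Proof.
apply: (@measurable_fun_cvg _ (fpower nat T) R X G) => [J|x Xx]; last exact: G_cvg.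
exact: measurable_funTS.
Qed.

Let G_dom J x : X x -> `|G J x| <= (\sum_(p <- l) `|p.1| / 2) * kd x +
  \sum_(p <- l) `|p.1| * (kd (val p.2) / 2).
Proof.
move=> Xx; rewrite GE mulr_suml -big_split/=; apply: le_trans (ler_norm_sum _ _ _) _.
apply: ler_sum => p _; rewrite normrM.
rewrite (_ : _ + _ = `|p.1| * ((kd x + kd (val p.2)) / 2)); last by field.
rewrite ler_wpM2l//; apply: (ksum_le Hu gam_ge0 us_inj us_range) => //; exact: set_valP.
Qed.

Let form_cvg : \sum_(j < J.+1) gam (su j) * kform (ku (su j)) vl vl @[J --> \oo] -->
  kform (Kker k gam) l l.
Proof.
have E J : \sum_(j < J.+1) gam (su j) * kform (ku (su j)) vl vl =
    \sum_(p <- l) \sum_(q <- l) p.1 * q.1 * ksum k gam us J.+1 (val p.2) (val q.2).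
  rewrite /kform; under eq_bigr do rewrite mulr_sumr big_map.
  rewrite exchange_big/=; apply: eq_bigr => p _.
  under eq_bigr do rewrite mulr_sumr big_map.
  rewrite exchange_big/=; apply: eq_bigr => q _; rewrite mulr_sumr.
  by apply: eq_bigr => j _; rewrite mulrCA.
under eq_fun do rewrite E.
by apply: cvg_bigsum => p; apply: cvg_bigsum => q; apply: cvgMr; exact: ksumS_cvg.
Qed.

Let form_le J : \sum_(j < J.+1) gam (su j) * kform (ku (su j)) vl vl <= kform (Kker k gam) l l.
Proof.
rewrite -(cvg_lim _ form_cvg)//.
apply: (nondecreasing_cvgn_le (u_ := fun J =>
  \sum_(j < J.+1) gam (su j) * kform (ku (su j)) vl vl)); last by apply/cvg_ex; eexists;
    exact: form_cvg.
apply/nondecreasing_seqP => i.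
rewrite [leRHS]big_ord_recr/= lerDl mulr_ge0// -(rk_dot_kspan2 (Hu _)).
by rewrite rk_dot_ge0//; exact: rk_set_kspan.
Qed.

(** The list is fixed and J tends to infinity: the finite sums converge pointwise on X, and their
    weighted quadratic forms increase to the squared norm in H(K). *)
Lemma span_error :
  (\int[PM]_o ((I (kspan (Kker k gam) l) - ml_eval a Q (zext (kspan (Kker k gam) l)) o) ^+ 2)%:E
   <= (C * kform (Kker k gam) l l)%:E)%E.
Proof.
apply: (second_moment_limit (F_ := fun J z => \sum_(p <- vl) p.1 - ml_eval a Q (G J) z)).
- move=> J; apply: measurable_funB => //; apply: (measurable_ml_eval Q mX hX).
  exact: measurable_funTS.
- move=> z; apply: cvgB; last by apply: (@ml_eval_cvg _ _ _ _ _ us a L n m Q X hX); exact: G_cvg.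
  (* The integrals of the finite sums form a constant sequence, so dominated convergence identifies
     the integral of the combination. *)
  have := Rintegral_cvg mX (fun J => measurable_funTS (measurable_G J)) G_cvg
    (integrable_dominating _ _) G_dom.
  under eq_fun do rewrite (integral_finite_part hmu k_meas hM k_mean0 k_ge0 k_int Hu gam_ge0 gam0
    gam_sum us_inj us_range).
  by [].
- by move=> J; apply: (le_trans (core J vl)); rewrite lee_fin ler_wpM2l// form_le.
Qed.

End span.

Lemma unit_ball_error f : unit_ball HK f ->
  (\int[PM]_o ((I f - ml_eval a Q (zext f) o) ^+ 2)%:E <= (4 * C)%:E)%E.
Proof.
move=> [Vf nf].
have /choice[l hl] : forall i : nat, exists l, rk_norm HK (kspan (Kker k gam) l - f) <= i.+1%:R^-1.
  by move=> i; apply: kspan_dense_le.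
have Vl i : rk_set HK (kspan (Kker k gam) (l i)) by exact: rk_set_kspan.
have cl : rk_norm HK (kspan (Kker k gam) (l i) - f) @[i --> \oo] --> 0.
  apply: (squeeze_cvgr _ (cvg_cst 0) (@cvg_harmonic R)).
  by apply: nearW => i; rewrite rk_norm_ge0 hl.
(* The approximants may leave the unit ball, but their norms stay below 2; squaring gives the factor
   4 in the conclusion. *)
have n2 i : rk_norm HK (kspan (Kker k gam) (l i)) <= 2.
  have -> : kspan (Kker k gam) (l i) = f + (kspan (Kker k gam) (l i) - f) by rewrite addrC subrK.
  apply: (le_trans (rk_normD Vf (rk_setB (Vl i) Vf))).
  have : i.+1%:R^-1 <= 1 :> R by rewrite invf_le1 ?ler1n.
  by move=> i1; apply: le_trans (lerD nf (le_trans (hl i) i1)) _; lra.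
(* Convergence in norm implies convergence at every point of X, which is all the algorithm needs. *)
have Gc x : X x -> zext (kspan (Kker k gam) (l i)) x @[i --> \oo] --> zext f x.
  move=> Xx; under eq_fun do rewrite (zext_mem _ Xx); rewrite (zext_mem _ Xx).
  exact: (rk_cvg_eval (f_ := fun i => kspan (Kker k gam) (l i)) Vl Vf cl).
(* From 2 sqrt(K(x, x)) <= K(x, x) + 1 one gets a majorant that is integrable because K(x, x) is. *)
have Gd i x : X x -> `|zext (kspan (Kker k gam) (l i)) x| <= 1 * kd x + 1.
  move=> Xx; rewrite (zext_mem _ Xx); set y := SigSub _.
  have h1 := rk_eval_le y (Vl i); have h2 := Kker_diag y.
  rewrite -[val y]/x -rk_normE// in h1 h2.
  have nsq : rk_norm HK (kspan (Kker k gam) (l i)) ^+ 2 <= 4.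
    by have := n2 i; have := rk_norm_ge0 HK (kspan (Kker k gam) (l i)); nra.
  have K0 := kernel_ge0 HK y; have k0 := kd_ge0 x.
  have hh : kspan (Kker k gam) (l i) y ^+ 2 <= 4 * kd x.
    apply: (le_trans h1); apply: ler_pM => //; exact: sqr_ge0.
  rewrite -(@ler_pXn2r _ 2)// ?nnegrE; last by lra.
  rewrite real_normK ?num_real//; apply: (le_trans hh).
  by have := sqr_ge0 (kd x - 1); nra.
apply: (second_moment_limit (F_ := fun i z => I (kspan (Kker k gam) (l i)) -
    ml_eval a Q (zext (kspan (Kker k gam) (l i))) z)).
- move=> i; apply: measurable_funB => //; apply: (measurable_ml_eval Q mX hX).
  exact: measurable_zext_span.
- move=> z; apply: cvgB; last by apply: (@ml_eval_cvg _ _ _ _ _ us a L n m Q X hX (fun i =>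
  zext (kspan (Kker k gam) (l i))) _ z); exact: Gc.
  exact: (Rintegral_cvg mX (fun i => measurable_zext_span (l i)) Gc (integrable_dominating _ _) Gd).
- move=> i; apply: (le_trans (span_error (l i))); rewrite lee_fin mulrC ler_wpM2r//.
  rewrite -(rk_dot_kspan2 HK) -rk_normE//.
  by have := n2 i; have := rk_norm_ge0 HK (kspan (Kker k gam) (l i)); nra.
Qed.

End unit_ball.

(** * Cost *)

Section cost.
Import HBNNSimple.
Context (R : realType).

(* No measurability is assumed of f. *)
Lemma integral_le_cst d (S : measurableType d) (PS : probability S R) (f : S -> \bar R) (c : R) :
  (forall x, 0 <= f x)%E -> (forall x, f x <= c%:E)%E -> (\int[PS]_x f x <= c%:E)%E.
Proof.
move=> f0 fc; rewrite ge0_integralTE//; apply: ge_ereal_sup => _ [h hf <-].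
rewrite -integralT_nnsfun -[leRHS](integral_prob_cst PS).
have c0 : (0 <= c%:E)%E by apply: le_trans (f0 point) (fc point).
apply: ge0_le_integral => //.
- by move=> x _; rewrite lee_fin fun_ge0.
- by apply/measurable_EFinP; exact: measurable_funP.
- by move=> x _; apply: le_trans (hf x) (fc x).
Qed.

(** Below the range of the asymptotic bound, monotonicity gives the price at N as a bound, and nu^s
    >= 1. *)
Lemma price_le_power (price : nat -> R) (s : R) : 0 <= s ->
  {homo price : i j / (i <= j)%N >-> i <= j} -> (forall nu, 0 <= price nu) ->
  (exists A : R, \forall nu \near \oo, price nu <= A * nu%:R `^ s) ->
  exists2 A : R, 0 <= A & forall nu, (0 < nu)%N -> price nu <= A * nu%:R `^ s.
Proof.
move=> s0 mono pge0 [A [N _ hN]]; exists (`|A| + price N); first by rewrite addr_ge0.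
move=> nu nu0; have p1 : 1 <= nu%:R `^ s :> R.
  by have := @ge0_ler_powR R s s0 1 nu%:R; rewrite powR1 !nnegrE ler01 ler0n ler1n => ->.
have [nN|Nn] := leqP N nu.
  apply: (le_trans (hN nu nN)); rewrite ler_wpM2r ?powR_ge0//.
  by apply: le_trans (ler_norm A) _; rewrite lerDl.
apply: (@le_trans _ _ (price N)); first by apply: mono; exact: ltnW.
rewrite -[leLHS]mulr1; apply: ler_pM => //; by rewrite lerDr.
Qed.

Lemma point_cost_ge0 (D : Type) (price : nat -> R) v (b x : nat -> D) :
  (forall nu, 0 <= price nu) -> (0 <= point_cost price v b x)%E.
Proof. by move=> p0; apply: le_ereal_inf_tmp => _ [i _ <-]; rewrite lee_fin. Qed.

Lemma point_cost_le (D : Type) (price : nat -> R) v (b x : nat -> D) i :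
  (forall j, j \notin v i -> x j = b j) -> (point_cost price v b x <= (price #|` v i|)%:E)%E.
Proof. by move=> h; apply: ereal_inf_lbound; exists i. Qed.

Lemma card_level (us : nat -> {fset nat}) (L : nat -> nat) om k :
  (forall j, (#|` us j| <= om)%N) -> (#|` level us L k.+1| <= om * L k)%N.
Proof.
move=> h /=; elim: (L k) => [|l IH]; first by rewrite big_ord0 cardfs0.
rewrite big_ord_recr/= mulnS addnC; apply: leq_trans (leq_add IH (h l)).
by rewrite cardfsU leq_subr.
Qed.

(** Taking the anchor of the algorithm and a chain through its levels, every point used by block k
    differs from the anchor only inside v_(k+1). The resulting bound holds for each seed and each f,
    so expectation and supremum preserve it. *)
Lemma multilevel_cost (dO : measure_display) (Om : measurableType dO)
    (P : probability Om R) (dD : measure_display) (T : measurableType dD)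
    (price : nat -> R) (us : nat -> {fset nat}) (L n : nat -> nat) (m : nat) (a : nat -> T)
    (Q : forall j : 'I_m, ralg R Om T (level us L j.+1) (n j))
    (X : set (nat -> T)) (K : X -> X -> R) (HK : rkhs K) :
  (forall nu, 0 <= price nu) -> {homo price : i j / (i <= j)%N >-> i <= j} -> (0 < m)%N ->
  (forall i, (i < m)%N -> (level us L i `<=` level us L i.+1)%fset) ->
  level us L 1 != fset0 -> X a ->
  (vcost price HK (power P (ml_index us L m)) (fun _ => ml_points a Q) <=
   (\sum_(k < m) (n k)%:R * (2 * price #|` level us L k.+1|))%:E)%E.
Proof.
move=> p0 mono m0 lmono l1 Xa.
(* Constant from the last level on, because an infinite increasing sequence is expected. *)
pose c i := level us L (minn i.+1 m).
have cE (i : nat) : (i < m)%N -> c i = level us L i.+1 by move=> im; rewrite /c (minn_idPl im).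
have c0 : c 0%N != fset0 by rewrite cE.
have cS i : (c i `<=` c i.+1)%fset.
  have [im|mi] := ltnP i.+1 m; first by rewrite !cE ?lmono// ltnW.
  by rewrite /c (minn_idPr mi) (minn_idPr (leq_trans mi (leqnSn _))).
have [v nv hv] := nested_through m c0 cS.
apply: (@le_trans _ _ (ereal_sup [set
      (\int[power P (ml_index us L m)]_o \sum_(x <- ml_points a Q o) point_cost price v a x)%E
    | f in unit_ball HK])).
  by apply: ereal_inf_lbound; exists (v, a).
apply: ge_ereal_sup => _ [f _ <-]; apply: integral_le_cst => o.
  by apply: sume_ge0 => x _; exact: point_cost_ge0.
rewrite /ml_points big_flatten big_map big_enum/= -sumEFin; apply: lee_sum => k _.
rewrite big_flatten big_map big_enum/= mulr_natl -[X in (_ *+ X)%:E]card_ord -sumr_const -sumEFin.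
apply: lee_sum => i _.
have [j vj] := hv k (ltnW (ltn_ord k)); rewrite cE// in vj.
have pc1 (x : level us L k.+1 -> T) : (point_cost price v a (anchored x a) <=
    (price #|` level us L k.+1|)%:E)%E.
  rewrite -[X in #|` X|]vj; apply: point_cost_le => l; rewrite vj => lv.
  by rewrite /anchored insubN.
have pc2 x : (point_cost price v a (splice (level us L k) x a) <=
    (price #|` level us L k.+1|)%:E)%E.
  rewrite -[X in #|` X|]vj; apply: point_cost_le => l; rewrite vj => lv.
  rewrite /splice ifN//; apply: contra lv; apply/fsubsetP; exact: lmono.
(* Block 0 evaluates one point per node but is charged for two, which makes the bound uniform in the
   blocks. *)
have le2 (k' : nat) (x y : nat -> T) (B : R) : 0 <= B ->
    (point_cost price v a x <= B%:E)%E -> (point_cost price v a y <= B%:E)%E ->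
    (\sum_(z <- x :: (if k' is 0 then [::] else [:: y])) point_cost price v a z <= (2 * B)%:E)%E.
  move=> B0 hx hy; rewrite mulr_natl mulr2n EFinD; case: k' => [|k'].
    by rewrite big_seq1 -[leLHS]adde0 leeD// lee_fin.
  by rewrite big_cons big_seq1 leeD.
exact: le2.
Qed.

End cost.

(** * Weights *)

Section coloring.
Context (R : realType) (gam : {fset nat} -> R) (om eta d : nat).
Hypothesis gam_order : finite_order gam om.
Hypothesis heta : forall i : nat, [set u | 0 < gam u /\ i \in u] #<= `I_eta.
Hypothesis hd : d = (eta * (om - 1) + 1)%N.
Local Notation colors := [fset i in iota 0 d]%fset.

Lemma card_weight_le u : 0 < gam u -> (#|` u| <= om)%N.
Proof. by move=> g0; rewrite leqNgt; apply/negP => /gam_order e; rewrite e ltxx in g0. Qed.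

Lemma weight_coloring (v : {fset nat}) : exists phi : nat -> colors,
  forall u, 0 < gam u -> {in (u `&` v)%fset &, injective phi}.
Proof.
have d0 : 0%N \in colors by rewrite !inE mem_iota/= hd addn1.
pose e : rel nat := fun x y => `[< exists u, [/\ 0 < gam u, x \in u & y \in u] >].
have esym : symmetric e.
  by move=> x y; apply/asboolP/asboolP => -[u [g0 xu yu]]; exists u.
have deg x : x \in enum_fset v -> (size [seq y <- enum_fset v | (y != x) && e x y]
  < #|{: colors}|)%N.
  move=> _; rewrite -cardfE card_fseq undup_id ?iota_uniq// size_iota hd addn1 ltnS.
  have [s sn hs] := card_le_cover (heta x).
  (* The cover s of the weighted sets through x may contain other sets; the filter keeps only those
     to which the count of at most om - 1 further elements applies. *)
  pose t : seq {fset nat} := [seq u <- enum_fset s | (x \in u) && (#|` u| <= om)%N].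
  apply: (@leq_trans (size (flatten [seq enum_fset (u `\ x)%fset | u <- t]))).
    apply: uniq_leq_size; first by rewrite filter_uniq.
    move=> y; rewrite mem_filter => /andP[/andP[yx /asboolP[u [g0 xu yu]]] _].
    apply/flatten_mapP; exists u; last by rewrite !inE yx.
    by rewrite mem_filter xu card_weight_le//=; exact: hs.
  rewrite size_flatten /shape -map_comp sumnE big_map.
  apply: (@leq_trans (\sum_(u <- t) (om - 1))).
    rewrite big_seq [leqRHS]big_seq; apply: leq_sum => u; rewrite mem_filter =>
      /andP[/andP[xu cu] _].
    by move: cu; rewrite (cardfsD1 x u) xu add1n subn1 /= => cu; rewrite -ltnS (ltn_predK cu).
  rewrite big_const_seq count_predT iter_addn_0 mulnC leq_mul2r; apply/orP; right.
  by apply: leq_trans sn; rewrite size_filter; exact: count_size.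
have [phi hphi] := greedy_coloring (FSetSub d0) esym (fset_uniq v) deg.
exists phi => u g0 x y; rewrite !inE => /andP[xu xv] /andP[yu yv] /eqP; apply: contraTeq => xy.
by apply: hphi => //; apply/asboolP; exists u.
Qed.

End coloring.

Section weight_facts.
Context (R : realType) (dD : measure_display) (T : measurableType dD)
  (k : T -> T -> R) (a : T).
Hypothesis k_pos : forall x, 0 < k x x.
Context (Hu : forall u, rkhs (kprod k u)) (gam : {fset nat} -> R) (us : nat -> {fset nat}).
Hypothesis gam_ge0 : forall u, 0 <= gam u.
Hypothesis gam0 : gam fset0 = 1.
Hypothesis us_inj : injective us.
Hypothesis us_range : range us = [set u | u != fset0 /\ 0 < gam u].
Hypothesis ha : (\esum_(u in setT) (ghat k gam a u)%:E < +oo)%E.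
Local Notation ku := (kprod k).
Local Notation anc := ((fun=> a) : nat -> T).

Lemma ghatE u : ghat k gam a u = gam u * ku u anc anc.
Proof. by rewrite kprod_cst. Qed.

Lemma Xdom_anchor : Xdom k gam anc.
Proof. by rewrite /Xdom/=; under eq_esum do rewrite -ghatE. Qed.

Lemma ghat_sum_le : exists G : R, forall J, \sum_(j < J) ghat k gam a (us j) <= G.
Proof.
exists (fine (kdiag k gam us anc)) => J.
apply: le_trans (ksum_diag_le Hu gam_ge0 us_inj us_range J.+1 Xdom_anchor).
rewrite /ksum big_ord_recl/= kprod0 mulr1 gam0.
by under eq_bigr do rewrite ghatE; rewrite lerDr.
Qed.

(** Changing the coordinates of the anchor in the finite set v affects only the summands of weighted
    sets meeting v, and these are finitely many because each coordinate lies in at most eta of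
    them. *)
Lemma Xdom_splice (eta : nat) :
  (forall i : nat, [set u | 0 < gam u /\ i \in u] #<= `I_eta) ->
  forall (v : {fset nat}) x, Xdom k gam (splice v x anc).
Proof.
move=> heta v x; set z := splice v x anc.
have /choice[c hc] : forall i : nat, exists s : {fset {fset nat}},
    forall u, 0 < gam u -> i \in u -> u \in s.
  by move=> i; have [s _ hs] := card_le_cover (heta i); exists s => u g0 iu; exact: hs.
pose S := (\bigcup_(i <- v) c i)%fset.
have hS u i : 0 < gam u -> i \in u -> i \in v -> u \in S.
  by move=> g0 iu iv; apply/bigfcupP; exists i; [rewrite iv|exact: hc].
have g0 u : 0 <= gam u * ku u z z by rewrite mulr_ge0// kernel_ge0.
have gh0 u : 0 <= ghat k gam a u by rewrite ghatE mulr_ge0// kernel_ge0.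
have le u : gam u * ku u z z <= ghat k gam a u + (if u \in [set` S] then gam u * ku u z z else 0).
  case: ifPn; first by rewrite lerDr.
  rewrite addr0 => uS.
  have [->|gu] := eqVneq (gam u) 0; first by rewrite mul0r.
  rewrite ghatE ler_wpM2l// /kprod le_eqVlt; apply/orP; left; apply/eqP.
  apply: eq_big_seq => i iu; rewrite /z /splice; case: ifP => // iv.
  by case/negP: uS; rewrite in_setE/=; apply: (hS u i) => //; rewrite lt_def gu gam_ge0.
rewrite /Xdom/=.
apply: (@le_lt_trans _ _ (\esum_(u in setT) ((ghat k gam a u)%:E +
    (if u \in [set` S] then (gam u * ku u z z)%:E else 0)))%E).
  apply: le_esum => u _; move: (le u); rewrite -lee_fin EFinD.
  by case: ifP.
rewrite esumD => [|u _|u _]; last 2 first.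
- by rewrite lee_fin.
- by case: ifP => _ //; rewrite lee_fin.
rewrite lte_add_pinfty// -esum_mkcond esum_fset//; last by move=> u _; rewrite lee_fin.
by rewrite fsbig_finite//= sumEFin ltry.
Qed.

Lemma kprod_anchor_le om : finite_order gam om -> exists2 K1 : R, 0 <= K1 &
  forall u w, 0 < gam u -> (w `<=` u)%fset -> ku w anc anc <= K1.
Proof.
move=> fo; exists (Num.max 1 (k a a) ^+ om) => [|u w g0 wu];
  first by rewrite exprn_ge0// le_max ler01.
rewrite kprod_cst; apply: (@le_trans _ _ (Num.max 1 (k a a) ^+ #|` w|)).
  by apply: lerXn2r; rewrite ?nnegrE ?le_max ?lexx ?ler01 ?orbT// ltW.
apply: ler_weXn2l; first by rewrite le_max lexx.
exact: leq_trans (fsubset_leq_card wu) (card_weight_le fo g0).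
Qed.

(** By finite order and k(a, a) > 0, the power k(a, a)^|u| is at least min(1, k(a, a))^om. *)
Lemma weight_le_ghat om : finite_order gam om -> exists2 K2 : R, 0 <= K2 &
  forall u, 0 < gam u -> gam u <= K2 * (gam u * ku u anc anc).
Proof.
move=> fo; have p0 : 0 < Num.min 1 (k a a) by rewrite lt_min ltr01 k_pos.
exists ((Num.min 1 (k a a) ^+ om)^-1) => [|u g0]; first by rewrite invr_ge0 exprn_ge0// ltW.
rewrite ler_pdivlMl ?exprn_gt0// mulrC ler_wpM2l ?gam_ge0// kprod_cst.
apply: (@le_trans _ _ (Num.min 1 (k a a) ^+ #|` u|)).
  apply: ler_wiXn2l; [exact: ltW|by rewrite ge_min lexx|exact: (card_weight_le fo g0)].
by apply: lerXn2r; rewrite ?nnegrE ?ge_min ?lexx ?orbT// ltW.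
Qed.

Lemma weight_conflicts r :
  (forall u, 0 < gam u -> [set v | 0 < gam v /\ (u `&` v != fset0)%fset] #<= `I_r) ->
  forall J u, 0 < gam u -> (#|[pred j : 'I_J | (u `&` supp us j)%fset != fset0]| <= r)%N.
Proof.
move=> h J u g0; have [s sn hs] := card_le_cover (h u g0).
apply: leq_trans sn; rewrite cardE -(size_map (fun j : 'I_J => supp us j)).
apply: uniq_leq_size.
  rewrite map_inj_uniq ?enum_uniq// => i j /(supp_inj us_inj us_range)/val_inj.
  by [].
move=> w /mapP[j]; rewrite mem_enum inE => uj ->; apply: hs; split => //.
apply: gam_supp => // i.
by have [] : [set u | u != fset0 /\ 0 < gam u] (us i) by rewrite -us_range; exists i.
Qed.

End weight_facts.

(** * Decay of the weights *)

Section decay_bound.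
Context (R : realType).

(** Some q' > q still satisfies g_j j^q' -> 0, and a convergent sequence is bounded. *)
Lemma decay_bound (g : nat -> R) (q : R) : (forall j, 0 <= g j) -> (q%:E < decay g)%E ->
  exists K : R, forall j, g j <= K * j.+1%:R `^ (- q).
Proof.
move=> g0 /ereal_sup_gt[_ [q' hq' <-]]; rewrite lte_fin => qq'.
have /cvg_seq_bounded[K [_ hK]] : cvgn (fun j => g j * j.+1%:R `^ q') by apply/cvg_ex; exists 0.
exists (K + 1) => j; have := hK (K + 1); rewrite ltrDl => /(_ ltr01 j I).
have p1 : 1 <= j.+1%:R :> R by rewrite ler1n.
have p0 (c : R) : 0 < j.+1%:R `^ c by rewrite powR_gt0.
rewrite /= ger0_norm ?mulr_ge0 ?powR_ge0// powRN ler_pdivlMr//.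
apply: le_trans.
by rewrite ler_wpM2l//; apply: ler_powR => //; exact: ltW.
Qed.

End decay_bound.

(** Used with tau = al s and with tau = decay - 1 for the two ranges of the decay. Giving up only
    delta / 2 leaves th' strictly between the target exponent and al. *)
Lemma decay_rate (R : realType) (g : nat -> R) (s al delta tau : R) :
  (forall j, 0 <= g j) -> 0 < s -> 0 < delta -> tau <= al * s -> ((1 + tau)%:E <= decay g)%E ->
  exists th' K, [/\ tau / s - delta < th', th' < al &
    forall j, g j <= K * j.+1%:R `^ (- (1 + th' * s))].
Proof.
move=> g0 s0 de0 tas dec.
have [|K hK] := @decay_bound R g (1 + (tau / s - delta / 2) * s) g0.
  apply: lt_le_trans dec; rewrite lte_fin ltrD2l mulrBl divfK ?gt_eqF//.
  by rewrite ltrBlDr ltrDl mulr_gt0// divr_gt0.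
exists (tau / s - delta / 2), K; split => //; first by lra.
by rewrite ltrBlDr (@le_lt_trans _ _ al)// ?ler_pdivrMr// ltrDl divr_gt0.
Qed.

Lemma kernel_section_integrable (R : realType) d (T : measurableType d) (rho : probability T R)
    (k : T -> T -> R) (Hk : rkhs k) (M : R) :
  measurable_fun setT (fun p : T * T => k p.1 p.2) -> (\int[rho]_x (k x x)%:E = M%:E)%E ->
  forall y, rho.-integrable setT (EFin \o k ^~ y).
Proof.
move=> k_meas hM y.
have md : measurable_fun setT (fun x => k x x).
  by apply: (measurableT_comp k_meas (g := fun x => (x, x))); exact: measurable_fun_pair.
have id : rho.-integrable setT (EFin \o (fun x => k x x)).
  apply/integrableP; split; first exact/measurable_EFinP.
  by under eq_integral do rewrite gee0_abs ?lee_fin ?(kernel_ge0 Hk)//; rewrite hM ltry.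
apply: (@le_integrable _ _ _ _ _ measurableT _ (EFin \o (fun x => k x x + k y y))).
- apply/measurable_EFinP; apply: (measurableT_comp k_meas (g := fun x => (x, y))).
  exact: measurable_fun_pair.
- move=> x _; rewrite /= lee_fin; apply: (le_trans (kernel_le Hk x y)).
  have h1 := kernel_ge0 Hk x; have h2 := kernel_ge0 Hk y.
  by rewrite ger0_norm ?addr_ge0//; lra.
- apply: integrable_EFinD => //; exact: finite_measure_integrable_cst.
Qed.

Lemma rerror_sqr_le (R : realType) (D : Type) (X : set (nat -> D)) (L : X -> X -> R)
    (H : rkhs L) d (S : measurableType d) (PS : probability S R)
    (I : (X -> R) -> R) (Q : (X -> R) -> S -> R) (B : R) :
  (forall f, unit_ball H f -> (\int[PS]_o ((I f - Q f o) ^+ 2)%:E <= B%:E)%E) ->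
  (rerror H PS I Q ^+ 2 <= B%:E)%E.
Proof.
move=> h; rewrite /rerror; set A := [set _ | _ in _].
have A0 : (0 <= ereal_sup A)%E.
  apply: (@le_trans _ _ (expectation PS (fun o => (I 0 - Q 0 o) ^+ 2))).
    by rewrite unlock; apply: integral_ge0 => o _; rewrite lee_fin sqr_ge0.
  apply: ereal_sup_ubound; exists 0 => //; split; first exact: rk_zero.
  by rewrite /rk_norm rk_dot0l ?sqrtr0//; exact: rk_zero.
rewrite poweR12_sqrt// sqr_sqrte//; apply: ge_ereal_sup => _ [f Hf <-].
by rewrite unlock; exact: h.
Qed.

Lemma condition_star_own (R : realType) (dO : measure_display) (Om : measurableType dO)
    (P : probability Om R) (dD : measure_display) (T : measurableType dD)
    (rho : probability T R) (w : {fset nat}) n (Q : ralg R Om T w n) :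
  condition_star P rho Q [set u | (u `<=` w)%fset] -> own_coordinates P rho Q.
Proof. by move=> h j i; apply: (h w) => //=; exact: fsvalP. Qed.

Theorem theorem4p3 (R : realType) (D : set R) (a : D)
    (rho : probability (dom a) R)
    (mu : probability (fpower nat (dom a)) R)
    (hmu : is_power rho mu)
    (k : dom a -> dom a -> R)
    (Hk : rkhs k)
    (k_neq0 : exists x y, k x y != 0)
    (k_meas : measurable_fun setT (fun p : dom a * dom a => k p.1 p.2))
    (k_cst : rk_set Hk `&` range (fun c : R => (fun _ : dom a => c))
             = [set 0])
    (M : R)
    (hM : (\int[rho]_x (k x x)%:E = M%:E)%E)
    (k_mean0 : forall y, (\int[rho]_x (k x y)%:E = 0)%E)
    (k_pos : forall x, 0 < k x x)
    (gam : {fset nat} -> R)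
    (gam_ge0 : forall u, 0 <= gam u)
    (gam0 : gam fset0 = 1)
    (gam_sum : (\esum_(u in setT) (gam u * M ^+ #|` u|)%:E < +oo)%E)
    (om : nat)
    (gam_order : finite_order gam om)
    (gam_inter : finite_intersection gam)
    (eta : nat)
    (heta : forall i : nat, [set u | 0 < gam u /\ i \in u] #<= `I_eta)
    (d : nat)
    (hd : d = (eta * (om - 1) + 1)%N)
    (ha : (\esum_(u in setT) (ghat k gam a u)%:E < +oo)%E)
    (us : nat -> {fset nat})
    (hus : weight_ordering gam (ghat k gam a) us)
    (Hu : forall u, rkhs (kprod k u))
    (HK : rkhs (Kker k gam))
    (dO : measure_display) (Om : measurableType dO) (P : probability Om R)
    (al be Cd : R)
    (hQ : forall n, (0 < n)%N ->
      exists Q : ralg R Om (dom a) [fset i in iota 0 d]%fset n,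
        [/\ condition_star P rho Q
              [set u | (u `<=` [fset i in iota 0 d])%fset],
            \sum_(i < n) ra_weight Q i = 1 &
            (1 < n)%N ->
            forall u, (u `<=` [fset i in iota 0 d])%fset ->
            forall f, rk_set (Hu u) f ->
              (variance (power P _) (ra_eval Q (anchor a) f)
               <= (variance_bound Cd al be n * rk_norm (Hu u) f ^+ 2)%:E)%E])
    (price : nat -> R)
    (price_ge0 : forall nu, 0 <= price nu)
    (price_mono : {homo price : i j / (i <= j)%N >-> i <= j})
    (s : R) (s_gt0 : 0 < s)
    (price_O : exists A : R, \forall nu \near \oo,
       price nu <= A * nu%:R `^ s)
    (delta : R) (delta_gt0 : 0 < delta) :
  exists (C : R) (N0 : nat), forall N : nat, (N0 <= N)%N ->
  exists (m : nat) (L n : nat -> nat)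
    (Q : forall j : 'I_m, ralg R Om (dom a) (level us L j.+1) (n j)),
    [/\ [/\ (0 < m)%N, (0 < L 0)%N,
            (forall i j, (i < j < m)%N -> (L i < L j)%N),
            (forall i, (i < m)%N -> (0 < n i)%N) &
            (forall i j, (i <= j < m)%N -> (n j <= n i)%N)],
        (forall j : 'I_m,
          [/\ condition_star P rho (Q j)
                [set u | (u `<=` level us L j.+1)%fset /\ 0 < gam u],
              \sum_(i < n j) ra_weight (Q j) i = 1 &
              forall u, (u `<=` level us L j.+1)%fset -> 0 < gam u ->
              forall f, rk_set (Hu u) f ->
                (variance (power P _) (ra_eval (Q j) (anchor a) f)
                 <= (variance_bound Cd al be (n j)
                     * rk_norm (Hu u) f ^+ 2)%:E)%E]),
        (vcost price HK (power P (ml_index us L m))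
           (fun _ => ml_points (anchor a) Q) <= N%:R%:E)%E &
        let e := rerror HK (power P (ml_index us L m))
          (fun f => \int[mu]_(x in Xdom k gam) zext f x)
          (fun f => ml_eval (anchor a) Q (zext f)) in
        let dec := decay (fun j => ghat k gam a (us j)) in
        (((1 + al * s)%:E <= dec)%E ->
           (e ^+ 2 <= (C * N%:R `^ (- al + delta))%:E)%E) /\
        ((1%:E < dec < (1 + al * s)%:E)%E ->
           (e ^+ 2 <=
            (C * N%:R `^ (- ((fine dec - 1) / s) + delta))%:E)%E)].
Proof.
case: hus => us_inj us_range g_anti.
have us_prop j : us j != fset0 /\ 0 < gam (us j).
  by have : [set u | u != fset0 /\ 0 < gam u] (us j) by rewrite -us_range; exists j.
have usn0 j : us j != fset0 by have [] := us_prop j.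
have gam_us j : 0 < gam (us j) by have [] := us_prop j.
have k_ge0 x : 0 <= k x x by exact: ltW.
have k_int := kernel_section_integrable Hk k_meas hM.
have k_mean y : \int[rho]_x k x y = 0 by rewrite /Rintegral k_mean0.
pose g j := ghat k gam a (us j).
have gE j : g j = gam (us j) * kprod k (us j) (anchor a) (anchor a) by rewrite /g ghatE.
have g0 j : 0 <= g j by rewrite /g /ghat mulr_ge0// exprn_ge0.
have [G hG] := ghat_sum_le Hu gam_ge0 gam0 us_inj us_range ha.
have hX := Xdom_splice Hu gam_ge0 ha heta.
have Xa : Xdom k gam (anchor a) by exact: Xdom_anchor.
have [K1 K1_ge0 hK1] := @kprod_anchor_le R _ (dom a) k a k_pos _ _ gam_order.
have [K2 K2_ge0 hK2] := @weight_le_ghat R _ (dom a) k a k_pos _ gam_ge0 _ gam_order.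
have [r hr] := gam_inter.
have hB := weight_conflicts gam0 us_inj us_range hr.
have [A A_ge0 hA] := price_le_power (ltW s_gt0) price_mono price_ge0 price_O.
have /choice[phi hphi] := weight_coloring gam_order heta hd.
(* The variance bound at n = 2 is tested on the constant function 1 of H(k_u) for u empty, whose
   norm is 1; the factors 2^(-al) and (ln 2)^be are positive. *)
have Cd_ge0 : 0 <= Cd.
  have [Q [_ _ /(_ isT fset0 (fsub0set _))]] := hQ 2%N isT.
  move=> /(_ (kprod k fset0 ^~ (anchor a)) (rk_section _ _)) h.
  have {h} := le_trans (variance_ge0 _ _) h.
  rewrite lee_fin rk_normE; last exact: rk_section.
  rewrite rk_reproducing ?kprod0; last exact: rk_section.
  rewrite mulr1 /variance_bound -mulrA pmulr_lge0// mulr_gt0// powR_gt0//.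
  by rewrite ln_gt0// ltr1n.
pose dec := decay g.
(* One exponent for both ranges of the decay, so that the parameters are chosen once; in the
   remaining range no rate is claimed and 0 is a placeholder. *)
pose th := if ((1 + al * s)%:E <= dec)%E then al - delta
  else if (1%:E < dec)%E then (fine dec - 1) / s - delta else 0.
(* In [Cc], two evaluations per node cost at most A (om L_k)^s each. In [Ce], the constants 2 and 8
   (1 + r) K1 K2 of [multilevel_error] are multiplied by the 4 of [unit_ball_error]. *)
pose Cc := 2 * (A * om%:R `^ s).
pose Ce := 8 + 32 * (1 + r)%:R * K1 * K2.
have Cc_ge0 : 0 <= Cc by rewrite !mulr_ge0// powR_ge0.
have Ce_ge0 : 0 <= Ce by rewrite addr_ge0// !mulr_ge0.
have hth : 0 < th -> exists th' K, [/\ th < th', th' < al &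
    forall j, g j <= K * j.+1%:R `^ (- (1 + th' * s))].
  rewrite /th; case: ifPn => [h _|].
    have := @decay_rate R g s al delta (al * s) g0 s_gt0 delta_gt0 (lexx _) h.
    by rewrite mulfK ?gt_eqF.
  rewrite -ltNge => h1; case: ifPn => [h2 _|]; last by rewrite ltxx.
  have fd : dec \is a fin_num by rewrite fin_real// (lt_trans (ltNyr _) h2)/= (lt_trans h1
    (ltry _)).
  apply: decay_rate => //; last by rewrite addrC subrK fineK.
  by rewrite lerBlDl -lee_fin fineK// ltW.
have [C [N0 hN]] := exists_parameters be g0 g_anti hG s_gt0 Cd_ge0 Cc_ge0 Ce_ge0 hth.
exists C, N0 => N /hN[m [L [n [adm cost [tb htb err]]]]].
exists m, L, n.
case: adm => m0 L0 Lmono n1 nmono.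
have n_gt0 (j : 'I_m) : (0 < n j)%N by rewrite (ltn_trans _ (n1 j (ltn_ord j))).
pose Qj (j : 'I_m) := projT1 (cid (hQ _ (n_gt0 j))).
have Qjprop (j : 'I_m) := projT2 (cid (hQ _ (n_gt0 j))).
pose Q (j : 'I_m) : ralg R Om (dom a) (level us L j.+1) (n j) :=
  recolor (Qj j) (phi (level us L j.+1)) (level us L j.+1).
have Qown0 j : own_coordinates P rho (Qj j).
  by apply: condition_star_own; have [] := Qjprop j.
have Qown j : own_coordinates P rho (Q j) by exact: recolor_own.
have Qw (j : 'I_m) : \sum_(i < n j) ra_weight (Q j) i = 1 by have [_ + _] := Qjprop j.
pose vb (j : 'I_m) := variance_bound Cd al be (n j).
have vb_ge0 j : 0 <= vb j.
  by rewrite /vb /variance_bound !mulr_ge0 ?powR_ge0.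
have Qvar (j : 'I_m) u w : 0 < gam u -> (w `<=` u)%fset -> (w `<=` level us L j.+1)%fset ->
    forall f, rk_set (Hu w) f ->
    (variance (power P _) (ra_eval (Q j) (anchor a) f) <= (vb j * rk_norm (Hu w) f ^+ 2)%:E)%E.
  move=> gu wu wl f Hf; apply: (recolor_variance_le (Hu := Hu) (Qown0 j)) => //.
    by have [_ _ /(_ (n1 j (ltn_ord j)))] := Qjprop j.
  (* The coloring of the level is injective on its intersection with u, hence on the subset w. *)
  move=> x y xw yw; apply: (hphi _ u gu).
    by rewrite !inE (fsubsetP wu)// (fsubsetP wl).
  by rewrite !inE (fsubsetP wu)// (fsubsetP wl).
exists Q; split.
- by split => // i im; exact: (n_gt0 (Ordinal im)).
- move=> j; split => //; last by move=> u ul gu f; exact: (Qvar j u u gu (fsubset_refl u) ul).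
  by move=> u _ l _ i; exact: Qown.
- apply: (le_trans (multilevel_cost P Q HK price_ge0 price_mono m0 _ _ Xa)).
  + by move=> i im; exact: (level_mono us Lmono im).
  + case/fset0Pn: (usn0 0%N) => x xu; apply/fset0Pn; exists x.
    by move: xu; apply/fsubsetP; exact: (@sub_level us L 1 0).
  rewrite lee_fin; apply: le_trans cost; rewrite mulr_sumr; apply: ler_sum => i _.
  have Li : (0 < L i)%N.
    have [->//|i0] := eqVneq (i : nat) 0%N.
    by apply: (leq_ltn_trans (leq0n (L 0%N))); apply: Lmono; rewrite lt0n i0 ltn_ord.
  have om0 : (0 < om)%N.
    by apply: leq_trans (card_weight_le gam_order (gam_us 0%N)); rewrite cardfs_gt0.
  rewrite [leRHS]mulrCA ler_wpM2l// /Cc -[leRHS]mulrA ler_wpM2l// -mulrA.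
  have cl := @card_level us L om i (fun j => card_weight_le gam_order (gam_us j)).
  apply: (le_trans (price_mono _ _ cl)); apply: (le_trans (hA _ _)); first by rewrite muln_gt0 om0.
  by rewrite natrM powRM.
have gm i j : (i <= j)%N -> gam (us j) * kprod k (us j) (anchor a) (anchor a) <=
    gam (us i) * kprod k (us i) (anchor a) (anchor a).
  by move=> ij; rewrite -!gE; exact: g_anti.
have tail J : \sum_(lvl L m <= j < J) gam (us j) * kprod k (us j) (anchor a) (anchor a) <= tb.
  by under eq_bigr do rewrite -gE; have := htb J; case: (m) m0.
pose S := \sum_(i < m) vb i * g (lvl L i).
have tb_ge0 : 0 <= tb by have := htb 0%N; rewrite big_geq.
have S_ge0 : 0 <= S by apply: sumr_ge0 => i _; rewrite mulr_ge0.
pose C0 := 2 * tb + 8 * (1 + r)%:R * K1 * K2 * S.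
have C0_ge0 : 0 <= C0 by rewrite /C0 addr_ge0// !mulr_ge0.
have core J l : (\int[power P (ml_index us L m)]_o (((\sum_(p <- l) p.1) - ml_eval (anchor a) Q
      (fun x => \sum_(j < J.+1) gam (supp us j) * kspan (kprod k (supp us j)) l x) o) ^+ 2)%:E <=
   (C0 * \sum_(j < J.+1) gam (supp us j) * kform (kprod k (supp us j)) l l)%:E)%E.
  have := multilevel_error k_meas k_int k_mean Lmono gam_us gam0 usn0 vb_ge0 Qown Qw Qvar
    K1_ge0 K2_ge0 hK1 (fun j => hK2 _ (gam_us j)) gm hB tail J l m0.
  by under [X in 8 * _ * _ * _ * X]eq_bigr do rewrite -gE.
have C0C : 4 * C0 <= C * N%:R `^ (- th).
  apply: le_trans err; rewrite -/S /C0 /Ce.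
  have : 0 <= (1 + r)%:R * K1 * K2 * tb by rewrite !mulr_ge0.
  by lra.
move=> e dec'.
have main : (e ^+ 2 <= (C * N%:R `^ (- th))%:E)%E.
  apply: (@le_trans _ _ (4 * C0)%:E); last by rewrite lee_fin.
  apply: rerror_sqr_le => f Hf.
  exact: (unit_ball_error hmu k_meas hM k_mean k_ge0 k_int Hu gam_ge0 gam0 gam_sum us_inj
    us_range hX C0_ge0 core Hf).
split => h.
- by move: main; rewrite /th /dec h opprB addrC.
- have {h} /andP[h1 h2] := h.
  have thE : th = (fine dec' - 1) / s - delta by rewrite /th /dec -/dec' leNgt h2 h1.
  by move: main; rewrite thE opprB addrC.
Qed.
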